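(* Let $\nu>0$ be any positive real number. There is a constant $C>0$, depending only on $\nu$, such that for every centered random variable $F$ admitting a finite chaos expansion with $\mathbb{E}[F^2]=2\nu$, and with $G(\nu)\sim CenteredGamma(\nu)$, $$d_{Kol}(F,G(\nu))\le\begin{cases}C\,\operatorname{Var}(\Gamma_1(F)-2F)^{1/4},&\text{if }\nu\ge2,\\ C\,\operatorname{Var}(\Gamma_1(F)-2F)^{\frac{\nu}{2(\nu+2)}},&\text{if }\nu\in(0,2).\end{cases}$$
   Context: $d_{Kol}(X,Y)=\sup_{x\in\mathbb{R}}|P(X\le x)-P(Y\le x)|$ is the Kolmogorov distance. $F$ admits a finite chaos expansion if $F=\sum_{q=0}^m I_q(f_q)$ for some finite $m$, where $I_q$ is the $q$-th multiple Wiener–Itô integral with respect to an isonormal Gaussian process over a real separable Hilbert space $\mathfrak{H}$ and $f_q\in\mathfrak{H}^{\odot q}$. $\Gamma_1(F)=\langle DF,-DL^{-1}F\rangle_{\mathfrak{H}}$, where $D$ is the Malliavin derivative and $L^{-1}F=-\sum_{p\ge1}\frac1pI_p(f_p)$. $CenteredGamma(\nu)$ is the law of $2\widehat{G}(\nu/2)-\nu$, with $\widehat{G}(\nu/2)$ having density $x^{\nu/2-1}e^{-x}\Gamma(\nu/2)^{-1}\mathbf{1}_{(0,\infty)}(x)$. *)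

(* Defs.v *)
(* MathComp-Analysis, over an arbitrary R : realType. *)
From HB Require Import structures.
From mathcomp Require Import all_boot all_order all_algebra all_fingroup.
From mathcomp Require Import all_classical all_reals all_analysis.

Set Implicit Arguments.
Unset Strict Implicit.
Unset Printing Implicit Defensive.

Import Order.TTheory GRing.Theory Num.Theory.
Import numFieldNormedType.Exports.

Local Open Scope classical_set_scope.
Local Open Scope ring_scope.

Definition kolmogorov_distance (R : realType)
    (d d' : measure_display) (T : measurableType d) (T' : measurableType d')
    (P : probability T R) (Q : probability T' R)
    (X : T -> R) (Y : T' -> R) : \bar R :=
  ereal_sup (range (fun x : R =>
    `|P [set w | (X w <= x)%R] - Q [set w | (Y w <= x)%R]|%E)).

Definition gamma_fun (R : realType) (a : R) : R :=
  \int[lebesgue_measure]_(x in `]0%R, +oo[) (x `^ (a - 1) * expR (- x)).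

Definition gamma_pdf (R : realType) (a x : R) : R :=
  if 0 < x then x `^ (a - 1) * expR (- x) / gamma_fun a else 0.

Definition gamma_law (R : realType) (a : R) (A : set R) : \bar R :=
  (\int[lebesgue_measure]_(x in A) (gamma_pdf a x)%:E)%E.

(* The law of 2 Ghat - nu, where Ghat has law [gamma_law (nu / 2)]. *)
Definition centered_gamma_law (R : realType) (nu : R) (A : set R) : \bar R :=
  gamma_law (nu / 2) ((fun x => 2 * x - nu) @^-1` A).

(* [normal_prob m 0] is a junk value in the library (the uniform law on
   [0, 1]); the degenerate Gaussian law is the Dirac mass at m. *)
Definition gaussian_law (R : realType) (m s : R) (A : set R) : \bar R :=
  if s == 0 then \d_m A else normal_prob m s A.

Definition has_law (R : realType) (d : measure_display) (T : measurableType d)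
    (P : probability T R) (X : T -> R) (mu : set R -> \bar R) : Prop :=
  forall A : set R, measurable A -> P (X @^-1` A) = mu A.

Record hilbert_product (R : realType) (H : completeNormedModType R)
    (ip : H -> H -> R) : Prop := HilbertProduct {
  ip_sym : forall x y, ip x y = ip y x ;
  ip_lin : forall (a : R) x y z, ip (a *: x + y) z = a * ip x z + ip y z ;
  ip_norm : forall x, `|x| ^+ 2 = ip x x }.

Definition separable (T : topologicalType) : Prop :=
  exists2 S : set T, countable S & dense S.

Section Tensors.
Context (R : realType) (H : completeNormedModType R) (ip : H -> H -> R).

(* The Hilbert tensor power of order q of H is modelled by the
   Hilbert-Schmidt q-linear forms on H: the tensor f corresponds to the form
   (g_1, ..., g_q) |-> < f, g_1 (x) ... (x) g_q >. *)

Definition upd (q : nat) (g : 'I_q -> H) (i : 'I_q) (x : H) : 'I_q -> H :=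
  fun j => if j == i then x else g j.

Definition multilinear (q : nat) (f : ('I_q -> H) -> R) : Prop :=
  forall (i : 'I_q) (g : 'I_q -> H) (a : R) (x y : H),
    f (upd g i (a *: x + y)) = a * f (upd g i x) + f (upd g i y).

Definition symmetric_form (q : nat) (f : ('I_q -> H) -> R) : Prop :=
  forall (s : 'S_q) (g : 'I_q -> H), f (fun i => g (s i)) = f g.

Definition orthonormal_family (n : nat) (e : 'I_n -> H) : Prop :=
  forall i j, ip (e i) (e j) = (i == j)%:R.

(* Squared Hilbert-Schmidt norm, the sum of f(e_{i_1}, ..., e_{i_q})^2 over an
   orthonormal basis (e_i); taking the supremum over all finite orthonormal
   families makes it independent of a basis, and makes every multilinear form
   of finite norm bounded. *)
Definition hs_norm2 (q : nat) (f : ('I_q -> H) -> R) : \bar R :=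
  ereal_sup [set z : \bar R | exists n : nat, exists e : 'I_n -> H,
    orthonormal_family e /\
    z = (\sum_(t : {ffun 'I_q -> 'I_n}) f (fun i => e (t i)) ^+ 2)%:E].

Record symmetric_tensor (q : nat) (f : ('I_q -> H) -> R) : Prop :=
  SymmetricTensor {
    st_lin : multilinear f ;
    st_sym : symmetric_form f ;
    st_fin : (hs_norm2 f < +oo)%E }.

(* The tensor \sum_p p.1 *: p.2^{(x) q}. *)
Definition tensor_powers (q : nat) (s : seq (R * H)) : ('I_q -> H) -> R :=
  fun g => \sum_(p <- s) p.1 * \prod_(i < q) ip p.2 (g i).

End Tensors.

(* Probabilists' Hermite polynomials, normalized to be monic. *)
Fixpoint hermite (R : realType) (q : nat) : {poly R} :=
  if q is q'.+1 then 'X * hermite R q' - (hermite R q')^`() else 1.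

Section SmoothFunctions.
Context (R : realType) (n : nat).

Definition partial (i : 'I_n.+1) (g : 'rV[R]_n.+1 -> R) : 'rV[R]_n.+1 -> R :=
  fun x => 'D_(delta_mx 0 i) g x.

Definition poly_growth (g : 'rV[R]_n.+1 -> R) : Prop :=
  exists (C : R) (k : nat), forall x, `|g x| <= C * (1 + `|x|) ^+ k.

(* C^oo functions all of whose partial derivatives have polynomial growth. *)
Definition smooth_poly_growth (g : 'rV[R]_n.+1 -> R) : Prop :=
  forall s : seq 'I_n.+1,
    (forall x, differentiable (foldr partial g s) x) /\
    poly_growth (foldr partial g s).

End SmoothFunctions.

Section Malliavin.
Context (R : realType) (H : completeNormedModType R) (ip : H -> H -> R).
Context (d : measure_display) (T : measurableType d) (P : probability T R).

Record isonormal (W : H -> {RV P >-> R}) : Prop := Isonormal {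
  iso_gaussian : forall (n : nat) (a : 'I_n -> R) (h : 'I_n -> H),
    exists m s : R,
      has_law P (fun w => \sum_(i < n) a i * W (h i) w) (gaussian_law m s) ;
  iso_centered : forall h, ('E_P[W h] = 0)%E ;
  iso_covariance : forall h g,
    ('E_P[fun w => (W h w * W g w)%R] = (ip h g)%:E)%E }.

Variable W : H -> {RV P >-> R}.

Definition cvg_L2 (V : normedModType R) (Xn : nat -> T -> V) (X : T -> V) :
    Prop :=
  (fun n => \int[P]_w (`|Xn n w - X w| ^+ 2)%:E)%E @ \oo --> 0%E.

(* I_q (h^{(x) q}) = H_q (W h) for a unit vector h, extended linearly. *)
Definition wiener_ito_powers (q : nat) (s : seq (R * H)) : T -> R :=
  fun w => \sum_(p <- s) p.1 * (hermite R q).[W p.2 w].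

(* X is a version of I_q(f): I_q is the continuous linear extension of
   [wiener_ito_powers] to the symmetric tensors.  For q = 0 one has
   h^{(x) 0} = 1 and H_0 = 1 whatever h is, so the unit vector condition is
   dropped, which keeps the constants when H = 0. *)
Definition is_wiener_ito (q : nat) (f : ('I_q -> H) -> R) (X : {RV P >-> R}) :
    Prop :=
  symmetric_tensor ip f /\
  exists s : nat -> seq (R * H),
    [/\ forall k p, p \in s k -> (0 < q)%N -> `|p.2| = 1,
        (fun k => hs_norm2 ip (fun g => tensor_powers ip (s k) g - f g))
          @ \oo --> 0%E
      & @cvg_L2 R^o (fun k => wiener_ito_powers q (s k)) X].

(* F = \sum_(q <= m) I_q(f_q), where X_q is a version of I_q(f_q). *)
Definition chaos_expansion (m : nat) (f : forall q, ('I_q -> H) -> R)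
    (X : nat -> {RV P >-> R}) (F : {RV P >-> R}) : Prop :=
  (forall q, (q <= m)%N -> is_wiener_ito (f q) (X q)) /\
  {ae P, forall w, F w = \sum_(0 <= q < m.+1) X q w}.

Definition finite_chaos (F : {RV P >-> R}) : Prop :=
  exists m f X, chaos_expansion m f X F.

(* V is a version of L^{-1} F, for F with a finite chaos expansion. *)
Definition is_Linv (F V : {RV P >-> R}) : Prop :=
  exists m f X, chaos_expansion m f X F /\
    {ae P, forall w, V w = - \sum_(1 <= q < m.+1) q%:R^-1 * X q w}.

(* F is the cylindrical functional g(W h_1, ..., W h_n) and
   DF = \sum_i (d_i g)(W h_1, ..., W h_n) h_i. *)
Definition smooth_derivative (F : T -> R) (DF : T -> H) : Prop :=
  exists n : nat, exists h : 'I_n.+1 -> H, exists g : 'rV[R]_n.+1 -> R,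
    [/\ smooth_poly_growth g,
        F = (fun w => g (\row_i W (h i) w))
      & DF = (fun w => \sum_i partial i g (\row_j W (h j) w) *: h i)].

Definition borel_measurable (u : T -> H) : Prop :=
  forall U : set H, open U -> measurable (u @^-1` U).

(* u is a version of DF: D is the closure of its restriction to smooth
   functionals, as an operator from L^2(P) to L^2(P; H). *)
Definition is_malliavin_derivative (F : {RV P >-> R}) (u : T -> H) : Prop :=
  borel_measurable u /\
  exists (Fn : nat -> T -> R) (un : nat -> T -> H),
    [/\ forall k, smooth_derivative (Fn k) (un k),
        @cvg_L2 R^o Fn F & cvg_L2 un u].

(* G is a version of Gamma_1(F) = < DF, - D L^{-1} F >. *)
Definition is_Gamma1 (F G : {RV P >-> R}) : Prop :=
  exists (V : {RV P >-> R}) (u v : T -> H),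
    [/\ is_Linv F V, is_malliavin_derivative F u, is_malliavin_derivative V v
      & {ae P, forall w, G w = ip (u w) (- v w)}].

End Malliavin.

(* Main.v *)
(* Let a = nu / 2 and Y = (F + nu) / 2, to be compared with the Gamma(a) law.
   Integration by parts gives E[F phi(F)] = E[Gamma_1(F) phi'(F)]: if
   delta is the adjoint of D, the operator delta D multiplies the q-th chaos by q,
   hence inverts - L^{-1}, and E[< D V, D phi(F) >] = E[V delta D phi(F)] with
   V = L^{-1} F. For z > 0 let g be the bounded solution of the Stein equation
   x g' - (x - a) g = 1_{x <= z} - m, where m is the Gamma(a) mass of ]-oo, z].
   Taking phi(y) = g((y + nu) / 2) yields
     P(Y <= z) - m = E[(2 F + 2 nu - Gamma_1(F)) g'(Y)] / 4.
   As E[Gamma_1(F)] = E[F^2] = 2 nu, and g' is of order 1 / alpha when z >= alpha,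
   this is at most (C / alpha) Var(Gamma_1(F) - 2 F)^{1/2}. For z < alpha one
   compares with alpha instead, at the cost of the mass of ]0, alpha], which is of
   order alpha^a. The choice alpha^(a + 1) = Var^{1/2} gives the exponent
   nu / (2 (nu + 2)), which is at least 1/4 exactly when nu >= 2. *)
Require Import Defs.
From HB Require Import structures.
From mathcomp Require Import all_boot all_order all_algebra all_fingroup.
From mathcomp Require Import all_classical all_reals all_analysis.
From mathcomp Require Import measurable_realfun ring lra.

Set Implicit Arguments.
Unset Strict Implicit.
Unset Printing Implicit Defensive.

Import Order.TTheory GRing.Theory Num.Theory.
Import numFieldNormedType.Exports.

Local Open Scope classical_set_scope.
Local Open Scope ring_scope.

(** * Expectations *)

(** The solution g has a kink at z, and nothing is known about the mass that the law of F puts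
    there. Integration by parts must therefore hold with a derivative defined at every point:
    [stein'] is the left derivative, and the Stein equation holds with it everywhere. The formula is
    proved for C^2 functions, because the coefficients of D phi(F_n) have to be differentiable in
    turn, and reaches C^1 and then Lipschitz functions by averaging to the left of each point. W is
    given only through the Gaussian laws of its linear combinations. These fix the characteristic
    functions, hence the joint laws, and allow W h to be replaced by a Gaussian variable independent
    of the remaining coordinates; integration by parts then takes place on the real line. Y may be
    negative, and x^(a - 1) is singular at 0 for a < 1. Left of z, g is therefore a multiple of an
    entire function, [kum]. Between z and a fixed threshold, g' is read off the equation after a
    division by x >= alpha, which is the origin of the factor 1 / alpha. *)

Section Expectation.
Context (d : measure_display) (T : measurableType d) (R : realType).
Variable P : probability T R.
Implicit Types (f g h X Y : T -> R).

Definition L1 f : Prop := P.-integrable setT (EFin \o f).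
Definition L2 f : Prop := measurable_fun setT f /\ L1 (fun w => f w ^+ 2).
Definition Ex f : R := \int[P]_w f w.

Lemma L1_meas f : L1 f -> measurable_fun setT f.
Proof. by move=> /integrableP[/measurable_EFinP]. Qed.

Lemma L1_le f g : measurable_fun setT f -> (forall w, `|f w| <= g w) ->
  L1 g -> L1 f.
Proof.
move=> mf fg ig; apply: (le_integrable measurableT _ _ ig).
  exact/measurable_EFinP.
move=> w _; rewrite /= lee_fin (le_trans (fg w))//; exact: ler_norm.
Qed.

Lemma L1_cst c : L1 (fun=> c).
Proof. exact: finite_measure_integrable_cst. Qed.

Lemma L1D f g : L1 f -> L1 g -> L1 (fun w => f w + g w).
Proof.
by move=> i1 i2; exact: (integrableD measurableT i1 i2).
Qed.

Lemma L1B f g : L1 f -> L1 g -> L1 (fun w => f w - g w).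
Proof.
by move=> i1 i2; exact: (integrableB measurableT i1 i2).
Qed.

Lemma L1Z c f : L1 f -> L1 (fun w => c * f w).
Proof.
by move=> i1; exact: (integrableZl measurableT c i1).
Qed.

Lemma L1_norm f : L1 f -> L1 (fun w => `|f w|).
Proof. by move=> i; exact: (integrable_norm i). Qed.

Lemma L1_sum (I : Type) (s : seq I) (F : I -> T -> R) :
  (forall i, L1 (F i)) -> L1 (fun w => \sum_(i <- s) F i w).
Proof.
move=> iF; elim: s => [|i s IH].
  by under eq_fun do rewrite big_nil; exact: L1_cst.
by under eq_fun do rewrite big_cons; exact: L1D.
Qed.

Lemma L1_bounded f c : measurable_fun setT f -> (forall w, `|f w| <= c) -> L1 f.
Proof. by move=> mf fc; apply: (L1_le mf fc); exact: L1_cst. Qed.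

Lemma Ex_cst c : Ex (fun=> c) = c.
Proof. by rewrite /Ex Rintegral_cst// [X in fine X]probability_setT mulr1. Qed.

Lemma ExD f g : L1 f -> L1 g -> Ex (fun w => f w + g w) = Ex f + Ex g.
Proof. by move=> i1 i2; rewrite /Ex RintegralD. Qed.

Lemma ExB f g : L1 f -> L1 g -> Ex (fun w => f w - g w) = Ex f - Ex g.
Proof. by move=> i1 i2; rewrite /Ex RintegralB. Qed.

Lemma ExZ c f : L1 f -> Ex (fun w => c * f w) = c * Ex f.
Proof. by move=> i1; rewrite /Ex RintegralZl. Qed.

Lemma Ex_sum (I : Type) (s : seq I) (F : I -> T -> R) :
  (forall i, L1 (F i)) ->
  Ex (fun w => \sum_(i <- s) F i w) = \sum_(i <- s) Ex (F i).
Proof.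
move=> iF; elim: s => [|i s IH].
  by under eq_fun do rewrite big_nil; rewrite Ex_cst big_nil.
under eq_fun do rewrite big_cons; rewrite ExD//; last exact: L1_sum.
by rewrite IH big_cons.
Qed.

Lemma Ex_le f g : L1 f -> L1 g -> (forall w, f w <= g w) -> Ex f <= Ex g.
Proof. by move=> i1 i2 fg; apply: le_Rintegral => // w _. Qed.

Lemma Ex_ge0 f : (forall w, 0 <= f w) -> 0 <= Ex f.
Proof. by move=> f0; apply: Rintegral_ge0 => w _. Qed.

Lemma Ex_norm f : L1 f -> `|Ex f| <= Ex (fun w => `|f w|).
Proof. by move=> i; exact: le_normr_Rintegral. Qed.

Lemma eq_Ex f g : f =1 g -> Ex f = Ex g.
Proof. by move=> fg; apply: eq_Rintegral => w _. Qed.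

Lemma EFin_Ex f : L1 f -> (\int[P]_w (f w)%:E)%E = (Ex f)%:E.
Proof. by move=> i; rewrite /Ex /Rintegral fineK//; exact: integrable_fin_num. Qed.

Lemma Ex_ae f g : measurable_fun setT f -> measurable_fun setT g ->
  {ae P, forall w, f w = g w} -> Ex f = Ex g.
Proof.
move=> mf mg fg; rewrite /Ex /Rintegral; congr fine.
apply: ae_eq_integral => //; [exact/measurable_EFinP|exact/measurable_EFinP|].
by apply: filterS fg => w /= -> _.
Qed.

Lemma L1_ae f g : measurable_fun setT g ->
  {ae P, forall w, `|g w| <= f w} -> L1 f -> L1 g.
Proof.
move=> mg gf i; apply/integrableP; split; first exact/measurable_EFinP.
have /integrableP[mf] := i; apply: le_lt_trans.
apply: ae_ge0_le_integral => //.
- by apply: measurableT_comp => //; exact/measurable_EFinP.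
- by apply: measurableT_comp.
- apply: filterS gf => w gf _ /=; rewrite lee_fin (le_trans gf)//; exact: ler_norm.
Qed.

Lemma Ex_ae_le f g : L1 f -> L1 g ->
  {ae P, forall w, f w <= g w} -> Ex f <= Ex g.
Proof.
move=> i1 i2 fg.
(* [g] is replaced by f + max(0, g - f), which equals it almost everywhere and dominates [f] at
   every point. *)
have im : L1 (fun w => Num.max 0 (g w - f w)).
  apply: (L1_le _ _ (L1_norm (L1B i2 i1))).
    by apply: measurable_maxr => //; apply: measurable_funB; exact: L1_meas.
  move=> w; rewrite ger0_norm ?le_max ?lexx// ge_max normr_ge0/=; exact: ler_norm.
have <- : Ex (fun w => f w + Num.max 0 (g w - f w)) = Ex g.
  apply: Ex_ae; first exact/L1_meas/L1D.
    exact: L1_meas.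
  apply: filterS fg => w fg; rewrite max_r ?subr_ge0//; ring.
rewrite ExD// lerDl; apply: Ex_ge0 => w; by rewrite le_max lexx.
Qed.

Lemma dominated_Ex (fn : nat -> T -> R) f g :
  (forall n, measurable_fun setT (fn n)) ->
  (forall w, (fn n w) @[n --> \oo] --> f w) ->
  (forall n w, `|fn n w| <= g w) -> L1 g ->
  L1 f /\ Ex (fn n) @[n --> \oo] --> Ex f.
Proof.
move=> mfn cf fg ig.
have mf : measurable_fun setT f.
  apply: (measurable_fun_cvg (h := fn)) => // w _; exact: cf.
have [i _ c] : [/\ P.-integrable setT (EFin \o f),
  [sequence \int[P]_(x in setT) `|(fn n x)%:E - (f x)%:E|]_n @ \oo --> 0 &
  [sequence \int[P]_(x in setT) (fn n x)%:E]_n @ \oo --> \int[P]_(x in setT) (f x)%:E]%E.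
  apply: (@dominated_convergence _ _ _ P setT measurableT (fun n w => (fn n w)%:E) (EFin \o f) (EFin \o g)).
  - by move=> n; exact/measurable_EFinP.
  - exact/measurable_EFinP.
  - by apply: aeW => w _; apply: cvg_EFin; [exact: nearW|exact: cf].
  - exact: ig.
  - by apply: aeW => w n _ /=; rewrite lee_fin.
split=> //; rewrite /Ex /Rintegral; apply: fine_cvg.
by rewrite fineK//; exact: integrable_fin_num.
Qed.

Lemma L2_meas f : L2 f -> measurable_fun setT f. Proof. by case. Qed.

Lemma L2_le f g : measurable_fun setT f -> (forall w, `|f w| <= `|g w|) ->
  L2 g -> L2 f.
Proof.
move=> mf fg [_ ig]; split => //; apply: (L1_le _ _ ig).
  exact: measurable_funX.
by move=> w; rewrite normrX -[leRHS]real_normK ?num_real// lerXn2r ?nnegrE.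
Qed.

Lemma L2M f g : L2 f -> L2 g -> L1 (fun w => f w * g w).
Proof.
move=> [mf i1] [mg i2]; apply: (L1_le _ _ (L1D i1 i2)).
  exact: measurable_funM.
move=> w; rewrite normrM -[f w ^+ 2]real_normK ?num_real//.
rewrite -[g w ^+ 2]real_normK ?num_real//; nra.
Qed.

Lemma L2_cst c : L2 (fun=> c).
Proof. by split; [exact: measurable_cst|exact: L1_cst]. Qed.

Lemma L2_L1 f : L2 f -> L1 f.
Proof.
move=> i; have := L2M i (L2_cst 1); apply: eq_integrable => // w _ /=.
by rewrite mulr1.
Qed.

Lemma L2D f g : L2 f -> L2 g -> L2 (fun w => f w + g w).
Proof.
move=> [mf i1] [mg i2]; split; first exact: measurable_funD.
apply: (L1_le _ _ (L1Z 2 (L1D i1 i2))).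
  by apply: measurable_funX; exact: measurable_funD.
move=> w; rewrite ger0_norm ?sqr_ge0//.
have := sqr_ge0 (f w - g w); rewrite sqrrB sqrrD; lra.
Qed.

Lemma L2Z c f : L2 f -> L2 (fun w => c * f w).
Proof.
move=> [mf i1]; split; first exact: measurable_funM.
by under eq_fun do rewrite exprMn; exact: L1Z.
Qed.

Lemma L2B f g : L2 f -> L2 g -> L2 (fun w => f w - g w).
Proof.
move=> i1 i2; have := L2D i1 (L2Z (-1) i2).
by under eq_fun do rewrite mulN1r.
Qed.

Lemma L2_norm f : L2 f -> L2 (fun w => `|f w|).
Proof.
move=> i; apply: (L2_le _ _ i) => [|w]; last by rewrite normr_id.
by apply: measurableT_comp => //; exact: L2_meas.
Qed.

(* AM-GM with a free parameter; optimizing over it gives Cauchy-Schwarz. *)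
Lemma Ex_cauchy_schwarz f g : L2 f -> L2 g ->
  Ex (fun w => `|f w * g w|) <=
  Num.sqrt (Ex (fun w => f w ^+ 2)) * Num.sqrt (Ex (fun w => g w ^+ 2)).
Proof.
move=> i1 i2; set a := Num.sqrt _; set b := Num.sqrt _.
have a0 : 0 <= a by exact: sqrtr_ge0.
have b0 : 0 <= b by exact: sqrtr_ge0.
have aE : Ex (fun w => f w ^+ 2) = a ^+ 2.
  by rewrite sqr_sqrtr//; apply: Ex_ge0 => w; exact: sqr_ge0.
have bE : Ex (fun w => g w ^+ 2) = b ^+ 2.
  by rewrite sqr_sqrtr//; apply: Ex_ge0 => w; exact: sqr_ge0.
have key t : 0 < t -> Ex (fun w => `|f w * g w|) <= 2^-1 * (t * a ^+ 2 + t^-1 * b ^+ 2).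
  move=> t0; rewrite -aE -bE.
  have [_ j1] := i1; have [_ j2] := i2.
  rewrite -ExZ// -ExZ// -ExD; [|exact: L1Z|exact: L1Z].
  rewrite -ExZ; last by apply: L1D; exact: L1Z.
  apply: Ex_le; first exact/L1_norm/L2M.
    by apply: L1Z; apply: L1D; exact: L1Z.
  move=> w; rewrite normrM -[f w ^+ 2]real_normK ?num_real//.
  rewrite -[g w ^+ 2]real_normK ?num_real//.
  set x := `|f w|; set y := `|g w|.
  have := sqr_ge0 (t * x - y) => h.
  rewrite -(ler_pM2l t0).
  have -> : t * (2^-1 * (t * x ^+ 2 + t^-1 * y ^+ 2)) =
    2^-1 * (t^+2 * x ^+ 2 + y ^+ 2) by field; rewrite gt_eqF.
  nra.
suff H e : 0 < e -> e <= 1 -> Ex (fun w => `|f w * g w|) <= a * b + e.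
  apply/ler_addgt0Pr => e e0; have [|/ltW e1] := leP e 1; first exact: H.
  by rewrite (le_trans (H 1 _ _))// lerD2l.
move=> e0 small.
(* The optimal parameter is t = b / a. Both norms are shifted by q = e / (1 + a + b) to keep t
   defined and positive; as q <= 1, the product grows by q (a + b) + q^2 <= e. *)
pose al := a + e / (1 + a + b); pose be := b + e / (1 + a + b).
have s0 : 0 < 1 + a + b by lra.
have q0 : 0 < e / (1 + a + b) by exact: divr_gt0.
have al0 : 0 < al by rewrite /al; lra.
have be0 : 0 < be by rewrite /be; lra.
have := key (be / al); rewrite divr_gt0// => /(_ isT) /le_trans; apply.
have h1 : be / al * a ^+ 2 <= be * al.
  rewrite -mulrA ler_pM2l// ler_pdivrMl// -expr2 lerXn2r ?nnegrE//; [exact: ltW|].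
  rewrite /al; lra.
have h2 : (be / al)^-1 * b ^+ 2 <= be * al.
  rewrite invf_div mulrC mulrA mulrAC ler_pM2r// ler_pdivrMr// -expr2 lerXn2r ?nnegrE//; [exact: ltW|].
  rewrite /be; lra.
have h3 : be * al <= a * b + e.
  rewrite /be /al; set q := e / _ in q0 *.
  have qE : q * (1 + a + b) = e by rewrite /q divfK// gt_eqF.
  have q1 : q <= 1 by nra.
  nra.
lra.
Qed.

Definition cvgL2 (Xn : nat -> T -> R) X :=
  Ex (fun w => (Xn n w - X w) ^+ 2) @[n --> \oo] --> (0 : R).

Lemma cvgL2_Ex (Xn : nat -> T -> R) X Y :
  (forall n, L2 (Xn n)) -> L2 X -> L2 Y -> cvgL2 Xn X ->
  Ex (fun w => Xn n w * Y w) @[n --> \oo] --> Ex (fun w => X w * Y w).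
Proof.
move=> iXn iX iY c; apply/subr_cvg0.
apply/norm_cvg0P.
apply: (@squeeze_cvgr _ _ _ _ (cst 0) (fun n =>
  Num.sqrt (Ex (fun w => (Xn n w - X w) ^+ 2)) * Num.sqrt (Ex (fun w => Y w ^+ 2)))).
- apply: nearW => n; rewrite normr_ge0/=.
  rewrite -ExB; [|exact: L2M|exact: L2M].
  apply: le_trans (Ex_cauchy_schwarz (L2B (iXn n) iX) iY).
  under eq_fun do rewrite -mulrBl.
  by apply: Ex_norm; apply: L2M => //; exact: L2B.
- exact: cvg_cst.
- rewrite -[X in _ --> X](mul0r (Num.sqrt (Ex (fun w => Y w ^+ 2)))).
  apply: cvgM; last exact: cvg_cst.
  rewrite -(@sqrtr0 R).
  by apply: (cvg_comp _ Num.sqrt c); exact: sqrt_continuous.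
Qed.

End Expectation.

(** * Laws determined by characteristic functions *)

Section SignApproximation.
Context (R : realType).
Implicit Types (s t c : R).

(* Iterating [sign_step] drives every nonzero s in [-1, 1] to its sign, so that
   signs of coordinates are iterated limits of trigonometric polynomials. *)
Definition sign_step s : R := (3 * s - s ^+ 3) / 2.

Lemma sign_step_itv s : 0 <= s <= 1 -> s <= sign_step s <= 1.
Proof.
move=> /andP[s0 s1]; rewrite /sign_step; apply/andP; split.
  have : 0 <= s * (1 - s) * (1 + s) by rewrite !mulr_ge0//; lra.
  lra.
have : 0 <= (1 - s) * (1 - s) * (2 + s) by rewrite !mulr_ge0//; lra.
lra.
Qed.

Lemma iter_sign_step_itv k s : 0 <= s <= 1 -> s <= iter k sign_step s <= 1.
Proof.
move=> s01; elim: k => [|k /andP[h1 h2]] /=.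
  by move/andP: s01 => [_ ->]; rewrite lexx.
have [s0 _] := andP s01.
have /andP[h3 h4] : iter k sign_step s <= sign_step (iter k sign_step s) <= 1.
  by apply: sign_step_itv; rewrite (le_trans s0 h1).
by rewrite h4 (le_trans h1 h3).
Qed.

(** The distance to 1 is multiplied at each step by (1 - u) (2 + u) / 2 = 1 - u / 2 - u^2 / 2, where
    u is the current value; iterates never drop below s, so this factor is at most 1 - s / 2. *)
Lemma iter_sign_step_geom k s : 0 <= s <= 1 ->
  1 - iter k sign_step s <= (1 - s / 2) ^+ k.
Proof.
move=> s01; have /andP[s0 s1] := s01; elim: k => [|k IH] /=.
  by rewrite expr0; lra.
have /andP[h1 h2] := iter_sign_step_itv k s01.
rewrite exprS; set u := iter k sign_step s in IH h1 h2 *.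
rewrite {1}/sign_step.
have -> : 1 - (3 * u - u ^+ 3) / 2 = ((1 - u) * (2 + u) / 2) * (1 - u) by field.
apply: ler_pM => //; [|lra|]; nra.
Qed.

Lemma iter_sign_stepN k s : iter k sign_step (- s) = - iter k sign_step s.
Proof. by elim: k => //= k ->; rewrite /sign_step; field. Qed.

Lemma cvg_iter_sign_step s : `|s| <= 1 ->
  iter k sign_step s @[k --> \oo] --> Num.sg s.
Proof.
have pos t : 0 < t -> t <= 1 -> iter k sign_step t @[k --> \oo] --> (1 : R).
  move=> t0 t1; have t01 : 0 <= t <= 1 by rewrite t1 ltW.
  have c : 1 - (1 - t / 2) ^+ k @[k --> \oo] --> (1 : R).
    rewrite -[X in _ --> X]subr0; apply: cvgB; first exact: cvg_cst.
    by apply: cvg_expr; rewrite ger0_norm; lra.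
  apply: (squeeze_cvgr _ c (@cvg_cst _ _ _ _ _)).
  apply: nearW => k; have /andP[_ ->] := iter_sign_step_itv k t01.
  by rewrite andbT lerBlDr -lerBlDl iter_sign_step_geom.
move=> s1; case: (sgrP s) s1 => [->|s0|s0] s1.
- rewrite (_ : (fun k => iter k sign_step 0) = fun=> 0); first exact: cvg_cst.
  by apply/funext; elim=> //= k ->; rewrite /sign_step expr0n/= mulr0 subrr mul0r.
- by apply: pos => //; rewrite -[s]gtr0_norm.
- have h : 0 < - s by rewrite oppr_gt0.
  have c : (- iter k sign_step (- s)) @[k --> \oo] --> (-1 : R).
    by apply: cvgN; exact: pos.
  suff -> : (fun k => iter k sign_step s) = (fun k => - iter k sign_step (- s)) by [].
  by apply/funext => k; rewrite iter_sign_stepN opprK.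
Qed.

Lemma iter_sign_step_norm k s : `|s| <= 1 -> `|iter k sign_step s| <= 1.
Proof.
have pos t : 0 <= t -> t <= 1 -> `|iter k sign_step t| <= 1.
  move=> t0 t1; have /(iter_sign_step_itv k)/andP[h1 h2] : 0 <= t <= 1 by rewrite t0.
  by rewrite ger0_norm// (le_trans t0).
have [s0 s1|s0 s1] := leP 0 s; first by apply: pos => //; rewrite -[s]ger0_norm.
by rewrite -(opprK s) iter_sign_stepN normrN pos// -?ltr0_norm// oppr_ge0 ltW.
Qed.

(** The argument eventually lies in ]-2, 2[, where the sine has the sign of its argument. Large
    periods thus recover the sign of t from trigonometric functions. *)
Lemma cvg_sg_sin t : Num.sg (sin (t / N.+1%:R)) @[N --> \oo] --> Num.sg t.
Proof.
apply: cvg_near_cst.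
near=> N.
have N0 : 0 < N.+1%:R :> R by rewrite ltr0n.
have sN : `|t| / N.+1%:R < 2.
  rewrite ltr_pdivrMr// (@lt_trans _ _ N.+1%:R)//; last first.
    by rewrite ltr_pMl// ltr1n.
  near: N; have [M _ hM] := @nbhs_infty_gtr R `|t|.
  by exists M => // k /= Mk; apply: hM => /=; apply: leq_trans Mk _.
case: (sgrP t) => [->|t0|t0].
- by rewrite mul0r sin0 sgr0.
- by rewrite gtr0_sg// sin2_gt0// divr_gt0//= -[t]gtr0_norm.
- rewrite -[t]opprK mulNr sinN sgrN gtr0_sg// sin2_gt0//.
  by rewrite divr_gt0 ?oppr_gt0//= -ltr0_norm.
Unshelve. all: end_near. Qed.

End SignApproximation.

Section LawFromCosines.
Context (R : realType) (n : nat).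
Implicit Types (l x : 'rV[R]_n) (b c : R) (f g : 'rV[R]_n -> R).

Definition dotv l x : R := \sum_i l 0 i * x 0 i.

(** The phase b brings in sines and constants, and the product-to-sum formula makes the class an
    algebra ([trigM]). A single constructor for linear combinations leaves two cases in each
    induction. *)
Inductive trigpoly : ('rV[R]_n -> R) -> Prop :=
| trig_cos l b : trigpoly (fun x => cos (dotv l x + b))
| trig_lin c f g : trigpoly f -> trigpoly g -> trigpoly (fun x => c * f x + g x).

Lemma eq_trig f g : f =1 g -> trigpoly f -> trigpoly g.
Proof. by move=> /funext ->. Qed.

Lemma trig0 : trigpoly (fun=> 0).
Proof.
apply: eq_trig (trig_lin (-1) (trig_cos 0 0) (trig_cos 0 0)) => x /=; ring.
Qed.

Lemma dotv0 x : dotv 0 x = 0.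
Proof. by rewrite /dotv big1// => i _; rewrite mxE mul0r. Qed.

Lemma dotvD l l' x : dotv (l + l') x = dotv l x + dotv l' x.
Proof.
by rewrite /dotv -big_split; apply: eq_bigr => i _; rewrite mxE mulrDl.
Qed.

Lemma dotvB l l' x : dotv (l - l') x = dotv l x - dotv l' x.
Proof.
by rewrite /dotv -sumrB; apply: eq_bigr => i _; rewrite !mxE mulrBl.
Qed.

Lemma trigZ c f : trigpoly f -> trigpoly (fun x => c * f x).
Proof. by move=> tf; apply: eq_trig (trig_lin c tf trig0) => x; rewrite addr0. Qed.

Lemma trigD f g : trigpoly f -> trigpoly g -> trigpoly (fun x => f x + g x).
Proof. by move=> tf tg; apply: eq_trig (trig_lin 1 tf tg) => x; rewrite mul1r. Qed.

Lemma trig_cst c : trigpoly (fun=> c).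
Proof.
apply: eq_trig (trigZ c (trig_cos 0 0)) => x.
by rewrite dotv0 addr0 cos0 mulr1.
Qed.

Lemma trigM f g : trigpoly f -> trigpoly g -> trigpoly (fun x => f x * g x).
Proof.
elim=> [l b|c f1 f2 _ IH1 _ IH2] tg; last first.
  apply: eq_trig (trig_lin c (IH1 tg) (IH2 tg)) => x /=; ring.
elim: tg => [l' b'|c g1 g2 _ IH1 _ IH2]; last first.
  apply: eq_trig (trig_lin c IH1 IH2) => x /=; ring.
apply: eq_trig (trigZ 2^-1 (trigD (trig_cos (l + l') (b + b'))
  (trig_cos (l - l') (b - b')))) => x.
rewrite dotvD dotvB.
have -> : dotv l x + dotv l' x + (b + b') = (dotv l x + b) + (dotv l' x + b') by ring.
have -> : dotv l x - dotv l' x + (b - b') = (dotv l x + b) - (dotv l' x + b') by ring.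
by rewrite cosB cosD; field.
Qed.

Lemma trig_bounded f : trigpoly f -> exists c, forall x, `|f x| <= c.
Proof.
elim=> [l b|c f1 f2 _ [c1 h1] _ [c2 h2]]; first by exists 1 => x; exact: cos_max.
exists (`|c| * c1 + c2) => x; rewrite (le_trans (ler_normD _ _))// lerD//.
by rewrite normrM ler_wpM2l.
Qed.

Lemma trig_sin_coord i c t : trigpoly (fun x => sin ((x 0 i - c) / t)).
Proof.
apply: eq_trig (trig_cos (t^-1 *: delta_mx 0 i) (- c / t - pi / 2)) => x.
have -> : dotv (t^-1 *: delta_mx 0 i) x = x 0 i / t.
  rewrite /dotv (bigD1 i)//= big1 => [|j ji]; rewrite !mxE eqxx/=.
    by rewrite eqxx mulr1 addr0 mulrC.
  by rewrite (negbTE ji) mulr0 mul0r.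
rewrite addrA -mulrDl cosB cos_pihalf sin_pihalf mulr0 add0r mulr1//.
Qed.

Lemma trig_iter_sign_step k f : trigpoly f ->
  trigpoly (fun x => iter k (@sign_step R) (f x)).
Proof.
move=> tf; elim: k => [//|k IH] /=.
apply: eq_trig (trigD (trigZ (3 / 2) IH) (trigZ (- 2^-1) (trigM IH (trigM IH IH)))).
by move=> x; rewrite /sign_step; field.
Qed.

Context (d d' : measure_display) (T : measurableType d) (T' : measurableType d').
Context (P : probability T R) (P' : probability T' R).
Variables (Z : T -> 'rV[R]_n) (Z' : T' -> 'rV[R]_n).
Hypothesis mZ : forall i, measurable_fun setT (fun w => Z w 0 i).
Hypothesis mZ' : forall i, measurable_fun setT (fun w => Z' w 0 i).
Hypothesis cosZ : forall l b,
  Ex P (fun w => cos (dotv l (Z w) + b)) = Ex P' (fun w => cos (dotv l (Z' w) + b)).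

Let meas f := measurable_fun setT (fun w => f (Z w)) /\
  measurable_fun setT (fun w => f (Z' w)).

(* The functions whose expectations under the two laws agree form a linear class
   closed under bounded limits. It contains the trigonometric polynomials, hence
   products of signs, indicators of cells, and finally continuous functions. *)
Let agree f := [/\ exists c, forall x, `|f x| <= c, meas f &
  Ex P (fun w => f (Z w)) = Ex P' (fun w => f (Z' w))].

Let agree_lim (fk : nat -> 'rV[R]_n -> R) f c : (forall k, agree (fk k)) ->
  (forall k x, `|fk k x| <= c) -> (forall x, fk k x @[k --> \oo] --> f x) ->
  agree f.
Proof.
move=> afk bfk cfk.
have bf x : `|f x| <= c.
  have h : `|fk k x| @[k --> \oo] --> `|f x| by apply: cvg_norm; exact: cfk.
  by apply: (cvgr_to_le h); apply: nearW.
have [i1 c1] := @dominated_Ex _ _ _ P (fun k w => fk k (Z w)) (fun w => f (Z w))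
  (fun=> c) (fun k => let: And3 _ m _ := afk k in m.1) (fun w => cfk _)
  (fun k w => bfk k _) (L1_cst _ _).
have [i2 c2] := @dominated_Ex _ _ _ P' (fun k w => fk k (Z' w)) (fun w => f (Z' w))
  (fun=> c) (fun k => let: And3 _ m _ := afk k in m.2) (fun w => cfk _)
  (fun k w => bfk k _) (L1_cst _ _).
split; [by exists c|by split; [exact: L1_meas i1|exact: L1_meas i2]|].
apply: (cvg_unique _ c1) => //.
suff -> : (fun k => Ex P (fun w => fk k (Z w))) = (fun k => Ex P' (fun w => fk k (Z' w))) by [].
by apply/funext => k; have [] := afk k.
Qed.

Let agree_lin c f g : agree f -> agree g -> agree (fun x => c * f x + g x).
Proof.
move=> [[c1 b1] [m1 m1'] e1] [[c2 b2] [m2 m2'] e2]; split.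
- exists (`|c| * c1 + c2) => x; rewrite (le_trans (ler_normD _ _))// lerD//.
  by rewrite normrM ler_wpM2l.
- by split; apply: measurable_funD => //; apply: measurable_funM.
- have i1 := L1_bounded P m1 (fun w => b1 (Z w)).
  have i2 := L1_bounded P m2 (fun w => b2 (Z w)).
  have i3 := L1_bounded P' m1' (fun w => b1 (Z' w)).
  have i4 := L1_bounded P' m2' (fun w => b2 (Z' w)).
  by rewrite ExD ?ExD ?ExZ ?e1 ?e2//; exact: L1Z.
Qed.

Let eq_agree f g : f =1 g -> agree f -> agree g.
Proof. by move=> /funext ->. Qed.

Let agree_trig f : trigpoly f -> agree f.
Proof.
elim=> [l b|c f1 f2 _ a1 _ a2]; last exact: agree_lin.
split; [by exists 1 => x; exact: cos_max| |exact: cosZ].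
have mcos := continuous_measurable_fun (@continuous_cos R).
split; apply: (measurableT_comp mcos);
  apply: measurable_funD => //; apply: measurable_sum => i;
  exact: measurable_funM.
Qed.

Definition sgn_prod (L : seq ('I_n * R)) x : R :=
  \prod_(p <- L) Num.sg (x 0 p.1 - p.2).

Lemma sgn_prod_norm L x : `|sgn_prod L x| <= 1.
Proof.
rewrite /sgn_prod; elim: L => [|p L IH]; first by rewrite big_nil normr1.
rewrite big_cons normrM mulr_ile1// normr_sg; by case: (_ != 0).
Qed.

(** Signs are added one at a time. Since [f] is an arbitrary trigonometric polynomial, the induction
    hypothesis applies to [f] times an iterate of [sign_step] at a sine; then the number of
    iterations tends to infinity at a fixed period, and the period last. *)
Let agree_sgn_prod L f : trigpoly f -> agree (fun x => sgn_prod L x * f x).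
Proof.
elim: L f => [|[i c] L IH] f tf.
  apply: eq_agree (agree_trig tf) => x; by rewrite /sgn_prod big_nil mul1r.
have [cf bf] := trig_bounded tf.
have cf0 : 0 <= cf by rewrite (le_trans _ (bf 0)).
pose s N k x := iter k (@sign_step R) (sin ((x 0 i - c) / N.+1%:R)).
have bs N k x : `|s N k x| <= 1 by apply: iter_sign_step_norm; exact: sin_max.
have a1 N k : agree (fun x => sgn_prod L x * (s N k x * f x)).
  by apply: IH; apply: trigM => //; apply: trig_iter_sign_step; exact: trig_sin_coord.
have a2 N : agree (fun x => sgn_prod L x *
    (Num.sg (sin ((x 0 i - c) / N.+1%:R)) * f x)).
  apply: (agree_lim (c := cf) (a1 N)) => [k x|x].
    rewrite !normrM -[leRHS]mul1r ler_pM ?mulr_ge0 ?sgn_prod_norm//.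
    by rewrite -[leRHS]mul1r ler_pM.
  apply: cvgM; first exact: cvg_cst.
  apply: cvgM; last exact: cvg_cst.
  by apply: cvg_iter_sign_step; exact: sin_max.
have a3 : agree (fun x => sgn_prod L x * (Num.sg (x 0 i - c) * f x)).
  apply: (agree_lim (c := cf) a2) => [k x|x].
    rewrite !normrM -[leRHS]mul1r ler_pM ?mulr_ge0 ?sgn_prod_norm//.
    by rewrite -[leRHS]mul1r ler_pM// normr_sg; case: (_ != 0).
  apply: cvgM; first exact: cvg_cst.
  apply: cvgM; last exact: cvg_cst.
  exact: cvg_sg_sin.
apply: eq_agree a3 => x; rewrite /sgn_prod big_cons /=; ring.
Qed.

(** Quantifying over all products of signs makes the class stable under multiplication by one more
    sign, hence by indicators of half-spaces. *)
Let agree_mul f := forall L, agree (fun x => sgn_prod L x * f x).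

Let agree_mul_sg f i c : agree_mul f -> agree_mul (fun x => Num.sg (x 0 i - c) * f x).
Proof.
move=> af L; apply: eq_agree (af ((i, c) :: L)) => x.
rewrite /sgn_prod big_cons/=; ring.
Qed.

Let agree_mul_lin a f g : agree_mul f -> agree_mul g ->
  agree_mul (fun x => a * f x + g x).
Proof.
move=> af ag L; apply: eq_agree (agree_lin a (af L) (ag L)) => x /=; ring.
Qed.

Let eq_agree_mul f g : f =1 g -> agree_mul f -> agree_mul g.
Proof. by move=> /funext ->. Qed.

(** The indicator of a closed half-line is a quadratic polynomial in the sign, with the right value
    1 where the sign is 0. *)
Let geE (t c : R) : (c <= t)%R%:R = 1 + (Num.sg (t - c) - Num.sg (t - c) ^+ 2) / 2 :> R.
Proof.
have [h|h|->] := ltgtP c t.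
- by rewrite gtr0_sg ?subr_gt0//=; field.
- by rewrite ltr0_sg ?subr_lt0//=; field.
- by rewrite subrr sgr0/=; field.
Qed.

Let agree_mul_ge f i c : agree_mul f -> agree_mul (fun x => (c <= x 0 i)%R%:R * f x).
Proof.
move=> af.
have s1 := agree_mul_sg i c af.
have s2 := agree_mul_sg i c s1.
apply: eq_agree_mul (agree_mul_lin 2^-1 s1 (agree_mul_lin (- 2^-1) s2 af)) => x /=.
rewrite geE; ring.
Qed.

(** For a.1 <= a.2, the indicator of the half-open interval [a.1, a.2[; half-open cells tile the
    line. *)
Definition cell (a : R * R) (t : R) : R := (a.1 <= t)%R%:R - (a.2 <= t)%R%:R.

Let agree_mul_cells (a : 'I_n -> R * R) (s : seq 'I_n) :
  agree_mul (fun x => \prod_(j <- s) cell (a j) (x 0 j)).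
Proof.
elim: s => [|j s IH].
  move=> L; apply: eq_agree (agree_sgn_prod L (trig_cst 1)) => x.
  by rewrite big_nil.
apply: eq_agree_mul (agree_mul_lin (-1) (agree_mul_ge j (a j).2 IH)
  (agree_mul_ge j (a j).1 IH)) => x /=.
rewrite big_cons /cell; ring.
Qed.

Let agree_cells (a : 'I_n -> R * R) :
  agree (fun x => \prod_j cell (a j) (x 0 j)).
Proof.
apply: eq_agree (agree_mul_cells a (index_enum _) [::]) => x.
by rewrite /sgn_prod big_nil mul1r.
Qed.

Let agree_step (I : finType) (a : I -> 'I_n -> R * R) (y : I -> R) :
  agree (fun x => \sum_i y i * \prod_j cell (a i j) (x 0 j)).
Proof.
elim: (index_enum I) => [|i s IH].
  by apply: eq_agree (agree_trig trig0) => x; rewrite big_nil.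
apply: eq_agree (agree_lin (y i) (agree_cells (a i)) IH) => x.
by rewrite big_cons.
Qed.

(** The points cut [-(N + 1), N + 1[ into 2 (N + 1)^2 cells of length 1 / (N + 1), which is
    [gridS N]: the mesh shrinks while the box exhausts the space. *)
Definition gridpt N (i : nat) : R := i%:R / N.+1%:R - N.+1%:R.

Definition grid N (i : nat) : R * R := (gridpt N i, gridpt N i.+1).

Let gridS N : nat := (N.+1 * N.+1).*2.

Lemma cell_gridE N i t : - N.+1%:R <= t ->
  cell (grid N i) t = (Num.truncn ((t + N.+1%:R) * N.+1%:R) == i)%:R.
Proof.
move=> tN; have N0 : 0 < N.+1%:R :> R by rewrite ltr0n.
have u0 : 0 <= (t + N.+1%:R) * N.+1%:R by rewrite mulr_ge0//; lra.
have e k : (gridpt N k <= t)%R = (k <= Num.truncn ((t + N.+1%:R) * N.+1%:R))%N.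
  by rewrite truncn_ge_nat// /gridpt lerBlDr ler_pdivrMr.
rewrite /cell /grid /= !e; set m := Num.truncn _.
by case: ltngtP => _; rewrite ?subr0 ?subrr.
Qed.

Lemma cell_grid_out N i t : t < - N.+1%:R -> cell (grid N i) t = 0.
Proof.
move=> tN; have e k : (gridpt N k <= t)%R = false.
  apply/negbTE; rewrite -ltNge (lt_le_trans tN)// /gridpt lerDr.
  by rewrite divr_ge0.
by rewrite /cell /grid /= !e subrr.
Qed.

Let stepf N f x := \sum_(p : {ffun 'I_n -> 'I_(gridS N)})
  f (\row_j gridpt N (p j)) * \prod_j cell (grid N (p j)) (x 0 j).

Let idx N (t : R) := Num.truncn ((t + N.+1%:R) * N.+1%:R).

Let stepf_in N f x : (forall j, - N.+1%:R <= x 0 j < N.+1%:R) ->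
  stepf N f x = f (\row_j gridpt N (idx N (x 0 j))).
Proof.
move=> xN.
have N0 : 0 < N.+1%:R :> R by rewrite ltr0n.
have lti (j : 'I_n) : (idx N (x 0%R j) < gridS N)%N.
  have /andP[x1 x2] := xN j.
  rewrite truncn_lt_nat; last by rewrite mulr_ge0//; lra.
  rewrite /gridS -mul2n natrM natrM mulrA ltr_pM2r//; lra.
pose p0 := [ffun j => Ordinal (lti j)].
rewrite /stepf (bigD1 p0)//= [X in _ + X]big1 => [|p pp0].
  rewrite addr0 big1 => [|j _]; last first.
    by have /andP[x1 _] := xN j; rewrite cell_gridE// ffunE eqxx.
  by rewrite mulr1; congr f; apply/rowP => j; rewrite !mxE ffunE.
have [j pj] : exists j, p j != p0 j.
  apply/existsP; rewrite -negb_forall; apply: contra pp0 => /forallP h.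
  by apply/eqP/ffunP => j; apply/eqP.
rewrite (bigD1 j)//=; have /andP[x1 _] := xN j; rewrite cell_gridE//.
move: pj; rewrite ffunE -val_eqE/= eq_sym => /negbTE.
by rewrite /idx => ->; rewrite mul0r mulr0.
Qed.

Let stepf_out N f x : ~ (forall j, - N.+1%:R <= x 0 j < N.+1%:R) ->
  stepf N f x = 0.
Proof.
move=> /existsNP[j /negP xj].
have N0 : 0 < N.+1%:R :> R by rewrite ltr0n.
rewrite /stepf big1// => p _; rewrite (bigD1 j)//=.
suff -> : cell (grid N (p j)) (x 0 j) = 0 by rewrite mul0r mulr0.
have [xN|xN] := ltP (x 0 j) (- N.+1%:R); first exact: cell_grid_out.
rewrite cell_gridE//; case: eqP => // h; move: xj; rewrite xN/= -leNgt => xj.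
have := ltn_ord (p j); rewrite -h truncn_lt_nat; last by rewrite mulr_ge0//; lra.
rewrite /gridS -mul2n natrM natrM mulrA ltr_pM2r//; lra.
Qed.

Let stepf_norm N f c x : (forall x, `|f x| <= c) -> `|stepf N f x| <= c.
Proof.
move=> fc; have [h|h] := pselect (forall j, - N.+1%:R <= x 0 j < N.+1%:R).
  by rewrite stepf_in.
by rewrite stepf_out// normr0 (le_trans _ (fc 0)).
Qed.

Let cvg_stepf f x : continuous f -> stepf N f x @[N --> \oo] --> f x.
Proof.
move=> cf; apply/cvgrPdist_lt => e e0.
have /cvgrPdist_lt /(_ _ e0) := cf x.
move=> /nbhs_ballP[r /= r0 hr].
near=> N.
have N0 : 0 < N.+1%:R :> R by rewrite ltr0n.
have xN j : - N.+1%:R <= x 0 j < N.+1%:R.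
  have : `|x 0 j| < N.+1%:R.
    (* Bounding the sum gives one N that serves every coordinate j. *)
    have : \sum_i `|x 0 i| < N.+1%:R.
      by near: N; have [M _ hM] := @nbhs_infty_gtr R (\sum_i `|x 0 i|);
        exists M => // k /= Mk; apply: hM => /=; apply: leq_trans Mk _.
    by apply: le_lt_trans; rewrite (bigD1 j)//= lerDl sumr_ge0.
  by rewrite ltr_norml => /andP[/ltW -> ->].
rewrite stepf_in//; apply: hr; split => // i j; rewrite !mxE !ord1.
have /andP[x1 x2] := xN j.
have /truncn_itv : 0 <= (x 0 j + N.+1%:R) * N.+1%:R by rewrite mulr_ge0//; lra.
rewrite -/(idx N (x 0 j)) => /andP[h1 h2].
have Nr : N.+1%:R^-1 < r.
  near: N; have [M _ hM] := @nbhs_infty_gtr R r^-1.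
  exists M => // k /= Mk; rewrite invf_plt ?posrE//.
  by apply: hM => /=; apply: leq_trans Mk _.
rewrite /ball/= /gridpt; apply: le_lt_trans Nr.
move: h1 h2; rewrite -ler_pdivrMr// -ltr_pdivlMr//.
rewrite -[(idx N (x 0 j)).+1%:R]natr1 [X in _ -> _ < X -> _]mulrDl mul1r => h1 h2.
have aux (q t u M : R) : 0 < u -> q <= t + M -> t + M < q + u -> `|t - (q - M)| <= u.
  by move=> *; rewrite ler_norml; apply/andP; split; lra.
by apply: aux => //; rewrite invr_gt0.
Unshelve. all: end_near. Qed.

Lemma bounded_law_from_cos f c : continuous f -> (forall x, `|f x| <= c) ->
  [/\ measurable_fun setT (fun w => f (Z w)), measurable_fun setT (fun w => f (Z' w)) &
  Ex P (fun w => f (Z w)) = Ex P' (fun w => f (Z' w))].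
Proof.
move=> cf fc.
have [] : agree f; last by move=> _ [? ?] ?; split.
apply: (agree_lim (c := c) (fk := fun N => stepf N f)) => [N|N x|x].
- exact: agree_step.
- exact: stepf_norm.
- exact: cvg_stepf.
Qed.

Definition clamp (k : nat) (t : R) : R := Num.max (- k%:R) (Num.min t k%:R).

Lemma clamp_norm k t : `|clamp k t| <= k%:R.
Proof.
have k0 : 0 <= k%:R :> R by [].
rewrite /clamp ler_norml le_max lexx/= ge_max ge_min lexx orbT andbT; lra.
Qed.

Lemma clamp_norm2 k t : `|clamp k t| <= `|t|.
Proof.
have k0 : 0 <= k%:R :> R by [].
rewrite /clamp; case: (leP t k%:R) => h; case: (leP (- k%:R) _) => h2 //;
  rewrite ?normrN ?(ger0_norm k0); rewrite ?ler_normr ?(ltW h) ?(ltW h2)//; lra.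
Qed.

Lemma cvg_clamp t : clamp k t @[k --> \oo] --> t.
Proof.
apply: cvg_near_cst; near=> k.
have : `|t| <= k%:R by near: k; exact: nbhs_infty_ger.
by rewrite ler_norml /clamp => /andP[h1 h2]; rewrite min_l// max_r.
Unshelve. all: end_near. Qed.

Lemma continuous_clamp k : continuous (clamp k).
Proof.
have -> : clamp k = (cst (- k%:R) : R -> R^o) \max ((id : R -> R^o) \min cst k%:R) by [].
move=> t; apply: continuous_max; first exact: cvg_cst.
by apply: continuous_min; [exact: cvg_id|exact: cvg_cst].
Qed.

Lemma law_from_cos f : continuous f ->
  L1 P (fun w => f (Z w)) -> L1 P' (fun w => f (Z' w)) ->
  Ex P (fun w => f (Z w)) = Ex P' (fun w => f (Z' w)).
Proof.
move=> cf i1 i2.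
have ck k : continuous (clamp k \o f).
  by move=> x; apply: continuous_comp; [exact: cf|exact: continuous_clamp].
have h k := bounded_law_from_cos (ck k) (fun x => clamp_norm k (f x)).
have [_ c1] := @dominated_Ex _ _ _ P (fun k w => clamp k (f (Z w))) (fun w => f (Z w))
  (fun w => `|f (Z w)|) (fun k => let: And3 m _ _ := h k in m)
  (fun w => @cvg_clamp _) (fun k w => clamp_norm2 k _) (L1_norm i1).
have [_ c2] := @dominated_Ex _ _ _ P' (fun k w => clamp k (f (Z' w))) (fun w => f (Z' w))
  (fun w => `|f (Z' w)|) (fun k => let: And3 _ m _ := h k in m)
  (fun w => @cvg_clamp _) (fun k w => clamp_norm2 k _) (L1_norm i2).
apply: (cvg_unique _ c1) => //.
suff -> : (fun k => Ex P (fun w => clamp k (f (Z w)))) =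
  (fun k => Ex P' (fun w => clamp k (f (Z' w)))) by [].
by apply/funext => k; have [] := h k.
Qed.

End LawFromCosines.

(** The measurability part of [bounded_law_from_cos], applied to two copies of the same vector, for
    which the hypothesis on cosines is trivial. *)
Lemma measurable_continuous_rV (R : realType) n (d : measure_display)
    (T : measurableType d) (P : probability T R) (Z : T -> 'rV[R]_n)
    (f : 'rV[R]_n -> R) :
  (forall i, measurable_fun setT (fun w => Z w 0 i)) -> continuous f ->
  measurable_fun setT (fun w => f (Z w)).
Proof.
move=> mZ cf.
apply: (measurable_fun_cvg (h := fun k w => clamp k (f (Z w)))) => [k|w _]; last exact: cvg_clamp.
have ck : continuous (clamp k \o f).
  by move=> x; apply: continuous_comp; [exact: cf|exact: continuous_clamp].
by have [] := @bounded_law_from_cos _ _ _ _ _ _ P P _ _ mZ mZ (fun l b => erefl) _ _ ck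
  (fun x => clamp_norm k (f x)).
Qed.

(** * One-dimensional Gaussian laws *)

Definition poly_bound (R : realType) (k : nat) (y : R -> R) : Prop :=
  exists C : R, forall x, `|y x| <= C * (1 + `|x|) ^+ k.

Section NormalIntegral.
Context (R : realType) (m s : R).
Hypothesis s0 : s != 0.
Notation mu := (@lebesgue_measure R).
Notation N := (normal_prob m s : probability _ R).

Let radon_nikodym_normal :
  ae_eq mu setT (Radon_Nikodym (charge_of_finite_measure N) mu)
    (fun x => (normal_pdf m s x)%:E).
Proof.
apply: integral_ae_eq => //.
- apply: Radon_Nikodym_integrable; exact: normal_prob_dominates.
- by apply/measurable_EFinP; exact: measurable_normal_pdf.
- move=> E _ mE; rewrite -Radon_Nikodym_integral//.
  exact: normal_prob_dominates.
Qed.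

Lemma Ex_normal (f : R -> R) : L1 N f ->
  Ex N f = \int[mu]_x (f x * normal_pdf m s x).
Proof.
move=> i1; rewrite /Ex /Rintegral; congr fine.
rewrite -(Radon_Nikodym_change_of_variables (normal_prob_dominates m s) measurableT i1).
have mf : measurable_fun setT f by exact: L1_meas i1.
apply: ae_eq_integral => //.
- apply: emeasurable_funM; first exact/measurable_EFinP.
  by apply: measurable_int; apply: Radon_Nikodym_integrable; exact: normal_prob_dominates.
- by apply/measurable_EFinP; apply: measurable_funM => //; exact: measurable_normal_pdf.
- by apply: filterS radon_nikodym_normal => x h _; rewrite h.
Qed.

(** Stated for extended integrals of nonnegative functions, since it serves to establish
    integrability in [L1_normal]. *)
Lemma ge0_integral_normal (f : R -> R) : measurable_fun setT f ->
  (forall x, 0 <= f x) ->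
  (\int[N]_x (f x)%:E = \int[mu]_x (f x * normal_pdf m s x)%:E)%E.
Proof.
move=> mf f0.
have mf' : measurable_fun setT (EFin \o f) by exact/measurable_EFinP.
have dom := normal_prob_dominates m s.
have f0' x : (0 <= (EFin \o f) x)%E by rewrite lee_fin.
rewrite -(@Radon_Nikodym_SigmaFinite.change_of_variables _ _ _ N mu dom (EFin \o f) setT f0' measurableT mf').
apply: ae_eq_integral => //.
- apply: emeasurable_funM => //.
  by apply: measurable_int; exact: Radon_Nikodym_SigmaFinite.f_integrable.
- by apply/measurable_EFinP; apply: measurable_funM => //; exact: measurable_normal_pdf.
- have h : ae_eq mu setT (Radon_Nikodym_SigmaFinite.f N mu) (fun x => (normal_pdf m s x)%:E).
    apply: integral_ae_eq => //.
    + exact: Radon_Nikodym_SigmaFinite.f_integrable.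
    + by apply/measurable_EFinP; exact: measurable_normal_pdf.
    + by move=> E _ mE; rewrite -Radon_Nikodym_SigmaFinite.f_integral.
  by apply: filterS h => x h _; rewrite h.
Qed.

Lemma L1_normal (f : R -> R) : measurable_fun setT f ->
  mu.-integrable setT (EFin \o (fun x => f x * normal_pdf m s x)) -> L1 N f.
Proof.
move=> mf /integrableP[_ h]; apply/integrableP; split; first exact/measurable_EFinP.
rewrite (_ : (fun x => _) = (fun x => (`|f x|)%:E)); last by [].
rewrite ge0_integral_normal//; last exact: measurableT_comp.
apply: le_lt_trans h; rewrite le_eqVlt; apply/orP; left; apply/eqP.
by apply: eq_integral => x _ /=; rewrite normrM (ger0_norm (normal_pdf_ge0 m s x)).
Qed.

(** Dividing by k + 1 instead of k avoids a division by 0 when k = 0. *)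
Lemma expR_ge_pow (k : nat) (u : R) : 0 <= u -> (1 + u / k.+1%:R) ^+ k <= expR u.
Proof.
move=> u0; have k0 : 0 < k.+1%:R :> R by [].
have h : 1 <= 1 + u / k.+1%:R by rewrite lerDl divr_ge0.
apply: le_trans (_ : (1 + u / k.+1%:R) ^+ k.+1 <= _); first exact: ler_weXn2l.
have -> : expR u = expR (u / k.+1%:R) ^+ k.+1.
  by rewrite -expRM_natl -[in RHS]mulr_natl mulrCA divff ?mulr1// gt_eqF.
rewrite lerXn2r ?nnegrE ?expR_ge0 ?(le_trans ler01 h)//.
by rewrite expR_ge1Dx.
Qed.

(** With u = (x - m)^2 / (4 s^2), the density is proportional to e^(-2u), and doubling s turns it
    into a multiple of e^(-u/2). A polynomial is at most a constant times e^u, and e^(u - 2u) <=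
    e^(-u/2). *)
Lemma normal_pdf_decay k : exists C : R, forall x,
  (1 + `|x|) ^+ k * normal_pdf m s x <= C * normal_pdf m (2 * s) x.
Proof.
have s20 : 2 * s != 0 by rewrite mulf_neq0.
have ss0 : 0 < s ^+ 2 by rewrite exprn_even_gt0.
(* M is large enough for 1 + |x| <= M (1 + u / (k + 1)), so that [expR_ge_pow] absorbs the
   polynomial. *)
pose M := 2 + `|m| + 2 * s ^+ 2 * k.+1%:R.
have M1 : 1 <= M.
  have h : 0 <= 2 * s ^+ 2 * k.+1%:R by apply: mulr_ge0 => //; apply: mulr_ge0 => //; exact: sqr_ge0.
  by rewrite /M; have := normr_ge0 m; lra.
exists (M ^+ k * normal_peak s / normal_peak (2 * s)) => x.
rewrite !normal_pdfE//.
rewrite [leRHS]mulrA divfK ?gt_eqF ?normal_peak_gt0//.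
rewrite [leRHS]mulrAC [leLHS]mulrCA [leRHS]mulrC ler_pM2l ?normal_peak_gt0//.
rewrite /normal_fun.
pose u := (x - m) ^+ 2 / (s ^+ 2) / 4.
have u0 : 0 <= u by rewrite /u !divr_ge0 ?sqr_ge0.
have -> : - (x - m) ^+ 2 / (s ^+ 2 *+ 2) = - (2 * u).
  by rewrite /u -mulr_natl; field.
have -> : - (x - m) ^+ 2 / ((2 * s) ^+ 2 *+ 2) = - (u / 2).
  by rewrite /u -mulr_natl; field.
have h1 : 1 + `|x| <= M * (1 + u / k.+1%:R).
  have k0 : 0 < k.+1%:R :> R by [].
  have e1 : M * (1 + u / k.+1%:R) >= M + 2 * s ^+ 2 * u.
    rewrite mulrDr mulr1 lerD2l (mulrA M) ler_pdivlMr// mulrAC ler_wpM2r//.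
    rewrite /M; have := normr_ge0 m; lra.
  apply: le_trans e1; rewrite /M.
  have -> : 2 * s ^+ 2 * u = (x - m) ^+ 2 / 2 by rewrite /u; field.
  have h3 : `|x| <= `|x - m| + `|m| by rewrite -[X in `|X| <= _](subrK m) ler_normD.
  have h4 : 0 <= 2 * s ^+ 2 * k.+1%:R by apply: mulr_ge0 => //; apply: mulr_ge0 => //; exact: sqr_ge0.
  have := sqr_ge0 (`|x - m| - 1); rewrite sqrrB real_normK ?num_real// => h5.
  lra.
have h2 : (1 + `|x|) ^+ k <= M ^+ k * expR u.
  apply: le_trans (_ : M ^+ k * (1 + u / k.+1%:R) ^+ k <= _).
    have x1 : 0 <= 1 + `|x| by have := normr_ge0 x; lra.
    by rewrite -exprMn lerXn2r ?nnegrE// (le_trans x1 h1).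
  rewrite ler_wpM2l ?exprn_ge0//; first lra.
  exact: expR_ge_pow.
apply: (@le_trans _ _ (M ^+ k * expR u * expR (- (2 * u)))).
  by rewrite ler_wpM2r// expR_ge0.
rewrite -mulrA -expRD ler_wpM2l ?exprn_ge0//; first lra.
rewrite ler_expR; lra.
Qed.

Lemma integrable_poly_bound (y : R -> R) k : measurable_fun setT y -> poly_bound k y ->
  mu.-integrable setT (EFin \o (fun x => y x * normal_pdf m s x)).
Proof.
move=> my [C hC].
have [D hD] := normal_pdf_decay k.
have C0 : 0 <= C.
  by have := hC 0; rewrite normr0 addr0 expr1n mulr1; apply: le_trans.
have ig : mu.-integrable setT (EFin \o (fun x => C * D * normal_pdf m (2 * s) x)).
  rewrite (_ : _ \o _ = fun x => ((C * D)%:E * (normal_pdf m (2 * s) x)%:E)%E)//.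
  by apply: integrableZl => //; exact: integrable_normal_pdf.
apply: (le_integrable measurableT _ _ ig).
- by apply/measurable_EFinP; apply: measurable_funM => //; exact: measurable_normal_pdf.
- move=> x _ /=; rewrite lee_fin normrM (ger0_norm (normal_pdf_ge0 m s x)).
  apply: le_trans (ler_norm _); rewrite -mulrA.
  apply: le_trans (_ : C * ((1 + `|x|) ^+ k * normal_pdf m s x) <= _).
    by rewrite mulrA ler_wpM2r// normal_pdf_ge0.
  by rewrite ler_wpM2l.
Qed.

Lemma L1_poly_bound (y : R -> R) k : measurable_fun setT y -> poly_bound k y -> L1 N y.
Proof. by move=> my hy; apply: L1_normal => //; exact: integrable_poly_bound hy. Qed.

(** The decay lemma is used with exponent k + 1, so that one factor 1 / (1 + |x|) is left over. *)
Lemma poly_bound_pdf_cvg0 (y : R -> R) k : poly_bound k y ->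
  (y n%:R * normal_pdf m s n%:R @[n --> \oo] --> (0 : R)) /\
  (y (- n%:R) * normal_pdf m s (- n%:R) @[n --> \oo] --> (0 : R)).
Proof.
move=> [C hC]; have [D hD] := normal_pdf_decay k.+1.
have s20 : 2 * s != 0 by rewrite mulf_neq0.
have C0 : 0 <= C.
  by have := hC 0; rewrite normr0 addr0 expr1n mulr1; apply: le_trans.
have hb x : `|y x * normal_pdf m s x| <= C * `|D| * normal_peak (2 * s) / (1 + `|x|).
  have x0 : 0 < 1 + `|x| by have := normr_ge0 x; lra.
  rewrite ler_pdivlMr// normrM (ger0_norm (normal_pdf_ge0 m s x)).
  apply: le_trans (_ : C * ((1 + `|x|) ^+ k.+1 * normal_pdf m s x) <= _).
    rewrite exprSr mulrAC [leRHS]mulrA.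
    rewrite ler_wpM2r ?normal_pdf_ge0// [leRHS]mulrA ler_wpM2r//; lra.
  rewrite -mulrA ler_wpM2l// (le_trans (hD x))//.
  apply: le_trans (_ : `|D| * normal_pdf m (2 * s) x <= _).
    by rewrite ler_wpM2r ?normal_pdf_ge0// ler_norm.
  by rewrite ler_wpM2l// normal_pdf_ub.
have hb0 : C * `|D| * normal_peak (2 * s) / (1 + n%:R) @[n --> \oo] --> (0 : R).
  rewrite -[X in _ --> X](mulr0 (C * `|D| * normal_peak (2 * s))).
  apply: cvgM; first exact: cvg_cst.
  by rewrite (_ : (fun n => _) = (@harmonic R)); [exact: cvg_harmonic|apply/funext => n; rewrite /harmonic/= -natr1 addrC].
by split; apply/norm_cvg0P; apply: (squeeze_cvgr _ (@cvg_cst _ _ _ _ _) hb0);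
  apply: nearW => n; rewrite normr_ge0/= (le_trans (hb _))// ?normrN (@ger0_norm _ n%:R).
Qed.

Lemma Rintegral_derivative_eq0 (G g : R -> R) : continuous g ->
  (forall x : R, is_derive x 1 G (g x)) -> mu.-integrable setT (EFin \o g) ->
  G n%:R @[n --> \oo] --> (0 : R) -> G (- n%:R) @[n --> \oo] --> (0 : R) ->
  \int[mu]_x g x = 0.
Proof.
move=> cg dG ig G1 G2.
have cG : continuous G.
  by move=> x; apply: differentiable_continuous; apply/derivable1_diffP; exact: ex_derive.
have mg : measurable_fun setT g by exact: continuous_measurable_fun.
have key n : (0 < n)%N -> \int[mu]_x ((g \_ `[- n%:R, n%:R]) x) = G n%:R - G (- n%:R).
  move=> n0; rewrite -Rintegral_mkcond /Rintegral.
  rewrite (@continuous_FTC2 _ g G)//; first by rewrite gtrN// ltr0n.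
  - exact: continuous_subspaceT.
  - split=> [x _| |]; first exact: ex_derive.
    + exact/cvg_at_right_filter/cG.
    + exact/cvg_at_left_filter/cG.
  - by move=> x _; rewrite derive1E; apply: derive_val.
have c1 : \int[mu]_x ((g \_ `[- n%:R, n%:R]) x) @[n --> \oo] --> \int[mu]_x g x.
  rewrite /Rintegral; apply: fine_cvg.
  rewrite fineK; last by apply: integrable_fin_num.
  apply: (@dominated_cvg _ _ _ mu setT measurableT
    (fun n x => ((g \_ `[- n%:R, n%:R]) x)%:E) (EFin \o g) (EFin \o (Num.norm \o g))).
  - move=> n; apply/measurable_EFinP/(measurable_restrictT _ _).1 => //.
    exact: measurable_funTS.
  - move=> x _; apply: cvg_EFin; first exact: nearW.
    apply: cvg_near_cst; near=> n; rewrite /= patchE ifT//.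
    rewrite inE/= in_itv/= -ler_norml; near: n; exact: nbhs_infty_ger.
  - by [].
  - exact: integrable_norm.
  - move=> n x _; rewrite lee_fin patchE; case: ifP => //= _.
    by rewrite normr0.
have c2 : \int[mu]_x ((g \_ `[- n%:R, n%:R]) x) @[n --> \oo] --> (0 : R).
  have : G n%:R - G (- n%:R) @[n --> \oo] --> (0 - 0 : R) by apply: cvgB.
  rewrite subr0; apply: cvg_trans; apply: near_eq_cvg; near=> n.
  by rewrite key//; near: n; exact: nbhs_infty_gt.
exact: (cvg_unique _ c1 c2).
Unshelve. all: end_near. Qed.

Lemma is_derive_normal_pdf (x : R) :
  is_derive x 1 (normal_pdf m s) (- ((x - m) / s ^+ 2) * normal_pdf m s x).
Proof.
rewrite normal_pdfE//.
have d1 : is_derive x 1 (fun x : R => - (x - m) ^+ 2 / (s ^+ 2 *+ 2))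
    (- ((x - m) / s ^+ 2)).
  apply: is_derive_eq.
  rewrite /GRing.scale/= -mulr_natl; field.
  exact: s0.
have d2 : is_derive x 1 (expR \o (fun x : R => - (x - m) ^+ 2 / (s ^+ 2 *+ 2)))
   (expR (- (x - m) ^+ 2 / (s ^+ 2 *+ 2)) * (- ((x - m) / s ^+ 2))).
  apply: is_derive1_comp.
rewrite (_ : (fun x => _) = normal_peak s \*: (expR \o (fun x : R => - (x - m) ^+ 2 / (s ^+ 2 *+ 2)))); last by [].
apply: is_derive_eq.
rewrite /GRing.scale /normal_fun/=; ring.
Qed.

(** The derivative of y times the density has integral 0, since the product vanishes at both
    infinities. *)
Lemma Ex_normal_ibp (y y' : R -> R) k : (forall x : R, is_derive x 1 y (y' x)) ->
  continuous y' -> poly_bound k y -> poly_bound k y' ->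
  Ex N (fun x => (x - m) * y x) = s ^+ 2 * Ex N y'.
Proof.
move=> dy cy' by1 by2.
have cy : continuous y.
  by move=> x; apply: differentiable_continuous; apply/derivable1_diffP; exact: ex_derive.
have my := continuous_measurable_fun cy; have my' := continuous_measurable_fun cy'.
have by3 : poly_bound k.+1 (fun x => (x - m) * y x).
  have [C hC] := by1; exists (C * (1 + `|m|)) => x.
  rewrite normrM exprS mulrC.
  have h : `|x - m| <= (1 + `|m|) * (1 + `|x|).
    rewrite (le_trans (ler_normB _ _))//.
    have := normr_ge0 x; have := normr_ge0 m => *; nra.
  apply: le_trans (_ : (C * (1 + `|x|) ^+ k) * ((1 + `|m|) * (1 + `|x|)) <= _).
    by apply: ler_pM.
  rewrite le_eqVlt; apply/orP; left; apply/eqP; ring.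
have mz : measurable_fun setT (fun x : R => (x - m) * y x).
  by apply: measurable_funM => //; apply: measurable_funB.
rewrite !Ex_normal; [|exact: L1_poly_bound by2|exact: L1_poly_bound by3].
have i2 := integrable_poly_bound my' by2.
have i3 := integrable_poly_bound mz by3.
have : \int[mu]_x (y' x * normal_pdf m s x -
    s ^- 2 * ((x - m) * y x * normal_pdf m s x)) = 0.
  have [g1 g2] := poly_bound_pdf_cvg0 by1.
  apply: (Rintegral_derivative_eq0 (G := fun x => y x * normal_pdf m s x)) => //.
  - have cp : continuous (normal_pdf m s) by exact: continuous_normal_pdf.
    move=> x; apply: cvgB; first by apply: cvgM; [exact: cy'|exact: cp].
    apply: cvgM; first exact: cvg_cst.
    apply: cvgM; last exact: cp.
    apply: cvgM; last exact: cy.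
    by apply: cvgB; [exact: cvg_id|exact: cvg_cst].
  - move=> x; have d1 := dy x; have d2 := is_derive_normal_pdf x.
    rewrite (_ : (fun x => _) = y * normal_pdf m s); last by [].
    apply: is_derive_eq; rewrite /GRing.scale/=; ring.
  - exact: (integrableB measurableT i2 (integrableZl measurableT (s ^- 2) i3)).
rewrite RintegralB//; last first.
  exact: (integrableZl measurableT (s ^- 2) i3).
rewrite RintegralZl// => /eqP; rewrite subr_eq0 => /eqP ->.
by rewrite mulrA divff ?mul1r// sqrf_eq0.
Qed.

Lemma Ex_normal_mean : Ex N id = m.
Proof.
have p1 : poly_bound 1 (fun x : R => x).
  by exists 1 => x; rewrite expr1 mul1r lerDr.
have i1 : L1 N id by apply: (L1_poly_bound (k := 1)).
have h := @Ex_normal_ibp (cst 1) (cst 0) 0 (fun x => is_derive_cst _ _ _)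
  (fun x => cvg_cst _).
have := h _ _; rewrite Ex_cst mulr0.
under eq_Ex do rewrite mulr1.
rewrite ExB//; last exact: L1_cst.
rewrite Ex_cst => e; apply/eqP; rewrite -subr_eq0; apply/eqP; apply: e.
- by exists 1 => x; rewrite normr1 mul1r expr0.
- by exists 1 => x; rewrite normr0 mul1r expr0.
Qed.

Lemma Ex_normal_var : Ex N (fun x => (x - m) ^+ 2) = s ^+ 2.
Proof.
have p1 : poly_bound 1 (fun x : R => x - m).
  exists (1 + `|m|) => x; rewrite expr1 (le_trans (ler_normB _ _))//.
  have := normr_ge0 x; have := normr_ge0 m => *; nra.
have p2 : poly_bound 1 (cst (1 : R)).
  by exists 1 => x; rewrite normr1 mul1r expr1 lerDl.
have d1 (x : R) : is_derive x 1 (fun x : R => x - m) ((cst 1) x).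
  by apply: is_derive_eq; rewrite /=; ring.
have := Ex_normal_ibp d1 (fun x => cvg_cst _) p1 p2.
by rewrite Ex_cst mulr1 => <-; apply: eq_Ex => x; rewrite expr2.
Qed.

(** Let c(t) be the left-hand side. Differentiating under the integral and integrating by parts with
    y(x) = sin(t (x - m) + b) gives c' = - s^2 t c, so that c(t) e^(s^2 t^2 / 2) is constant, equal
    to its value cos b at t = 0. *)
Lemma Ex_normal_cos (t b : R) :
  Ex N (fun x => cos (t * (x - m) + b)) = cos b * expR (- (s * t) ^+ 2 / 2).
Proof.
pose c t := Ex N (fun x => cos (t * (x - m) + b)).
have mcos := continuous_measurable_fun (@continuous_cos R).
have msin := continuous_measurable_fun (@continuous_sin R).
have mlin (u : R) : measurable_fun setT (fun x : R => u * (x - m) + b).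
  by apply: measurable_funD => //; apply: measurable_funM => //; apply: measurable_funB.
have i1 u : L1 N (fun x => cos (u * (x - m) + b)).
  apply: (@L1_bounded _ _ _ _ _ 1) => [|x]; last exact: cos_max.
  exact: measurableT_comp mcos (mlin u).
have dcos (u x : R) : is_derive u 1 (fun u => cos (u * (x - m) + b)) (- (x - m) * sin (u * (x - m) + b)).
  have h : is_derive u 1 (fun u : R => u * (x - m) + b) (x - m).
    by apply: is_derive_eq; rewrite /GRing.scale/=; ring.
  by apply: is_derive_eq; rewrite /GRing.scale/=; ring.
have ilin : L1 N (fun x => `|x - m|).
  apply: (L1_poly_bound (k := 1)).
    by apply: measurableT_comp => //; apply: measurable_funB.
  exists (1 + `|m|) => x; rewrite normr_id expr1 (le_trans (ler_normB _ _))//.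
  have := normr_ge0 x; have := normr_ge0 m => *; nra.
have dc (u : R) : is_derive u 1 c (- (s ^+ 2 * u * c u)).
  have bnd (v x : R) : `|partial1of2 (fun u x => cos (u * (x - m) + b)) v x| <= `|x - m|.
    rewrite partial1of2E derive_val normrM normrN ler_piMr//; exact: sin_max.
  have uI : (`]u - 1, u + 1[%classic : set R) u by rewrite /= in_itv/=; lra.
  have dr := @derivable_under_integral R _ _ N (fun u x => cos (u * (x - m) + b)) setT
    measurableT u (u - 1) (u + 1) uI (fun v _ => i1 v)
    (fun v x _ _ => @ex_derive _ _ _ _ _ _ _ (dcos v x)) (fun x => `|x - m|) (fun x => normr_ge0 _) ilin
    (fun v x _ _ => bnd v x).
  have dE := @differentiation_under_integral R _ _ N (fun u x => cos (u * (x - m) + b)) setT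
    measurableT u (u - 1) (u + 1) uI (fun v _ => i1 v)
    (fun v x _ _ => @ex_derive _ _ _ _ _ _ _ (dcos v x)) (fun x => `|x - m|) (fun x => normr_ge0 _) ilin
    (fun v x _ _ => bnd v x).
  apply: DeriveDef => //; rewrite -derive1E [LHS]dE.
  transitivity (Ex N (fun x => (-1) * ((x - m) * sin (u * (x - m) + b)))).
    by apply: eq_Ex => x; rewrite partial1of2E derive_val; ring.
  have psin : poly_bound 1 (fun x : R => sin (u * (x - m) + b)).
    exists 1 => x; rewrite (le_trans (sin_max _))// expr1 mul1r lerDl//.
  have pcos : poly_bound 1 (fun x : R => u * cos (u * (x - m) + b)).
    exists `|u| => x; rewrite normrM ler_wpM2l//.
    by rewrite (le_trans (cos_max _))// expr1 lerDl.
  have dsin (x : R) : is_derive x 1 (fun x : R => sin (u * (x - m) + b)) (u * cos (u * (x - m) + b)).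
    have h : is_derive x 1 (fun x : R => u * (x - m) + b) u.
      by apply: is_derive_eq; rewrite /GRing.scale/=; ring.
    by apply: is_derive_eq; rewrite /GRing.scale/=; ring.
  have cc : continuous (fun x : R => u * cos (u * (x - m) + b)).
    move=> x; apply: cvgM; first exact: cvg_cst.
    apply: (continuous_comp (f := fun x : R => u * (x - m) + b) (g := cos)); last exact: continuous_cos.
    apply: cvgD; last exact: cvg_cst.
    by apply: cvgM; [exact: cvg_cst|apply: cvgB; [exact: cvg_id|exact: cvg_cst]].
  rewrite ExZ; last first.
    apply: (L1_le _ _ ilin).
      apply: measurable_funM; first by apply: measurable_funB.
      exact: measurableT_comp msin (mlin u).
    by move=> x; rewrite normrM ler_piMr//; exact: sin_max.
  rewrite (Ex_normal_ibp dsin cc psin pcos) ExZ//.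
  rewrite /c; ring.
have key (u : R) : is_derive u 1 (fun u => c u * expR ((s * u) ^+ 2 / 2)) 0.
  have h0 := dc u.
  have h : is_derive u 1 (fun u : R => (s * u) ^+ 2 / 2) (s ^+ 2 * u).
    by apply: is_derive_eq; rewrite /GRing.scale/=; field.
  have h2 : is_derive u 1 (expR \o (fun u : R => (s * u) ^+ 2 / 2))
    (expR ((s * u) ^+ 2 / 2) * (s ^+ 2 * u)) by exact: is_derive1_comp.
  rewrite (_ : (fun u => _) = c * (expR \o (fun u : R => (s * u) ^+ 2 / 2))); last by [].
  apply: is_derive_eq; rewrite /GRing.scale/=; ring.
have cst_c := @is_derive_0_is_cst R _ t 0 key.
have : c t * expR ((s * t) ^+ 2 / 2) = cos b.
  rewrite cst_c mulr0 expr0n/= mul0r expR0 mulr1 /c.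
  under eq_Ex do rewrite mul0r add0r.
  by rewrite Ex_cst.
rewrite mulNr expRN -/(c t) => <-.
by rewrite mulfK// gt_eqF// expR_gt0.
Qed.

End NormalIntegral.

(** * Isonormal processes *)

Section Moments.
Context (d : measure_display) (T : measurableType d) (R : realType).
Variable P : probability T R.
Implicit Types (f g : T -> R).

Definition all_moments f : Prop :=
  measurable_fun setT f /\ forall k, L1 P (fun w => `|f w| ^+ k).

Lemma moments_le f g : measurable_fun setT f -> (forall w, `|f w| <= `|g w|) ->
  all_moments g -> all_moments f.
Proof.
move=> mf fg [mg ig]; split=> // k; apply: (L1_le _ _ (ig k)).
  by apply: measurable_funX; exact: measurableT_comp.
by move=> w; rewrite normrX normr_id lerXn2r ?nnegrE.
Qed.

Lemma moments_cst c : all_moments (fun=> c).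
Proof. by split=> // k; exact: L1_cst. Qed.

Lemma moments_L1 f : all_moments f -> L1 P f.
Proof. by move=> [mf /(_ 1%N)]; apply: L1_le. Qed.

Lemma moments_L2 f : all_moments f -> L2 P f.
Proof.
move=> [mf /(_ 2)] i; split=> //; apply: eq_integrable i => // w _ /=.
by rewrite real_normK ?num_real.
Qed.

Lemma momentsM f g : all_moments f -> all_moments g ->
  all_moments (fun w => f w * g w).
Proof.
move=> [mf i1] [mg i2]; split; first exact: measurable_funM.
move=> k; apply: (L1_le _ _ (L1D (i1 (k * 2)%N) (i2 (k * 2)%N))).
  by apply: measurable_funX; apply: measurableT_comp => //; exact: measurable_funM.
move=> w; rewrite normrX normr_id normrM exprMn !exprM.
have := sqr_ge0 (`|f w| ^+ k - `|g w| ^+ k); rewrite sqrrB.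
have := sqr_ge0 (`|f w| ^+ k); have := sqr_ge0 (`|g w| ^+ k); lra.
Qed.

Lemma momentsD f g : all_moments f -> all_moments g ->
  all_moments (fun w => f w + g w).
Proof.
move=> [mf i1] [mg i2]; split; first exact: measurable_funD.
move=> k; apply: (L1_le _ _ (L1Z (2 ^+ k) (L1D (i1 k) (i2 k)))).
  by apply: measurable_funX; apply: measurableT_comp => //; exact: measurable_funD.
move=> w; rewrite normrX normr_id.
apply: le_trans (_ : (`|f w| + `|g w|) ^+ k <= _).
  by rewrite lerXn2r ?nnegrE ?addr_ge0// ler_normD.
have h a b : 0 <= b -> b <= a -> (a + b : R) ^+ k <= 2 ^+ k * (a ^+ k + b ^+ k).
  move=> b0 ba; have a0 := le_trans b0 ba.
  apply: le_trans (_ : (2 * a) ^+ k <= _).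
    by rewrite lerXn2r ?nnegrE ?addr_ge0 ?mulr_ge0//; lra.
  by rewrite exprMn ler_wpM2l ?exprn_ge0// lerDl exprn_ge0.
have [fg|/ltW fg] := leP `|g w| `|f w|; first exact: h.
by rewrite addrC [X in _ * X]addrC; exact: h.
Qed.

Lemma momentsZ c f : all_moments f -> all_moments (fun w => c * f w).
Proof. by move=> h; apply: momentsM => //; exact: moments_cst. Qed.

Lemma momentsB f g : all_moments f -> all_moments g ->
  all_moments (fun w => f w - g w).
Proof.
move=> h1 h2; have := momentsD h1 (momentsZ (-1) h2).
by under eq_fun do rewrite mulN1r.
Qed.

Lemma moments_sum (I : Type) (s : seq I) (F : I -> T -> R) :
  (forall i, all_moments (F i)) -> all_moments (fun w => \sum_(i <- s) F i w).
Proof.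
move=> iF; elim: s => [|i s IH].
  by under eq_fun do rewrite big_nil; exact: moments_cst.
by under eq_fun do rewrite big_cons; exact: momentsD.
Qed.

Lemma moments_norm f : all_moments f -> all_moments (fun w => `|f w|).
Proof.
move=> h; have [mf _] := h; apply: moments_le h => [|w]; last by rewrite normr_id.
exact: measurableT_comp.
Qed.

Lemma momentsX f k : all_moments f -> all_moments (fun w => f w ^+ k).
Proof.
move=> h; elim: k => [|k IH].
  by under eq_fun do rewrite expr0; exact: moments_cst.
by under eq_fun do rewrite exprS; exact: momentsM.
Qed.

End Moments.

(** * Expectations under a Gaussian law, degenerate or not *)

Section Transfer.
Context (R : realType) (d : measure_display) (T : measurableType d).
Variables (P : probability T R) (X : {RV P >-> R}).
Let mX : measurable_fun setT X. Proof. exact: measurable_funPT. Qed.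

Notation RR := (measurableTypeR R).

Section Law.
Variable Q : probability RR R.
Hypothesis XQ : forall A : set R, measurable A -> P (X @^-1` A) = Q A.

(** The same function, with its target retyped as the measurable space that carries [Q]. *)
Let X' : {mfun T >-> RR} := HB.pack_for {mfun T >-> RR} (X : T -> RR)
  (@isMeasurableFun.Build d _ T RR X mX).

Let lawE (f : RR -> \bar R) : (\int[distribution P X']_x f x = \int[Q]_x f x)%E.
Proof. by apply: eq_measure_integral => A mA _; exact: XQ. Qed.

Lemma law_L1 (f : R -> R) : L1 Q f -> L1 P (fun w => f (X w)).
Proof.
move=> i; have mf : measurable_fun setT f by exact: L1_meas i.
have /integrableP[_ h] := i.
apply/integrableP; split; first by apply/measurable_EFinP; exact: measurableT_comp.
have := @ge0_integral_distribution _ _ _ _ _ P X' (fun x => `|(f x)%:E|%E).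
rewrite /comp => <-//; first by rewrite lawE.
by apply: measurableT_comp => //; exact/measurable_EFinP.
Qed.

Lemma law_Ex (f : R -> R) : L1 Q f -> Ex P (fun w => f (X w)) = Ex Q f.
Proof.
move=> i; have mf : measurable_fun setT f by exact: L1_meas i.
rewrite /Ex /Rintegral; congr fine; rewrite -lawE.
have mf' : measurable_fun setT (EFin \o f) by exact/measurable_EFinP.
by rewrite (@integral_distribution _ _ _ _ _ P X' (EFin \o f) mf')//; exact: law_L1.
Qed.

End Law.

Variables (m s : R).
Hypothesis lawX : has_law P X (gaussian_law m s).

Lemma gaussian_L1_Ex (f : R -> R) k : measurable_fun setT f -> poly_bound k f ->
  L1 P (fun w => f (X w)) /\
  Ex P (fun w => f (X w)) = if s == 0 then f m else Ex (normal_prob m s) f.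
Proof.
move=> mf pf; have := lawX; rewrite /has_law /gaussian_law.
have [s0|s0] := eqVneq s 0 => hl; last first.
  have i := L1_poly_bound m s0 mf pf.
  have j1 := @law_L1 (normal_prob m s) hl f i.
  have j2 := @law_Ex (normal_prob m s) hl f i.
  by split.
have mf' : measurable_fun setT (EFin \o f) by exact/measurable_EFinP.
pose D : probability RR R := @dirac _ RR m R.
have i : L1 D f.
  apply/integrableP; split => //.
  have ma : measurable_fun setT (fun x : RR => `|(EFin \o f) x|%E).
    by apply: measurableT_comp.
  by rewrite /D (@integral_dirac _ RR m R setT measurableT _ ma) diracT mul1e ltry.
split; first exact: (@law_L1 D hl).
rewrite (@law_Ex D hl)//.
by rewrite /Ex /Rintegral /D (@integral_dirac _ RR m R setT measurableT _ mf') diracT mul1e.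
Qed.

Lemma gaussian_moments : all_moments P X.
Proof.
split=> // k; have [] // := @gaussian_L1_Ex (fun x => `|x| ^+ k) k.
  by apply: measurable_funX; exact: normr_measurable.
exists 1 => x; rewrite normrX normr_id mul1r lerXn2r ?nnegrE// ?addr_ge0//.
by rewrite lerDr.
Qed.

Lemma gaussian_mean : Ex P X = m.
Proof.
have pb : poly_bound 1 (@id R) by exists 1 => x; rewrite expr1 mul1r lerDr.
have [_ ->] := gaussian_L1_Ex (@measurable_id _ _ _) pb.
by have [//|s0] := eqVneq s 0; exact: Ex_normal_mean.
Qed.

Lemma gaussian_var : Ex P (fun w => (X w - m) ^+ 2) = s ^+ 2.
Proof.
have mf : measurable_fun setT (fun x : R => (x - m) ^+ 2).
  by apply: measurable_funX; exact: measurable_funB.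
have pb : poly_bound 2 (fun x : R => (x - m) ^+ 2).
  exists ((1 + `|m|) ^+ 2) => x; rewrite normrX -exprMn lerXn2r ?nnegrE ?mulr_ge0 ?addr_ge0//.
  rewrite (le_trans (ler_normB _ _))//.
  have := normr_ge0 x; have := normr_ge0 m => *; nra.
have [_ ->] := gaussian_L1_Ex mf pb.
have [->|s0] := eqVneq s 0; first by rewrite subrr.
exact: Ex_normal_var.
Qed.

Lemma gaussian_cos (t b : R) :
  Ex P (fun w => cos (t * (X w - m) + b)) = cos b * expR (- (s * t) ^+ 2 / 2).
Proof.
have mf : measurable_fun setT (fun x : R => cos (t * (x - m) + b)).
  apply: (measurableT_comp (continuous_measurable_fun (@continuous_cos R))).
  by apply: measurable_funD => //; apply: measurable_funM => //; exact: measurable_funB.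
have pb : poly_bound 0 (fun x : R => cos (t * (x - m) + b)).
  by exists 1 => x; rewrite expr0 mulr1 cos_max.
have [_ ->] := gaussian_L1_Ex mf pb.
have [->|s0] := eqVneq s 0; last exact: Ex_normal_cos.
by rewrite subrr mulr0 add0r mul0r expr0n/= oppr0 mul0r expR0 mulr1.
Qed.

End Transfer.

(** * Algebra of the inner product *)

Section InnerProduct.
Context (R : realType) (H : completeNormedModType R) (ip : H -> H -> R).
Hypothesis hip : hilbert_product ip.

Lemma ipDl x y z : ip (x + y) z = ip x z + ip y z.
Proof. by rewrite -[x]scale1r (ip_lin hip) mul1r scale1r. Qed.

Lemma ip0l z : ip 0 z = 0.
Proof. by apply: (addrI (ip 0 z)); rewrite -ipDl !addr0. Qed.

Lemma ipZl a x z : ip (a *: x) z = a * ip x z.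
Proof. by rewrite -[a *: x]addr0 (ip_lin hip) ip0l addr0. Qed.

Lemma ipC x y : ip x y = ip y x. Proof. exact: (ip_sym hip). Qed.

Lemma ipDr x y z : ip x (y + z) = ip x y + ip x z.
Proof. by rewrite ipC ipDl !(ipC x). Qed.

Lemma ipZr a x z : ip x (a *: z) = a * ip x z.
Proof. by rewrite ipC ipZl (ipC x). Qed.

Lemma ipNl x y : ip (- x) y = - ip x y.
Proof. by rewrite -scaleN1r ipZl mulN1r. Qed.

Lemma ipNr x y : ip x (- y) = - ip x y.
Proof. by rewrite ipC ipNl ipC. Qed.

Lemma ipBl x y z : ip (x - y) z = ip x z - ip y z.
Proof. by rewrite ipDl ipNl. Qed.

Lemma ipBr x y z : ip x (y - z) = ip x y - ip x z.
Proof. by rewrite ipDr ipNr. Qed.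

Lemma ip_suml (I : Type) (s : seq I) (F : I -> H) z :
  ip (\sum_(i <- s) F i) z = \sum_(i <- s) ip (F i) z.
Proof.
elim: s => [|i s IH]; first by rewrite !big_nil ip0l.
by rewrite !big_cons ipDl IH.
Qed.

Lemma ip_sumr (I : Type) (s : seq I) (F : I -> H) z :
  ip z (\sum_(i <- s) F i) = \sum_(i <- s) ip z (F i).
Proof. by rewrite ipC ip_suml; apply: eq_bigr => i _; rewrite ipC. Qed.

Lemma ip_le_norm x y : `|ip x y| <= `|x| * `|y|.
Proof.
have key a : 0 <= `|x| ^+ 2 - 2 * a * ip x y + a ^+ 2 * `|y| ^+ 2.
  have -> : `|x| ^+ 2 - 2 * a * ip x y + a ^+ 2 * `|y| ^+ 2 = `|x - a *: y| ^+ 2.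
    rewrite !(ip_norm hip) ipBl !ipBr !ipZr !ipZl (ipC y x); ring.
  exact: sqr_ge0.
have [y0|y0] := eqVneq y 0.
  by rewrite y0 ipC ip0l !normr0 mulr0.
have ny : 0 < `|y| ^+ 2 by rewrite exprn_gt0// normr_gt0.
have := key (ip x y / `|y| ^+ 2).
have -> : `|x| ^+ 2 - 2 * (ip x y / `|y| ^+ 2) * ip x y + (ip x y / `|y| ^+ 2) ^+ 2 * `|y| ^+ 2
  = `|x| ^+ 2 - (ip x y) ^+ 2 / `|y| ^+ 2.
  by field; rewrite gt_eqF// normr_gt0.
rewrite subr_ge0 ler_pdivrMr// -exprMn -[X in X <= _]real_normK ?num_real//.
by move=> h; rewrite -(ler_pXn2r (n := 2)) ?nnegrE ?mulr_ge0.
Qed.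

End InnerProduct.

Section IsonormalLaw.
Context (R : realType) (H : completeNormedModType R) (ip : H -> H -> R).
Hypothesis hip : hilbert_product ip.
Context (d : measure_display) (T : measurableType d) (P : probability T R).
Variable W : H -> {RV P >-> R}.
Hypothesis iW : isonormal ip W.

Lemma meas_W h : measurable_fun setT (W h). Proof. exact: measurable_funPT. Qed.

Lemma moments_W h : all_moments P (W h).
Proof.
have [m [s l]] := @iso_gaussian _ _ _ _ _ _ _ iW 1 (fun=> 1) (fun=> h).
rewrite (_ : (fun w => _) = W h) in l; last by apply/funext => w; rewrite big_ord1 mul1r.
exact: gaussian_moments l.
Qed.

Lemma Ex_W h : Ex P (W h) = 0.
Proof.
have := iso_centered iW h; rewrite unlock EFin_Ex//; last exact/moments_L1/moments_W.
by move=> [].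
Qed.

Lemma Ex_WW h g : Ex P (fun w => W h w * W g w) = ip h g.
Proof.
have := iso_covariance iW h g; rewrite unlock EFin_Ex//; last first.
  by apply/moments_L1/momentsM; exact: moments_W.
by move=> [].
Qed.

(** [iso_gaussian] leaves the parameters m and s open; the mean gives m = 0, and the covariances
    give s^2 = |S|^2. The result depends on the family only through the vector S. *)
Lemma Ex_cos_W (n : nat) (a : 'I_n -> R) (h : 'I_n -> H) (b : R) :
  let S := \sum_i a i *: h i in
  Ex P (fun w => cos (\sum_i a i * W (h i) w + b)) = cos b * expR (- ip S S / 2).
Proof.
move=> S.
have [m [s l]] := iso_gaussian iW a h.
pose X : {mfun T >-> R} := \sum_i a i *: (W (h i) : {mfun T >-> R}).
have XE w : X w = \sum_i a i * W (h i) w by rewrite mfun_sum.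
rewrite (_ : (fun w => _) = X) in l; last by apply/funext => w; rewrite XE.
have iX i : L1 P (fun w => a i * W (h i) w) by apply/L1Z/moments_L1/moments_W.
have m0 : m = 0.
  rewrite -(gaussian_mean l) (eq_Ex _ XE) Ex_sum// big1// => i _.
  by rewrite ExZ ?Ex_W ?mulr0//; exact/moments_L1/moments_W.
have sE : s ^+ 2 = ip S S.
  rewrite -(gaussian_var l) m0.
  transitivity (Ex P (fun w => \sum_i \sum_j (a i * a j) * (W (h i) w * W (h j) w))).
    apply: eq_Ex => w; rewrite subr0 expr2 XE mulr_suml; apply: eq_bigr => i _.
    rewrite mulr_sumr; apply: eq_bigr => j _; ring.
  have iij i j : L1 P (fun w => (a i * a j) * (W (h i) w * W (h j) w)).
    by apply/L1Z/moments_L1/momentsM; exact: moments_W.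
  rewrite Ex_sum => [|i]; last exact: L1_sum.
  rewrite /S (ip_suml hip); apply: eq_bigr => i _.
  rewrite Ex_sum// (ip_sumr hip); apply: eq_bigr => j _.
  rewrite ExZ ?Ex_WW; last by apply/moments_L1/momentsM; exact: moments_W.
  rewrite (ipZl hip) (ipZr hip); ring.
have := gaussian_cos l 1 b; rewrite m0 mulr1 sE => <-.
by apply: eq_Ex => w; rewrite subr0 mul1r XE.
Qed.

End IsonormalLaw.

(** * Gaussian integration by parts *)

Lemma continuous_rsum (R : realType) (V : topologicalType) (I : Type) (s : seq I)
    (F : I -> V -> R) : (forall i, continuous (F i)) ->
  continuous (fun x => \sum_(i <- s) F i x).
Proof.
move=> cF; elim: s => [|i s IH].
  by under eq_fun do rewrite big_nil; move=> x; exact: cst_continuous.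
under eq_fun do rewrite big_cons.
by move=> x; apply: (@continuousD _ R^o); [exact: cF|exact: IH].
Qed.

Section ProductExpectation.
Context (R : realType) (d1 d2 : measure_display).
Context (T1 : measurableType d1) (T2 : measurableType d2).
Variables (P1 : probability T1 R) (P2 : probability T2 R).
Notation P12 := ((P1 \x P2)%E : probability (T1 * T2)%type R).

Lemma Ex_fubini (f : T1 * T2 -> R) : L1 P12 f -> (forall w, L1 P1 (fun x => f (x, w))) ->
  Ex P12 f = Ex P2 (fun w => Ex P1 (fun x => f (x, w))).
Proof.
move=> i12 i1; rewrite /Ex /Rintegral; congr fine.
rewrite -(@integral21_prod_meas1 _ _ _ _ _ P1 P2 (EFin \o f) i12).
apply: eq_integral => w _; rewrite /fubini_G /= fineK//.
exact: (integrable_fin_num measurableT (i1 w)).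
Qed.

Lemma L1_fst (f : T1 -> R) : L1 P1 f -> L1 P12 (fun z => f z.1).
Proof.
move=> i; have mf := L1_meas i.
have m2 : measurable_fun setT (EFin \o (fun z : T1 * T2 => f z.1)).
  by apply/measurable_EFinP; exact: measurableT_comp.
apply/(integrable12ltyP P1 P2 m2).
have /integrableP[_] := i; apply: le_lt_trans.
rewrite le_eqVlt; apply/orP; left; apply/eqP.
by apply: eq_integral => x _ /=; rewrite integral_cst//= [X in (_ * X)%E]probability_setT mule1.
Qed.

Lemma L1_snd (f : T2 -> R) : L1 P2 f -> L1 P12 (fun z => f z.2).
Proof.
move=> i; have mf := L1_meas i.
have m2 : measurable_fun setT (EFin \o (fun z : T1 * T2 => f z.2)).
  by apply/measurable_EFinP; exact: measurableT_comp.
apply/(integrable21ltyP P1 P2 m2).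
have /integrableP[_] := i; apply: le_lt_trans.
rewrite le_eqVlt; apply/orP; left; apply/eqP.
by apply: eq_integral => x _ /=; rewrite integral_cst//= [X in (_ * X)%E]probability_setT mule1.
Qed.

Lemma moments_fst (f : T1 -> R) : all_moments P1 f -> all_moments P12 (fun z => f z.1).
Proof.
move=> [mf i]; split=> [|k]; first exact: measurableT_comp.
exact: (L1_fst (i k)).
Qed.

Lemma moments_snd (f : T2 -> R) : all_moments P2 f -> all_moments P12 (fun z => f z.2).
Proof.
move=> [mf i]; split=> [|k]; first exact: measurableT_comp.
exact: (L1_snd (i k)).
Qed.

End ProductExpectation.

Section PolyGrowth.
Context (R : realType) (n : nat).
Implicit Types (y : 'rV[R]_n.+1 -> R).

Lemma rV_norm_le_sum (x : 'rV[R]_n.+1) : `|x| <= \sum_i `|x 0 i|.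
Proof.
rewrite [leLHS]/Num.norm/= mx_normrE; apply/bigmax_leP; split=> [|[i j] _ /=].
  exact: sumr_ge0.
by rewrite ord1 (bigD1 j)//= lerDl sumr_ge0.
Qed.

Lemma poly_growth_ge0 y C k : (forall x, `|y x| <= C * (1 + `|x|) ^+ k) -> 0 <= C.
Proof. by move=> /(_ 0); rewrite normr0 addr0 expr1n mulr1; apply: le_trans. Qed.

Context (d : measure_display) (T : measurableType d) (P : probability T R).

Lemma moments_poly_growth (Z : T -> 'rV[R]_n.+1) y :
  (forall i, all_moments P (fun w => Z w 0 i)) -> continuous y -> poly_growth y ->
  all_moments P (fun w => y (Z w)).
Proof.
move=> mZ cy [C [k hC]].
have C0 := poly_growth_ge0 hC.
apply: (@moments_le _ _ _ _ _ (fun w => C * (1 + \sum_i `|Z w 0 i|) ^+ k)).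
- by apply: (measurable_continuous_rV P) => // i; have [] := mZ i.
- move=> w; apply: le_trans (ler_norm _); apply: (le_trans (hC _)).
  rewrite ler_wpM2l// lerXn2r ?nnegrE ?addr_ge0 ?sumr_ge0//.
  by rewrite lerD2l rV_norm_le_sum.
- apply/momentsZ/momentsX/momentsD; first exact: moments_cst.
  by apply: moments_sum => i; exact: moments_norm.
Qed.

End PolyGrowth.

Lemma normal_moments (R : realType) : all_moments (normal_prob 0 1 : probability _ R) id.
Proof.
split=> // k; apply: (L1_poly_bound _ (oner_neq0 R) (k := k)).
  by apply: measurable_funX; exact: normr_measurable.
exists 1 => x; rewrite normrX normr_id mul1r lerXn2r ?nnegrE ?addr_ge0//.
by rewrite lerDr.
Qed.

Lemma is_derive_line (R : realType) n (y : 'rV[R]_n -> R) (c u : 'rV[R]_n) (x : R) :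
  differentiable y (x *: c + u) ->
  is_derive x 1 (fun x : R => y (x *: c + u)) ('D_c y (x *: c + u)).
Proof.
move=> dy.
have e : (fun h : R => h^-1 *: (y (((h *: (1 : R) + x) *: c + u)) - y (x *: c + u))) =
  (fun h : R => h^-1 *: (y (h *: c + (x *: c + u)) - y (x *: c + u))).
  by apply/funext => h; rewrite addrA -scalerDl [h *: 1]mulr1.
have dv : derivable y (x *: c + u) c by exact: diff_derivable.
apply: DeriveDef.
  by rewrite /derivable [X in cvg (X @ _)]e.
by rewrite /derive [X in lim (X @ _)]e.
Qed.

Section IsonormalIBP.
Context (R : realType) (H : completeNormedModType R) (ip : H -> H -> R).
Hypothesis hip : hilbert_product ip.
Context (d : measure_display) (T : measurableType d) (P : probability T R).
Variable W : H -> {RV P >-> R}.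
Hypothesis iW : isonormal ip W.
Notation RR := (measurableTypeR R).
Let N : probability RR R := normal_prob 0 1.
Let NP : probability (RR * T)%type R := (N \x P)%E.

(* For |h| = 1, (W h, W g) has the law of (N, W(g - <g,h>h) + <g,h> N) with N an
   independent standard Gaussian, which reduces the formula to dimension one. *)
Section UnitDirection.
Variables (n : nat) (h : H) (hs : 'I_n.+1 -> H).
Hypothesis h1 : ip h h = 1.

Let c : 'rV[R]_n.+1 := \row_i ip (hs i) h.
Let g i := hs i - c 0 i *: h.

Let ghE i : ip (g i) h = 0.
Proof. by rewrite /g (ipBl hip) (ipZl hip) h1 mulr1 mxE subrr. Qed.

Definition consv (a : R) (u : 'rV[R]_n.+1) : 'rV[R]_n.+2 :=
  \row_i if unlift ord0 i is Some j then u 0 j else a.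

Definition tailv (x : 'rV[R]_n.+2) : 'rV[R]_n.+1 := \row_i x 0 (lift ord0 i).

Lemma consv0 a u : consv a u 0 ord0 = a.
Proof. by rewrite mxE unlift_none. Qed.

Lemma consvS a u i : consv a u 0 (lift ord0 i) = u 0 i.
Proof. by rewrite mxE liftK. Qed.

Lemma tailv_consv a u : tailv (consv a u) = u.
Proof. by apply/rowP => i; rewrite mxE consvS. Qed.

Lemma continuous_tailv : continuous tailv.
Proof.
move=> x A /nbhs_ballP[e e0 eA]; apply/nbhs_ballP; exists e => // z [_ xz].
by apply: eA; split=> // i j; rewrite !mxE; exact: xz.
Qed.

Let Wv w : 'rV[R]_n.+1 := \row_i W (hs i) w.
Let Uv w : 'rV[R]_n.+1 := \row_i W (g i) w.
Let Z1 w := consv (W h w) (Wv w).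
Let Z2 (z : RR * T) := consv z.1 ((z.1 : R) *: c + Uv z.2).

Let moments_Z1 i : all_moments P (fun w => Z1 w 0 i).
Proof.
case: (unliftP ord0 i) => [j|] ->.
  by under eq_fun do rewrite consvS mxE; exact: (moments_W iW).
by under eq_fun do rewrite consv0; exact: (moments_W iW).
Qed.

Let moments_Z2 i : all_moments NP (fun z => Z2 z 0 i).
Proof.
have m1 : all_moments NP (fun z => z.1) := moments_fst P (@normal_moments R).
case: (unliftP ord0 i) => [j|] ->; last by under eq_fun do rewrite consv0.
under eq_fun do rewrite consvS.
under eq_fun do rewrite !mxE mulrC.
by apply: momentsD; [exact: momentsZ|exact: (moments_snd _ (moments_W iW _))].
Qed.

(** The vector attached to l splits as S = th h + S' with S' orthogonal to h, so |S|^2 = th^2 +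
    |S'|^2. The Gaussian factor of th comes from integrating out the independent variable, the one
    of S' from [Ex_cos_W]. *)
Let cos_Z1_Z2 l b :
  Ex P (fun w => cos (dotv l (Z1 w) + b)) = Ex NP (fun z => cos (dotv l (Z2 z) + b)).
Proof.
pose th := l 0 ord0 + \sum_i l 0 (lift ord0 i) * c 0 i.
pose S' := \sum_i l 0 (lift ord0 i) *: g i.
pose hh i := if unlift ord0 i is Some j then hs j else h.
pose S := \sum_i l 0 i *: hh i.
have SE : S = th *: h + S'.
  rewrite /S big_ord_recl /hh unlift_none /th scalerDl -addrA; congr (_ + _).
  rewrite scaler_suml /S' -big_split/=; apply: eq_bigr => i _.
  by rewrite liftK /g scalerBr scalerA addrC subrK.
have hS' : ip h S' = 0.
  rewrite (ip_sumr hip) big1// => i _.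
  by rewrite (ipZr hip) (ipC hip) ghE mulr0.
have ipS : ip S S = th ^+ 2 + ip S' S'.
  rewrite SE !(ipDl hip) !(ipDr hip) !(ipZl hip) !(ipZr hip) h1 (ipC hip S' h) hS'; ring.
have := Ex_cos_W hip iW (fun i => l 0 i) hh b; rewrite -/S => e1.
transitivity (cos b * expR (- ip S S / 2)).
  rewrite -e1; apply: eq_Ex => w; congr (cos (_ + b)).
  rewrite /dotv; apply: eq_bigr => i _; congr (_ * _).
  by case: (unliftP ord0 i) => [j|] ->; rewrite ?consvS ?consv0 ?mxE /hh ?liftK ?unlift_none.
have mcos := continuous_measurable_fun (@continuous_cos R).
have dE z : dotv l (Z2 z) + b = th * (z.1 - 0) + (\sum_i l 0 (lift ord0 i) * W (g i) z.2 + b).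
  rewrite subr0 /dotv big_ord_recl consv0 /th mulrDl -!addrA; congr (_ + _).
  rewrite addrA; congr (_ + _); rewrite mulr_suml -big_split/=; apply: eq_bigr => i _.
  by rewrite consvS !mxE; ring.
rewrite (eq_Ex _ (fun z => congr1 cos (dE z))).
have mZ : measurable_fun setT (fun z => dotv l (Z2 z) + b).
  apply: measurable_funD => //; apply: measurable_sum => i; apply: measurable_funM => //.
  by have [] := moments_Z2 i.
rewrite (@Ex_fubini _ _ _ _ _ N P); last 2 first.
- apply: (@L1_bounded _ _ _ _ _ 1) => [|x]; last exact: cos_max.
  by under eq_fun do rewrite -dE; exact: measurableT_comp mcos mZ.
- move=> w; apply: (@L1_bounded _ _ _ _ _ 1) => [|x]; last exact: cos_max.
  apply: (measurableT_comp mcos); apply: measurable_funD => /=; last exact: measurable_cst.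
  by apply: measurable_funM => //; apply: measurable_funB => //; exact: measurable_cst.
have cosN (t a : R) : Ex N (fun x => cos (t * (x - 0) + a)) =
    cos a * expR (- (1 * t) ^+ 2 / 2) := Ex_normal_cos 0 (oner_neq0 R) t a.
transitivity (Ex P (fun w => expR (- (1 * th) ^+ 2 / 2) *
    cos (\sum_i l 0 (lift ord0 i) * W (g i) w + b))); last first.
  by apply: eq_Ex => w; rewrite mulrC -cosN.
rewrite ExZ; last first.
  apply: (@L1_bounded _ _ _ _ _ 1) => [|x]; last exact: cos_max.
  apply: (measurableT_comp mcos); apply: measurable_funD => //.
  by apply: measurable_sum => i; apply: measurable_funM => //; exact: meas_W.
by rewrite (Ex_cos_W hip iW) -/S' ipS mul1r mulrCA -expRD; congr (_ * expR _); field.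
Qed.

(** On the product space the Gaussian variable and the remaining vector u = [Uv w] are separate, and
    Fubini reduces the claim to one-dimensional integration by parts for x |-> y(x c + u), whose
    derivative is 'D_c y on that line. *)
Lemma gaussian_ibp_unit (y : 'rV[R]_n.+1 -> R) :
  (forall x, differentiable y x) -> continuous ('D_c y) ->
  poly_growth y -> poly_growth ('D_c y) ->
  Ex P (fun w => W h w * y (Wv w)) = Ex P (fun w => 'D_c y (Wv w)).
Proof.
move=> dy cDy py pDy.
have cy : continuous y by move=> x; exact: differentiable_continuous.
have chead : continuous (fun x : 'rV[R]_n.+2 => x 0 ord0) by exact: coord_continuous.
have ctail (f : 'rV[R]_n.+1 -> R) : continuous f -> continuous (fun x => f (tailv x)).
  by move=> cf x; apply: continuous_comp; [exact: continuous_tailv|exact: cf].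
have c1 : continuous (fun x : 'rV[R]_n.+2 => x 0 ord0 * y (tailv x)).
  by move=> x; apply: continuousM; [exact: chead|exact: ctail].
have mW : forall i, all_moments P (fun w => Wv w 0 i).
  by move=> i; under eq_fun do rewrite mxE; exact: (moments_W iW).
have mz1 : all_moments NP (fun z => z.1) := moments_fst P (@normal_moments R).
have mU i : all_moments NP (fun z => ((z.1 : R) *: c + Uv z.2) 0 i).
  have := moments_Z2 (lift ord0 i); by under eq_fun do rewrite consvS.
have mWf f cf pf := @moments_poly_growth _ _ _ _ P Wv f mW cf pf.
have mUf f cf pf := @moments_poly_growth _ _ _ _ NP _ f mU cf pf.
have law_tr := @law_from_cos _ _ _ _ _ _ P NP Z1 Z2 (fun i => proj1 (moments_Z1 i))
  (fun i => proj1 (moments_Z2 i)) cos_Z1_Z2.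
transitivity (Ex NP (fun z => z.1 * y ((z.1 : R) *: c + Uv z.2))).
  transitivity (Ex P (fun w => (fun x : 'rV[R]_n.+2 => x 0 ord0 * y (tailv x)) (Z1 w))).
    by apply: eq_Ex => w; rewrite consv0 tailv_consv.
  transitivity (Ex NP (fun w => (fun x : 'rV[R]_n.+2 => x 0 ord0 * y (tailv x)) (Z2 w))); last first.
    by apply: eq_Ex => w; rewrite consv0 tailv_consv.
  apply: (law_tr _ c1).
  - apply: moments_L1; under eq_fun do rewrite consv0 tailv_consv.
    by apply: momentsM; [exact: (moments_W iW)|exact: (mWf y cy py)].
  - apply: moments_L1; under eq_fun do rewrite consv0 tailv_consv.
    by apply: momentsM => //; exact: (mUf y cy py).
transitivity (Ex NP (fun z => 'D_c y ((z.1 : R) *: c + Uv z.2))); last first.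
  transitivity (Ex NP (fun w => (fun x => 'D_c y (tailv x)) (Z2 w))).
    by apply: eq_Ex => w; rewrite tailv_consv.
  transitivity (Ex P (fun w => (fun x => 'D_c y (tailv x)) (Z1 w))); last first.
    by apply: eq_Ex => w; rewrite tailv_consv.
  apply/esym/(law_tr _ (ctail _ cDy)).
  - apply: moments_L1; under eq_fun do rewrite tailv_consv.
    exact: (mWf _ cDy pDy).
  - apply: moments_L1; under eq_fun do rewrite tailv_consv.
    exact: (mUf _ cDy pDy).
have bnd (f : 'rV[R]_n.+1 -> R) (u : 'rV[R]_n.+1) : poly_growth f ->
    exists k, poly_bound k (fun x : R => f (x *: c + u)).
  move=> [C [k hC]]; exists k; exists (C * (1 + `|c| + `|u|) ^+ k) => x.
  have C0 := poly_growth_ge0 hC.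
  rewrite (le_trans (hC _))// -mulrA ler_wpM2l// -exprMn lerXn2r ?nnegrE ?mulr_ge0 ?addr_ge0//.
  have h2 : `|x *: c + u| <= `|x| * `|c| + `|u| by rewrite -normrZ ler_normD.
  have := normr_ge0 x; have := normr_ge0 c; have := normr_ge0 u.
  move: (`|x|) (`|c|) (`|u|) (`|x *: c + u|) h2 => a b e f'; nra.
have wbnd (f : 'rV[R]_n.+1 -> R) k k' (u : 'rV[R]_n.+1) : (k <= k')%N ->
    poly_bound k (fun x : R => f (x *: c + u)) -> poly_bound k' (fun x : R => f (x *: c + u)).
  move=> kk [C hC]; exists C => x; apply: (le_trans (hC x)).
  have C0 : 0 <= C.
    by have := hC 0; rewrite normr0 addr0 expr1n mulr1; apply: le_trans.
  by rewrite ler_wpM2l// ler_weXn2l// lerDl.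
have cline (f : 'rV[R]_n.+1 -> R) (u : 'rV[R]_n.+1) : continuous f ->
    continuous (fun x : R => f (x *: c + u)).
  move=> cf x; apply: (continuous_comp (f := fun x : R => x *: c + u)); last exact: cf.
  by apply: cvgD; [apply: cvgZr_tmp; exact: cvg_id|exact: cvg_cst].
rewrite (@Ex_fubini _ _ _ _ _ N P); last 2 first.
- by apply: moments_L1; apply: momentsM => //; exact: (mUf y cy py).
- move=> w; have [k [C hC]] := bnd y (Uv w) py.
  apply: (L1_poly_bound _ (oner_neq0 R) (k := k.+1)).
    have mm := continuous_measurable_fun (cline y (Uv w) cy).
    by rewrite /=; apply: (measurable_funM (@measurable_id _ _ _) mm).
  exists C => x; rewrite normrM exprS mulrCA ler_pM// lerDr//.
rewrite (@Ex_fubini _ _ _ _ _ N P); last 2 first.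
- by apply: moments_L1; exact: (mUf _ cDy pDy).
- move=> w; have [k hC] := bnd _ (Uv w) pDy.
  apply: (L1_poly_bound _ (oner_neq0 R) (k := k)) => //.
  have mm := continuous_measurable_fun (cline _ (Uv w) cDy).
  exact: mm.
apply: eq_Ex => w.
have [k1 b1] := bnd y (Uv w) py; have [k2 b2] := bnd _ (Uv w) pDy.
have := @Ex_normal_ibp R 0 1 (oner_neq0 R) _ _ (maxn k1 k2)
  (fun x => is_derive_line (dy (x *: c + Uv w))) (cline _ (Uv w) cDy)
  (wbnd y _ _ (Uv w) (leq_maxl _ _) b1) (wbnd ('D_c y) _ _ (Uv w) (leq_maxr _ _) b2).
rewrite expr1n mul1r => <-.
by apply: eq_Ex => x; rewrite subr0.
Qed.

End UnitDirection.

(** W is homogeneous only in L^2: the covariances show that W (a g) - a W g has second moment 0, and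
    Cauchy-Schwarz does the rest. *)
Lemma Ex_W_scale (a : R) (g : H) (Y : T -> R) : L2 P Y ->
  Ex P (fun w => W (a *: g) w * Y w) = a * Ex P (fun w => W g w * Y w).
Proof.
move=> iY.
have i1 := moments_L2 (moments_W iW (a *: g)).
have i2 := moments_L2 (moments_W iW g).
have i3 := L2M i1 iY; have i4 := L2M i2 iY.
rewrite -ExZ//; apply/eqP; rewrite -subr_eq0 -ExB//; last exact: L1Z.
have i5 := L2B i1 (L2Z a i2).
rewrite (eq_Ex _ (g := fun w => (W (a *: g) w - a * W g w) * Y w)); last by move=> w; ring.
rewrite -normr_le0 (le_trans (Ex_norm (L2M i5 iY)))//.
rewrite (le_trans (Ex_cauchy_schwarz i5 iY))//.
suff -> : Ex P (fun w => (W (a *: g) w - a * W g w) ^+ 2) = 0 by rewrite sqrtr0 mul0r.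
have m1 h h' : L1 P (fun w => W h w * W h' w) by apply/moments_L1/momentsM; exact: (moments_W iW).
rewrite (eq_Ex _ (g := fun w => W (a *: g) w * W (a *: g) w +
  ((- (2 * a)) * (W (a *: g) w * W g w) + a ^+ 2 * (W g w * W g w)))); last by move=> w; ring.
rewrite ExD//; last by apply: L1D; exact: L1Z.
rewrite ExD; [|exact: L1Z|exact: L1Z].
rewrite !ExZ// !(Ex_WW iW) !(ipZl hip) (ipZr hip); ring.
Qed.

Lemma derive_sum_partial n (y : 'rV[R]_n.+1 -> R) (c x : 'rV[R]_n.+1) :
  differentiable y x -> 'D_c y x = \sum_i c 0 i * partial i y x.
Proof.
move=> dy; rewrite deriveE//.
rewrite [in LHS](matrix_sum_delta c) big_ord1 linear_sum.
by apply: eq_bigr => i _; rewrite linearZ/= /partial deriveE.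
Qed.

Lemma gaussian_ibp n (h : H) (hs : 'I_n.+1 -> H) (y : 'rV[R]_n.+1 -> R) :
  (forall x, differentiable y x) -> poly_growth y ->
  (forall i, continuous (partial i y)) -> (forall i, poly_growth (partial i y)) ->
  Ex P (fun w => W h w * y (\row_i W (hs i) w)) =
  \sum_i ip (hs i) h * Ex P (fun w => partial i y (\row_i W (hs i) w)).
Proof.
move=> dy py cp pp.
have cy : continuous y by move=> x; exact: differentiable_continuous.
have mW : forall i, all_moments P (fun w => (\row_i W (hs i) w) 0 i).
  by move=> i; under eq_fun do rewrite mxE; exact: (moments_W iW).
have iy := @moments_poly_growth _ _ _ _ P _ y mW cy py.
have ip' i := @moments_poly_growth _ _ _ _ P _ _ mW (cp i) (pp i).
have unit (u : H) : ip u u = 1 -> Ex P (fun w => W u w * y (\row_i W (hs i) w)) =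
    \sum_i ip (hs i) u * Ex P (fun w => partial i y (\row_i W (hs i) w)).
  move=> u1; pose c : 'rV[R]_n.+1 := \row_i ip (hs i) u.
  have DE : 'D_c y = fun x => \sum_i c 0 i * partial i y x.
    by apply/funext => x; rewrite derive_sum_partial.
  have cD : continuous ('D_c y).
    rewrite DE; apply: continuous_rsum => i x; apply: continuousM; [exact: cst_continuous|exact: cp].
  have pD : poly_growth ('D_c y).
    rewrite DE; elim: (index_enum _) => [|i s [C [k hC]]].
      by exists 0, 0%N => x; rewrite big_nil normr0 mul0r.
    have [D [k' hD]] := pp i.
    have C0 := poly_growth_ge0 hC; have D0 := poly_growth_ge0 hD.
    exists (C + `|c 0 i| * D), (maxn k k') => x.
    rewrite big_cons addrC mulrDl (le_trans (ler_normD _ _))// lerD//.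
      rewrite (le_trans (hC _))// ler_wpM2l// ler_weXn2l ?leq_maxl// lerDl//.
    rewrite normrM -mulrA ler_wpM2l// (le_trans (hD _))// ler_wpM2l//.
    by rewrite ler_weXn2l ?leq_maxr// lerDl.
  rewrite (gaussian_ibp_unit u1 dy cD py pD).
  rewrite (eq_Ex _ (fun w => derive_sum_partial _ (dy _))) Ex_sum => [|i]; last exact/L1Z/moments_L1.
  by apply: eq_bigr => i _; rewrite ExZ ?mxE//; exact: moments_L1.
have [h0|h0] := eqVneq h 0.
  (* Writing 0 as 0 *: 0 turns homogeneity into the vanishing of the left-hand side. *)
  rewrite h0 -(scaler0 _ 0) Ex_W_scale ?mul0r; last exact: moments_L2.
  by rewrite big1// => i _; rewrite (ipZr hip) !mul0r.
have nh : `|h| != 0 by rewrite normr_eq0.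
pose u := `|h|^-1 *: h.
have hE : h = `|h| *: u by rewrite scalerA divff// scale1r.
have u1 : ip u u = 1.
  by rewrite (ipZl hip) (ipZr hip) -(ip_norm hip); field.
rewrite [in LHS]hE Ex_W_scale; last exact: moments_L2.
rewrite (unit u u1) mulr_sumr; apply: eq_bigr => i _.
have -> : ip (hs i) h = `|h| * ip (hs i) u by rewrite -(ipZr hip) -hE.
by rewrite mulrA.
Qed.

End IsonormalIBP.

(** * Cylindrical functionals *)

Section PolyGrowthClosure.
Context (R : realType) (n : nat).
Implicit Types (y z : 'rV[R]_n.+1 -> R).

Lemma poly_growthD y z : poly_growth y -> poly_growth z -> poly_growth (fun x => y x + z x).
Proof.
move=> [C [k hC]] [D [l hD]]; have C0 := poly_growth_ge0 hC; have D0 := poly_growth_ge0 hD.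
exists (C + D), (maxn k l) => x; rewrite (le_trans (ler_normD _ _))// mulrDl lerD//.
  by rewrite (le_trans (hC x))// ler_wpM2l// ler_weXn2l ?leq_maxl// lerDl.
by rewrite (le_trans (hD x))// ler_wpM2l// ler_weXn2l ?leq_maxr// lerDl.
Qed.

Lemma poly_growthM y z : poly_growth y -> poly_growth z -> poly_growth (fun x => y x * z x).
Proof.
move=> [C [k hC]] [D [l hD]]; have C0 := poly_growth_ge0 hC; have D0 := poly_growth_ge0 hD.
exists (C * D), (k + l)%N => x; rewrite normrM exprD mulrACA.
by apply: ler_pM.
Qed.

Lemma poly_growth_bounded y C : (forall x, `|y x| <= C) -> poly_growth y.
Proof. by move=> hC; exists C, 0%N => x; rewrite expr0 mulr1. Qed.

Lemma poly_growth_sum (I : Type) (s : seq I) (F : I -> 'rV[R]_n.+1 -> R) :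
  (forall i, poly_growth (F i)) -> poly_growth (fun x => \sum_(i <- s) F i x).
Proof.
move=> pF; elim: s => [|i s IH].
  by apply: (@poly_growth_bounded _ 0) => x; rewrite big_nil normr0.
by under [X in poly_growth X]eq_fun do rewrite big_cons; exact: poly_growthD.
Qed.

End PolyGrowthClosure.

(** Integration by parts involves one derivative. Asking for no more makes the class stable under
    composition with bounded C^1 functions whose derivative is bounded, whereas [smooth_poly_growth]
    would ask for a smooth outer function. *)
Definition C1_poly_growth (R : realType) n (y : 'rV[R]_n.+1 -> R) : Prop :=
  [/\ forall x, differentiable y x, poly_growth y,
      forall i, continuous (partial i y) & forall i, poly_growth (partial i y)].

Section C1PolyGrowth.
Context (R : realType) (n : nat).
Implicit Types (y z : 'rV[R]_n.+1 -> R).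

Lemma continuous_C1 y : C1_poly_growth y -> continuous y.
Proof. by move=> [dy _ _ _] x; exact: differentiable_continuous. Qed.

Lemma derive_C1 y c : C1_poly_growth y ->
  continuous ('D_c y) /\ poly_growth ('D_c y).
Proof.
move=> [dy _ cy py].
have -> : 'D_c y = fun x => \sum_i c 0 i * partial i y x.
  by apply/funext => x; rewrite derive_sum_partial.
split.
  by apply: continuous_rsum => i x; apply: continuousM; [exact: cst_continuous|exact: cy].
apply: poly_growth_sum => i; apply: poly_growthM => //.
exact: (@poly_growth_bounded _ _ _ `|c 0 i|).
Qed.

Lemma C1D y z : C1_poly_growth y -> C1_poly_growth z ->
  C1_poly_growth (fun x => y x + z x).
Proof.
move=> [d1 p1 c1 q1] [d2 p2 c2 q2].
have pE i : partial i (fun x => y x + z x) = fun x => partial i y x + partial i z x.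
  by apply/funext => x; rewrite /partial (@deriveD _ _ _ y z)//; exact: diff_derivable.
split.
- by move=> x; apply: differentiableD.
- exact: poly_growthD.
- by move=> i; rewrite pE => x; apply: (@continuousD _ R^o); [exact: c1|exact: c2].
- by move=> i; rewrite pE; exact: poly_growthD.
Qed.

Lemma C1M y z : C1_poly_growth y -> C1_poly_growth z ->
  C1_poly_growth (fun x => y x * z x).
Proof.
move=> C1 C2; have [d1 p1 c1 q1] := C1; have [d2 p2 c2 q2] := C2.
have pE i : partial i (fun x => y x * z x) = fun x => y x * partial i z x + z x * partial i y x.
  by apply/funext => x; rewrite /partial (@deriveM _ _ y z)//; exact: diff_derivable.
have cy := continuous_C1 C1; have cz := continuous_C1 C2.
split.
- by move=> x; apply: differentiableM.
- exact: poly_growthM.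
- move=> i; rewrite pE => x.
  apply: (@continuousD _ R^o _ (fun x => y x * partial i z x) (fun x => z x * partial i y x)).
    by apply: continuousM; [exact: cy|exact: c2].
  by apply: continuousM; [exact: cz|exact: c1].
- by move=> i; rewrite pE; apply: poly_growthD; exact: poly_growthM.
Qed.

Lemma derive_comp1 (phi phi' : R -> R) y c x : is_derive (y x) (1 : R) phi (phi' (y x)) ->
  differentiable y x -> 'D_c (fun x => phi (y x)) x = phi' (y x) * 'D_c y x.
Proof.
move=> dphi dy.
have dv : derivable phi (y x) 1 by exact: ex_derive.
have df : differentiable phi (y x) by apply/derivable1_diffP.
rewrite (@deriveE _ _ _ (phi \o y)); last exact: differentiable_comp.
rewrite (diff_comp dy df)/= -deriveE// deriveE// -[X in 'd phi (y x) X]mulr1.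
rewrite [_ * 1](_ : _ = ('d y x c) *: (1 : R))// linearZ/= -[X in _ *: X]deriveE//.
by rewrite derive_val deriveE// mulrC.
Qed.

Lemma C1_comp (phi phi' : R -> R) y M : (forall x : R, is_derive x (1 : R) phi (phi' x)) ->
  continuous phi' -> (forall x, `|phi x| <= M) -> (forall x, `|phi' x| <= M) ->
  C1_poly_growth y -> C1_poly_growth (fun x => phi (y x)).
Proof.
move=> dphi cphi' bphi bphi' C1; have [d1 p1 c1 q1] := C1.
have pE i : partial i (fun x => phi (y x)) = fun x => phi' (y x) * partial i y x.
  by apply/funext => x; rewrite /partial (derive_comp1 _ (dphi _)).
split.
- move=> x; apply: (@differentiable_comp _ _ _ _ y phi) => //.
  by apply/derivable1_diffP; exact: ex_derive.
- exact: poly_growth_bounded (fun x => bphi (y x)).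
- move=> i; rewrite pE => x; apply: continuousM; last exact: c1.
  by apply: (@continuous_comp _ _ _ y phi'); [exact: continuous_C1|exact: cphi'].
- move=> i; rewrite pE; apply: poly_growthM => //.
  exact: poly_growth_bounded (fun x => bphi' (y x)).
Qed.

Lemma C1_cst (a : R) : C1_poly_growth (fun _ : 'rV[R]_n.+1 => a).
Proof.
have pE i : partial i (fun _ : 'rV[R]_n.+1 => a) = fun=> 0.
  by apply/funext => x; rewrite /partial derive_cst.
split; first by move=> x; exact: differentiable_cst.
- exact: (@poly_growth_bounded _ _ _ `|a|).
- by move=> i; rewrite pE => x; exact: cst_continuous.
- by move=> i; rewrite pE; apply: (@poly_growth_bounded _ _ _ 0) => x; rewrite normr0.
Qed.

Lemma derive_coord (i : 'I_n.+1) (c x : 'rV[R]_n.+1) : 'D_c (fun x : 'rV[R]_n.+1 => x 0 i) x = c 0 i.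
Proof.
have h : derivable (@id 'rV[R]_n.+1) x c by exact: derivable_id.
by have /matrixP/(_ 0 i) := derive_mx h; rewrite derive_id mxE.
Qed.

Lemma C1_coord (i : 'I_n.+1) : C1_poly_growth (fun x : 'rV[R]_n.+1 => x 0 i).
Proof.
have pE j : partial j (fun x : 'rV[R]_n.+1 => x 0 i) = fun=> (delta_mx 0 j : 'rV[R]_n.+1) 0 i.
  by apply/funext => x; rewrite /partial derive_coord.
split; first by move=> x; exact: differentiable_coord.
- exists 1, 1%N => x; rewrite mul1r expr1.
  rewrite (le_trans (_ : _ <= `|x|)) ?lerDr//.
  by rewrite [leRHS]/Num.norm/= mx_normrE (le_bigmax_cond _ (j := (0, i))).
- by move=> j; rewrite pE => x; exact: cst_continuous.
- by move=> j; rewrite pE; exact: (@poly_growth_bounded _ _ _ `|(delta_mx 0 j : 'rV[R]_n.+1) 0 i|).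
Qed.

Lemma C1_horner (p : {poly R}) y : C1_poly_growth y -> C1_poly_growth (fun x => p.[y x]).
Proof.
move=> Cy; elim/poly_ind: p => [|p a IH].
  by under eq_fun do rewrite horner0; exact: C1_cst.
by under eq_fun do rewrite hornerMXaddC; exact: C1D (C1M IH Cy) (C1_cst a).
Qed.

Lemma smooth_C1 (g : 'rV[R]_n.+1 -> R) : smooth_poly_growth g -> C1_poly_growth g.
Proof.
move=> sg; split; [exact: (sg [::]).1|exact: (sg [::]).2| |].
  by move=> i x; apply: differentiable_continuous; exact: (sg [:: i]).1.
by move=> i; exact: (sg [:: i]).2.
Qed.

Lemma smooth_partial (g : 'rV[R]_n.+1 -> R) i : smooth_poly_growth g -> smooth_poly_growth (partial i g).
Proof. by move=> sg s; have := sg (rcons s i); rewrite -cats1 foldr_cat. Qed.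

End C1PolyGrowth.

Lemma derive_lin (R : realType) n m (L : {linear 'rV[R]_n.+1 -> 'rV[R]_m.+1}) y c x :
  'D_c (fun x => y (L x)) x = 'D_(L c) y (L x) :> R.
Proof.
have e0 (h : R) : L (h *: c + x) = h *: L c + L x by rewrite linearD linearZ.
have e : (fun h : R => h^-1 *: (y (L (h *: c + x)) - y (L x))) =
    (fun h : R => h^-1 *: (y (h *: L c + L x) - y (L x))).
  by apply/funext => h; congr (h^-1 *: (y _ - _)); exact: e0.
by rewrite /derive [X in lim (X @ _)]e.
Qed.

Lemma C1_lin (R : realType) n m (L : {linear 'rV[R]_n.+1 -> 'rV[R]_m.+1}) y :
  (forall x, `|L x| <= `|x|) -> C1_poly_growth y -> C1_poly_growth (fun x => y (L x)).
Proof.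
move=> nL Cy; have [d1 [C [k pC]] c1 q1] := Cy.
have cL : continuous L.
  move=> x A /nbhs_ballP[e e0 eA]; apply/nbhs_ballP; exists e => // z.
  rewrite -ball_normE /= => h; apply: eA; rewrite -ball_normE /= -linearB.
  exact: le_lt_trans (nL _) h.
have pL f : poly_growth f -> poly_growth (fun x => f (L x)).
  move=> [C' [k' h]]; exists C', k' => x; rewrite (le_trans (h _))//.
  by rewrite ler_wpM2l ?(poly_growth_ge0 h)// lerXn2r ?nnegrE ?addr_ge0// lerD2l.
have pE i : partial i (fun x => y (L x)) = fun x => 'D_(L (delta_mx 0 i)) y (L x).
  by apply/funext => x; rewrite /partial derive_lin.
split.
- move=> x; apply: (@differentiable_comp _ _ _ _ L y) => //.
  exact: linear_differentiable.
- by apply: pL; exists C, k.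
- move=> i; rewrite pE => x; apply: (@continuous_comp _ _ _ L ('D_(L (delta_mx 0 i)) y)); first exact: cL.
  exact: (derive_C1 _ Cy).1.
- by move=> i; rewrite pE; exact: (pL ('D_(L (delta_mx 0 i)) y) (derive_C1 _ Cy).2).
Qed.

(** Coordinate selections are the linear maps that let a function of a few of the W h_i be read as a
    function of more of them. *)
Definition colsel (R : pzRingType) n m (f : 'I_m -> 'I_n) (x : 'rV[R]_n) : 'rV[R]_m :=
  \row_j x 0 (f j).

Lemma colsel_is_linear (R : pzRingType) n m (f : 'I_m -> 'I_n) : linear (@colsel R n m f).
Proof. by move=> a x y; apply/rowP => j; rewrite !mxE. Qed.

HB.instance Definition _ (R : pzRingType) n m (f : 'I_m -> 'I_n) :=
  GRing.isLinear.Build R 'rV[R]_n 'rV[R]_m _ (@colsel R n m f) (colsel_is_linear f).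

Lemma colsel_norm_le (R : realType) n m (f : 'I_m -> 'I_n) (x : 'rV[R]_n) : `|colsel f x| <= `|x|.
Proof.
rewrite /Num.norm/= !mx_normrE; apply/bigmax_leP; split=> [|[i j] _ /=].
  exact: bigmax_ge_id.
by rewrite mxE; apply: (le_bigmax_cond _ (j := (0, f j))).
Qed.

Section Cylindrical.
Context (R : realType) (H : completeNormedModType R) (ip : H -> H -> R).
Hypothesis hip : hilbert_product ip.
Context (d : measure_display) (T : measurableType d) (P : probability T R).
Variable W : H -> {RV P >-> R}.
Hypothesis iW : isonormal ip W.
Implicit Types (Y Z : T -> R) (DY DZ : H -> T -> R).

Definition Wv n (hs : 'I_n.+1 -> H) (w : T) : 'rV[R]_n.+1 := \row_i W (hs i) w.

(* [DY h] is the directional derivative < DY, h >. *)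
Definition cyl Y DY : Prop := exists n (hs : 'I_n.+1 -> H) y,
  [/\ C1_poly_growth y, Y = (fun w => y (Wv hs w)) &
      DY = (fun h w => 'D_(\row_i ip (hs i) h) y (Wv hs w))].

Lemma moments_Wv n (hs : 'I_n.+1 -> H) (y : 'rV[R]_n.+1 -> R) : continuous y ->
  poly_growth y -> all_moments P (fun w => y (Wv hs w)).
Proof.
move=> cy py; apply: (@moments_poly_growth _ _ _ _ P _ y) => // i.
by under eq_fun do rewrite mxE; exact: (moments_W iW).
Qed.

Lemma cyl_moments Y DY : cyl Y DY -> all_moments P Y /\ forall h, all_moments P (DY h).
Proof.
move=> [n [hs [y [Cy -> ->]]]]; split=> [|h].
  by apply: moments_Wv; [exact: continuous_C1|case: Cy].
by have [c1 c2] := derive_C1 (\row_i ip (hs i) h) Cy; exact: moments_Wv c1 c2.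
Qed.

Lemma cyl_ibp Y DY h : cyl Y DY -> Ex P (fun w => W h w * Y w) = Ex P (DY h).
Proof.
move=> [n [hs [y [Cy -> ->]]]]; have [dy py cp pp] := Cy.
rewrite [LHS](gaussian_ibp hip iW h hs dy py cp pp).
rewrite (eq_Ex _ (fun w => derive_sum_partial _ (dy _))) Ex_sum => [|i].
  apply: eq_bigr => i _; rewrite ExZ ?mxE//.
  by apply: moments_L1; exact: moments_Wv.
by apply/L1Z/moments_L1; exact: moments_Wv.
Qed.

Lemma cyl_lin m n (L : {linear 'rV[R]_n.+1 -> 'rV[R]_m.+1}) (hs : 'I_m.+1 -> H)
    (hs' : 'I_n.+1 -> H) y : (forall x, `|L x| <= `|x|) -> C1_poly_growth y ->
  (forall w, L (Wv hs' w) = Wv hs w) ->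
  (forall h, L (\row_i ip (hs' i) h) = \row_i ip (hs i) h) ->
  [/\ C1_poly_growth (fun x => y (L x)),
      (fun w => y (Wv hs w)) = (fun w => y (L (Wv hs' w))) &
      (fun h w => 'D_(\row_i ip (hs i) h) y (Wv hs w)) =
      (fun h w => 'D_(\row_i ip (hs' i) h) (fun x => y (L x)) (Wv hs' w))].
Proof.
move=> nL Cy LW Li; split; first exact: C1_lin.
  by apply/funext => w; rewrite LW.
by apply/funext => h; apply/funext => w; rewrite derive_lin LW Li.
Qed.

(** The two families of vectors are concatenated, and each function reads its own block of
    coordinates. *)
Lemma cyl_pair Y DY Z DZ : cyl Y DY -> cyl Z DZ ->
  exists n (hs : 'I_n.+1 -> H) y z, [/\ C1_poly_growth y, C1_poly_growth z,
    Y = (fun w => y (Wv hs w)) /\ DY = (fun h w => 'D_(\row_i ip (hs i) h) y (Wv hs w))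
    & Z = (fun w => z (Wv hs w)) /\ DZ = (fun h w => 'D_(\row_i ip (hs i) h) z (Wv hs w))].
Proof.
move=> [n [hs [y [Cy -> ->]]]] [m [gs [z [Cz -> ->]]]].
pose ks (i : 'I_(n.+1 + m.+1)) := match fintype.split i with inl j => hs j | inr j => gs j end.
have e1 j : ks (lshift m.+1 j) = hs j by rewrite /ks -[lshift _ _]/(unsplit (inl j)) unsplitK.
have e2 j : ks (rshift n.+1 j) = gs j by rewrite /ks -[rshift _ _]/(unsplit (inr j)) unsplitK.
pose L1 : {linear 'rV[R]_(n + m.+1).+1 -> 'rV[R]_n.+1} := @colsel R (n.+1 + m.+1) n.+1 (lshift m.+1).
pose L2 : {linear 'rV[R]_(n + m.+1).+1 -> 'rV[R]_m.+1} := @colsel R (n.+1 + m.+1) m.+1 (@rshift n.+1 m.+1).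
have [] := @cyl_lin _ _ L1 hs ks y _ Cy.
- exact: colsel_norm_le.
- by move=> w; apply/rowP => i; rewrite !mxE e1.
- by move=> h; apply/rowP => i; rewrite !mxE e1.
move=> C1 -> ->.
have [] := @cyl_lin _ _ L2 gs ks z _ Cz.
- exact: colsel_norm_le.
- by move=> w; apply/rowP => i; rewrite !mxE e2.
- by move=> h; apply/rowP => i; rewrite !mxE e2.
move=> C2 -> ->.
by exists (n + m.+1)%N, ks, (fun x => y (L1 x)), (fun x => z (L2 x)).
Qed.

Lemma cylM Y DY Z DZ : cyl Y DY -> cyl Z DZ ->
  cyl (fun w => Y w * Z w) (fun h w => Y w * DZ h w + Z w * DY h w).
Proof.
move=> cY cZ; have [n [hs [y [z [Cy Cz [-> ->] [-> ->]]]]]] := cyl_pair cY cZ.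
exists n, hs, (fun x => y x * z x); split=> //; first exact: C1M.
apply/funext => h; apply/funext => w; rewrite (@deriveM _ _ y z)//.
  by apply: diff_derivable; case: Cy.
by apply: diff_derivable; case: Cz.
Qed.

Lemma cyl_horner (p : {poly R}) l :
  cyl (fun w => p.[W l w]) (fun h w => p^`().[W l w] * ip l h).
Proof.
exists 0%N, (fun=> l), (fun x => p.[x 0 0]); split.
- exact/C1_horner/C1_coord.
- by apply/funext => w; rewrite mxE.
apply/funext => h; apply/funext => w.
rewrite (@derive_comp1 _ _ (horner p) (horner p^`())).
- by rewrite derive_coord !mxE.
- exact: differentiable_coord.
Qed.

Lemma cyl_comp Y DY (phi phi' : R -> R) M : (forall x : R, is_derive x (1 : R) phi (phi' x)) ->
  continuous phi' -> (forall x, `|phi x| <= M) -> (forall x, `|phi' x| <= M) ->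
  cyl Y DY -> cyl (fun w => phi (Y w)) (fun h w => phi' (Y w) * DY h w).
Proof.
move=> dphi cphi' bphi bphi' [n [hs [y [Cy -> ->]]]].
exists n, hs, (fun x => phi (y x)); split=> //; first exact: (C1_comp dphi cphi' bphi bphi').
apply/funext => h; apply/funext => w; rewrite (derive_comp1 _ (dphi _))//.
by case: Cy.
Qed.

End Cylindrical.

(** * Malliavin integration by parts *)

Lemma derive_bound_lipschitz (R : realType) (f f' : R -> R) M :
  (forall x : R, is_derive x (1 : R) f (f' x)) -> (forall x, `|f' x| <= M) ->
  forall x y, `|f x - f y| <= M * `|x - y|.
Proof.
move=> df bf x y; wlog xy : x y / x <= y.
  by move=> wl; have [|/ltW] := leP x y => [/wl//|/wl]; rewrite distrC (distrC y).
have cf z : {for z, continuous f} by apply/differentiable_continuous/derivable1_diffP; exact: ex_derive.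
have [|c _] := @MVT_segment R f f' x y xy (fun z _ => df z).
  by apply: continuous_subspaceT => z; exact: cf.
by rewrite distrC => ->; rewrite normrM (distrC x) ler_wpM2r.
Qed.

Section MeasurableConvergence.
Context (d : measure_display) (T : measurableType d) (R : realType).
Variable P : probability T R.

Lemma L2_bounded (f : T -> R) c : measurable_fun setT f -> (forall w, `|f w| <= c) -> L2 P f.
Proof.
move=> mf fc; split=> //; apply: (@L1_bounded _ _ _ _ _ (c ^+ 2)); first exact: measurable_funX.
by move=> w; rewrite normrX lerXn2r ?nnegrE// (le_trans _ (fc w)).
Qed.

(** An extended integral that tends to 0 is finite from some rank on. Earlier terms may be infinite,
    and there [Ex] is 0 by default, which does not affect the limit. *)
Lemma integrable_cvg0 (D : nat -> T -> R) : (forall n w, 0 <= D n w) ->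
  (forall n, measurable_fun setT (D n)) ->
  ((\int[P]_w (D n w)%:E)%E @[n --> \oo] --> 0%E) ->
  exists2 N, forall n, (N <= n)%N -> L1 P (D n) & Ex P (D n) @[n --> \oo] --> (0 : R).
Proof.
move=> D0 mD cD.
have int n : (\int[P]_w (D n w)%:E < +oo)%E -> L1 P (D n).
  move=> fin; apply/integrableP; split; first exact/measurable_EFinP.
  by under eq_integral do rewrite /= ger0_norm//.
have ex : exists N, forall n, (N <= n)%N -> (\int[P]_w (D n w)%:E < +oo)%E.
  have : \forall n \near \oo, (\int[P]_w (D n w)%:E < +oo)%E.
    apply: (cD [set x | (x < +oo)%E]).
    apply: open_nbhs_nbhs; split; [exact: open_ereal_lt_ereal|exact: ltry].
  by move=> [N _ hN]; exists N => n; exact: hN.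
have [N hN] := ex; exists N => [n Nn|]; first exact: int (hN n Nn).
by apply: fine_cvg.
Qed.

(** X lies in L^2 because it differs by a square-integrable function from some term of the
    sequence. *)
Lemma cvg_L2_real (Xn : nat -> T -> R) (X : T -> R) : (forall n, L2 P (Xn n)) ->
  measurable_fun setT X -> @cvg_L2 _ _ _ P R^o Xn X -> L2 P X /\ cvgL2 P Xn X.
Proof.
move=> iXn mX c.
have [] := @integrable_cvg0 (fun n w => (Xn n w - X w) ^+ 2).
- by move=> n w; exact: sqr_ge0.
- by move=> n; apply/measurable_funX/measurable_funB => //; case: (iXn n).
- move: c; apply: cvg_trans; apply: near_eq_cvg; apply: nearW => n.
  by apply: eq_integral => w _; rewrite /= real_normK ?num_real.
move=> N /(_ N (leqnn N)) i c'; split=> //.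
have iX : L2 P (fun w => Xn N w - X w).
  by split=> //; apply: measurable_funB => //; case: (iXn N).
have := L2B (iXn N) iX; congr (L2 P _); apply/funext => w; ring.
Qed.

Lemma cvgL2_le (C : R) (Xn Yn : nat -> T -> R) X Y : (forall n, L2 P (Xn n)) -> L2 P X ->
  (forall n, L1 P (fun w => (Yn n w - Y w) ^+ 2)) ->
  (forall n w, `|Xn n w - X w| <= C * `|Yn n w - Y w|) ->
  cvgL2 P Yn Y -> cvgL2 P Xn X.
Proof.
move=> iXn iX iY le c.
apply: (@squeeze_cvgr _ _ _ _ (cst 0) (fun n => C ^+ 2 * Ex P (fun w => (Yn n w - Y w) ^+ 2))).
- apply: nearW => n; apply/andP; split; first by apply: Ex_ge0 => w; exact: sqr_ge0.
  rewrite -ExZ//; apply: Ex_le; [by case: (L2B (iXn n) iX)|exact: L1Z|move=> w].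
  rewrite -real_normK ?num_real// -[X in _ <= _ * X]real_normK ?num_real// -exprMn.
  by rewrite lerXn2r ?nnegrE// (le_trans _ (le n w)).
- exact: cvg_cst.
- rewrite -[X in _ --> X](mulr0 (C ^+ 2)); apply: cvgM => //; exact: cvg_cst.
Qed.

End MeasurableConvergence.

Lemma cvg_to_unique (R : realType) (a b : nat -> R) (x y : R) : a =1 b ->
  a @ \oo --> x -> b @ \oo --> y -> x = y.
Proof. by move=> /funext -> c1 c2; exact: (cvg_unique (@Rhausdorff R) c1 c2). Qed.

Section MalliavinIBP.
Context (R : realType) (H : completeNormedModType R) (ip : H -> H -> R).
Hypothesis hip : hilbert_product ip.
Context (d : measure_display) (T : measurableType d) (P : probability T R).
Variable W : H -> {RV P >-> R}.
Hypothesis iW : isonormal ip W.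
Implicit Types (Y Z V : T -> R) (DY DZ DV : H -> T -> R) (u v : T -> H).
Notation cyl := (cyl ip W).

Lemma hermite_deriv q : (hermite R q.+1)^`() = q.+1%:R *: hermite R q.
Proof.
elim: q => [|q IH]; first by rewrite /= mulr1 derivC subr0 derivX scale1r.
rewrite [hermite R q.+2]/(_ * hermite R q.+1 - (hermite R q.+1)^`()) derivB derivM derivX mul1r.
rewrite IH derivZ -scalerAr -addrA -scalerBr -[X in _ *: X]/(hermite R q.+1).
by rewrite -[X in X + _ = _]scale1r -scalerDl -[q.+2%:R]natr1 addrC.
Qed.

Section Divergence.
Variables (n : nat) (hs : 'I_n -> H) (b : 'I_n -> T -> R) (Db : 'I_n -> H -> T -> R).
Hypothesis cb : forall i, cyl (b i) (Db i).

(** The divergence of the field sum_i b_i h_i, that is, the adjoint of D applied to it, as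
    [cyl_divergence] shows. *)
Definition divergence (w : T) : R := \sum_i (W (hs i) w * b i w - Db i (hs i) w).

Lemma moments_divergence : all_moments P divergence.
Proof.
apply: moments_sum => i; have [m1 m2] := cyl_moments iW (cb i).
by apply: momentsB => //; apply: momentsM => //; exact: (moments_W iW).
Qed.

(** Integration by parts in direction h_i is applied to the product V b_i; of the two terms of the
    product rule, V < D b_i, h_i > is the one that [divergence] subtracts. *)
Lemma cyl_divergence V DV : cyl V DV ->
  Ex P (fun w => V w * divergence w) = \sum_i Ex P (fun w => b i w * DV (hs i) w).
Proof.
move=> cV; have [mV mDV] := cyl_moments iW cV.
rewrite (eq_Ex _ (g := fun w => \sum_i V w * (W (hs i) w * b i w - Db i (hs i) w))); last first.
  by move=> w; rewrite mulr_sumr.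
rewrite Ex_sum => [|i]; last first.
  have [m1 m2] := cyl_moments iW (cb i).
  apply/moments_L1/momentsM/momentsB => //; apply: momentsM => //; exact: (moments_W iW).
apply: eq_bigr => i _; have [m1 m2] := cyl_moments iW (cb i).
have c2 := cylM cV (cb i).
have [m3 m4] := cyl_moments iW c2.
have mW := moments_W iW (hs i).
rewrite (eq_Ex _ (g := fun w => W (hs i) w * (V w * b i w) - V w * Db i (hs i) w)); last first.
  by move=> w; ring.
rewrite ExB; [|by apply/moments_L1/momentsM|by apply/moments_L1/momentsM].
rewrite (cyl_ibp hip iW (hs i) c2) ExD; [|by apply/moments_L1/momentsM|by apply/moments_L1/momentsM].
by rewrite addrC addKr.
Qed.

(* [b] and [hs] are the coordinates of DZ = \sum_i b_i h_i, so that [divergence]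
   applied to them is the number operator: it multiplies the chaos q by q. *)
Variables (Z : T -> R) (DZ : H -> T -> R).
Hypothesis cZ : cyl Z DZ.
Hypothesis DZE : forall h w, DZ h w = \sum_i b i w * ip (hs i) h.

(** Writing H_n for the Hermite polynomials, duality and H_q' = q H_(q-1) give q
    E[H_(q-1)(W l) < DZ, l >]. Integrating by parts in direction l, with |l| = 1, rebuilds W l
    H_(q-1) - H_(q-1)' = H_q. For q = 0 both sides are 0. *)
Lemma hermite_divergence q l : ((0 < q)%N -> `|l| = 1) ->
  Ex P (fun w => (hermite R q).[W l w] * divergence w) =
  q%:R * Ex P (fun w => (hermite R q).[W l w] * Z w).
Proof.
case: q => [_|q /(_ isT) l1].
  have c1 := cyl_horner ip W (hermite R 0) l.
  rewrite (cyl_divergence c1) mul0r big1// => i _.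
  by rewrite (eq_Ex _ (g := fun=> 0)) ?Ex_cst// => w; rewrite derivC horner0 mul0r mulr0.
have ll : ip l l = 1 by rewrite -(ip_norm hip) l1 expr1n.
have c1 := cyl_horner ip W (hermite R q.+1) l.
have c0 := cyl_horner ip W (hermite R q) l.
have [mZ mDZ] := cyl_moments iW cZ.
have [m0 _] := cyl_moments iW c0.
have m0' : all_moments P (fun w => ((hermite R q)^`()).[W l w]).
  by have [] := cyl_moments iW (cyl_horner ip W (hermite R q)^`() l).
have mW := moments_W iW l.
rewrite (cyl_divergence c1).
transitivity (q.+1%:R * Ex P (fun w => (hermite R q).[W l w] * DZ l w)).
  rewrite -ExZ; last by apply/moments_L1/momentsM.
  rewrite -Ex_sum => [|i]; last first.
    apply/moments_L1/momentsM; first by have [] := cyl_moments iW (cb i).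
    by have [_] := cyl_moments iW c1; apply.
  apply: eq_Ex => w; rewrite DZE !mulr_sumr; apply: eq_bigr => i _.
  rewrite hermite_deriv hornerZ (ipC hip l); ring.
congr (_ * _).
rewrite [RHS](eq_Ex _ (g := fun w => W l w * ((hermite R q).[W l w] * Z w) -
   (hermite R q)^`().[W l w] * Z w)); last first.
  move=> w; rewrite [hermite R q.+1]/(_ * hermite R q - (hermite R q)^`()).
  by rewrite hornerD hornerN hornerM hornerX; ring.
rewrite ExB; [|apply/moments_L1; do ![apply: momentsM => //]|by apply/moments_L1/momentsM].
rewrite (cyl_ibp hip iW l (cylM c0 cZ)) ExD; last 2 first.
- by apply/moments_L1/momentsM.
- apply/moments_L1/momentsM => //; under eq_fun do rewrite ll mulr1; exact: m0'.
rewrite [X in _ + X - _](eq_Ex _ (g := fun w => ((hermite R q)^`()).[W l w] * Z w)); first by rewrite addrK.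
by move=> w; rewrite ll; ring.
Qed.

Lemma powers_divergence q (s : seq (R * H)) : (forall p, p \in s -> (0 < q)%N -> `|p.2| = 1) ->
  Ex P (fun w => wiener_ito_powers W q s w * divergence w) =
  q%:R * Ex P (fun w => wiener_ito_powers W q s w * Z w).
Proof.
have [mZ mDZ] := cyl_moments iW cZ.
have mH l : all_moments P (fun w => (hermite R q).[W l w]).
  by have [] := cyl_moments iW (cyl_horner ip W (hermite R q) l).
have mw s' : all_moments P (wiener_ito_powers W q s') by apply: moments_sum => p; exact: momentsZ.
have md := moments_divergence.
elim: s => [_|p s IH hs'].
  rewrite !(eq_Ex _ (g := fun=> 0)) ?Ex_cst ?mulr0// => w;
  by rewrite /wiener_ito_powers big_nil mul0r.
have E (D : T -> R) : all_moments P D -> Ex P (fun w => wiener_ito_powers W q (p :: s) w * D w) =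
    p.1 * Ex P (fun w => (hermite R q).[W p.2 w] * D w) +
    Ex P (fun w => wiener_ito_powers W q s w * D w).
  move=> mD; rewrite -ExZ; last by apply/moments_L1/momentsM.
  rewrite -ExD; [|by apply/L1Z/moments_L1/momentsM|by apply/moments_L1/momentsM].
  by apply: eq_Ex => w; rewrite /wiener_ito_powers big_cons mulrDl mulrA.
rewrite !E// IH; last by move=> r rs; apply: hs'; rewrite in_cons rs orbT.
rewrite hermite_divergence; last by apply: hs'; rewrite in_cons eqxx.
ring.
Qed.

End Divergence.

Lemma moments_wip q (s : seq (R * H)) : all_moments P (wiener_ito_powers W q s).
Proof.
apply: moments_sum => p; apply: momentsZ.
by have [] := cyl_moments iW (cyl_horner ip W (hermite R q) p.2).
Qed.

Lemma wiener_ito_L2 q f (X : {RV P >-> R}) : @is_wiener_ito R H ip d T P W q f X -> L2 P X /\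
  exists s : nat -> seq (R * H), (forall k p, p \in s k -> (0 < q)%N -> `|p.2| = 1) /\
    cvgL2 P (fun k => wiener_ito_powers W q (s k)) X.
Proof.
move=> [_ [s [h1 _ c]]].
have [] := cvg_L2_real (fun k => moments_L2 (moments_wip q (s k))) _ c.
  exact: measurable_funPT.
by move=> i c'; split=> //; exists s.
Qed.

(** Both sides are continuous in X for the L^2 distance, and X is an L^2 limit of combinations of
    Hermite polynomials. *)
Lemma wiener_ito_divergence n (hs : 'I_n -> H) b Db Z DZ q f (X : {RV P >-> R}) :
  (forall i, cyl (b i) (Db i)) -> cyl Z DZ ->
  (forall h w, DZ h w = \sum_i b i w * ip (hs i) h) ->
  @is_wiener_ito R H ip d T P W q f X ->
  Ex P (fun w => X w * divergence hs b Db w) = q%:R * Ex P (fun w => X w * Z w).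
Proof.
move=> cb cZ DZE wX; have [iX [s [h1 c]]] := wiener_ito_L2 wX.
have iw k := moments_L2 (moments_wip q (s k)).
have [mZ _] := cyl_moments iW cZ.
have c1 := cvgL2_Ex iw iX (moments_L2 (moments_divergence hs cb)) c.
have c2 := cvgL2_Ex iw iX (moments_L2 mZ) c.
have c3 : q%:R * Ex P (fun w => wiener_ito_powers W q (s k) w * Z w) @[k --> \oo] -->
    q%:R * Ex P (fun w => X w * Z w).
  by apply: cvgM; [exact: cvg_cst|exact: c2].
apply: (cvg_to_unique _ c1 c3) => k.
exact: (powers_divergence cb cZ DZE (h1 _)).
Qed.

Lemma cyl_cst a : cyl (fun=> a) (fun _ _ => 0).
Proof.
have := cyl_horner ip W a%:P 0; congr (cyl _ _).
  by apply/funext => w; rewrite hornerC.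
by apply/funext => h; apply/funext => w; rewrite derivC horner0 mul0r.
Qed.

(** With Z = 1 and the empty family of vectors the divergence is 0, so q E[X] = 0. *)
Lemma wiener_ito_mean q f (X : {RV P >-> R}) : @is_wiener_ito R H ip d T P W q f X ->
  (0 < q)%N -> Ex P X = 0.
Proof.
move=> wX q0; have := @wiener_ito_divergence 0%N (fun=> 0) (fun _ _ => 0) (fun _ _ _ => 0) (fun=> 1)
  (fun _ _ => 0) q f X (fun=> cyl_cst 0) (cyl_cst 1).
rewrite (eq_Ex _ (g := fun=> 0)) ?Ex_cst; last by move=> w; rewrite /divergence big_ord0 mulr0.
rewrite [X in _ * X](eq_Ex _ (g := X)); last by move=> w; rewrite mulr1.
move=> /(_ _ wX) h; apply/eqP; have /eqP := esym (h (fun _ _ => esym (big_ord0 _ _ _ _))).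
by rewrite mulf_eq0 pnatr_eq0 eqn0Ngt q0.
Qed.

(** X is an L^2 limit of constants, so it factors out of every expectation. *)
Lemma wiener_ito0_Ex f (X : {RV P >-> R}) Z : @is_wiener_ito R H ip d T P W 0 f X -> L2 P Z ->
  Ex P (fun w => X w * Z w) = Ex P X * Ex P Z.
Proof.
move=> wX iZ; have [iX [s [_ c]]] := wiener_ito_L2 wX.
have iw k := moments_L2 (moments_wip 0 (s k)).
have c1 := cvgL2_Ex iw iX iZ c.
have c2 := cvgL2_Ex iw iX (L2_cst P 1) c.
rewrite [X in _ --> X](eq_Ex _ (g := X)) in c2; last by move=> w; rewrite mulr1.
apply: (cvg_to_unique _ c1 (cvgM c2 (cvg_cst (Ex P Z)))) => k /=.
have E w : wiener_ito_powers W 0 (s k) w = \sum_(p <- s k) p.1.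
  by apply: eq_bigr => p _; rewrite hornerC mulr1.
rewrite [in RHS](eq_Ex _ (g := fun=> \sum_(p <- s k) p.1)) ?Ex_cst; last by move=> w; rewrite E mulr1.
by rewrite -ExZ; [apply: eq_Ex => w; rewrite E|exact: L2_L1].
Qed.

(** [is_Linv] expands F and V over the same components X q; on the component of order q, the factor
    q from the divergence cancels the weight -1/q. *)
Lemma Linv_divergence n (hs : 'I_n -> H) b Db Z DZ (F V : {RV P >-> R}) :
  (forall i, cyl (b i) (Db i)) -> cyl Z DZ ->
  (forall h w, DZ h w = \sum_i b i w * ip (hs i) h) ->
  is_Linv ip W F V -> Ex P F = 0 ->
  Ex P (fun w => V w * divergence hs b Db w) = - Ex P (fun w => F w * Z w).
Proof.
move=> cb cZ DZE [m [f [X [[wX FE] VE]]]] F0.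
have [mZ _] := cyl_moments iW cZ; have md := moments_divergence hs cb.
have iX q : (q <= m)%N -> L2 P (X q) by move=> qm; have [] := wiener_ito_L2 (wX q qm).
have iXD q D : (q <= m)%N -> all_moments P D -> L1 P (fun w => X q w * D w).
  by move=> qm mD; apply: L2M; [exact: iX|exact: moments_L2].
have mF : measurable_fun setT F by exact: measurable_funPT.
have mV : measurable_fun setT V by exact: measurable_funPT.
have mX q : measurable_fun setT (X q) by exact: measurable_funPT.
have sumE (c : nat -> R) D : all_moments P D ->
    Ex P (fun w => (\sum_(q < m.+1) c q * X q w) * D w) = \sum_(q < m.+1) c q * Ex P (fun w => X q w * D w).
  move=> mD; rewrite (eq_Ex _ (g := fun w => \sum_(q < m.+1) c q * (X q w * D w))); last first.
    by move=> w; rewrite mulr_suml; apply: eq_bigr => q _; rewrite mulrA.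
  have iq (q : 'I_m.+1) : L1 P (fun w => c q * (X q w * D w)).
    by apply: L1Z; apply: iXD => //; rewrite -ltnS.
  by rewrite Ex_sum//; apply: eq_bigr => q _; rewrite ExZ//; apply: iXD => //; rewrite -ltnS.
have mS (c : nat -> R) : measurable_fun setT (fun w => \sum_(q < m.+1) c q * X q w).
  by apply: measurable_sum => q; exact: measurable_funM.
have ExF D : all_moments P D -> Ex P (fun w => F w * D w) = \sum_(q < m.+1) Ex P (fun w => X q w * D w).
  move=> mD; have [mD' _] := mD.
  transitivity (Ex P (fun w => (\sum_(q < m.+1) 1 * X q w) * D w)).
    apply: Ex_ae; [exact: measurable_funM|exact: measurable_funM (mS (fun=> 1)) mD'|].
    by apply: filterS FE => w ->; rewrite big_mkord; under [in RHS]eq_bigr do rewrite mul1r.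
  by rewrite (sumE (fun=> 1))//; under eq_bigr do rewrite mul1r.
have Xq0 q : (q < m)%N -> Ex P (X q.+1) = 0.
  by move=> qm; apply: (wiener_ito_mean (wX q.+1 qm)).
(* The component of order 0 is absent from V. Its share of E[F Z] is E[X 0] E[Z], and E[X 0] = E[F]
   = 0 since the other components are centered. *)
have X00 : Ex P (X 0%N) = 0.
  have := ExF (fun=> 1) (moments_cst P 1).
  rewrite (eq_Ex _ (g := F)) ?F0; last by move=> w; rewrite mulr1.
  rewrite big_ord_recl big1 ?addr0; last first.
    move=> q _; rewrite (eq_Ex _ (g := X q.+1)) ?Xq0//; first by move=> w; rewrite mulr1.
  by move=> h; rewrite h; apply: eq_Ex => w; rewrite mulr1.
transitivity (- \sum_(q < m) Ex P (fun w => X q.+1 w * Z w)).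
  (* The weight 0 at order 0 lets the sum for V start at 0, like the one for F. *)
  pose c (q : nat) : R := if q is q'.+1 then - q'.+1%:R^-1 else 0.
  transitivity (Ex P (fun w => (\sum_(q < m.+1) c q * X q w) * divergence hs b Db w)).
    apply: Ex_ae; [by apply: measurable_funM => //; case: md|by apply: (measurable_funM (mS c)); case: md|].
    apply: filterS VE => w ->; rewrite big_ord_recl mul0r add0r big_add1/= big_mkord -sumrN.
    by congr (_ * _); apply: eq_bigr => q _; rewrite /= mulNr.
  rewrite sumE// big_ord_recl mul0r add0r -sumrN; apply: eq_bigr => q _ /=.
  rewrite (wiener_ito_divergence cb cZ DZE (wX q.+1 _))//.
  by rewrite mulNr mulKf// pnatr_eq0.
rewrite ExF// big_ord_recl (wiener_ito0_Ex (wX 0%N _) (moments_L2 mZ))// X00 mul0r add0r.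
by [].
Qed.

(** The coefficients of the derivative are partial derivatives of a smooth function, hence
    cylindrical in turn, as [divergence] requires. *)
Lemma smooth_decomp (Fn : T -> R) un : smooth_derivative W Fn un ->
  cyl Fn (fun h w => ip (un w) h) /\
  exists n (hs : 'I_n.+1 -> H) b Db, (forall i : 'I_n.+1, cyl (b i) (Db i)) /\
    un = (fun w => \sum_i b i w *: hs i).
Proof.
move=> [n [hs [g [sg -> ->]]]]; have Cg := smooth_C1 sg; split.
  exists n, hs, g; split=> //; apply/funext => h; apply/funext => w.
  rewrite derive_sum_partial; last by case: Cg.
  by rewrite (ip_suml hip); apply: eq_bigr => i _; rewrite (ipZl hip) mxE mulrC.
exists n, hs, (fun i w => partial i g (Wv W hs w)),
  (fun i h w => 'D_(\row_j ip (hs j) h) (partial i g) (Wv W hs w)); split=> // i.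
by exists n, hs, (partial i g); split=> //; apply/smooth_C1/smooth_partial.
Qed.

Lemma measurable_borel_comp u (f : H -> R) : borel_measurable u -> continuous f ->
  measurable_fun setT (f \o u).
Proof.
move=> bu cf; apply: (measurability _ (RGenOpens.measurableE R)).
move=> _ [_ [a [b' ->]] <-]; rewrite setTI comp_preimage; apply: bu.
by apply: open_comp => [x _|]; [exact: cf|exact: interval_open].
Qed.

Lemma continuous_ip h : continuous (fun x => ip x h).
Proof.
move=> x; apply/cvgrPdist_lt => e e0.
have n0 : 0 < 1 + `|h| by rewrite ltr_pwDl.
near=> z; rewrite -(ipBl hip) (le_lt_trans (ip_le_norm hip _ _))//.
apply: (@le_lt_trans _ _ (`|x - z| * (1 + `|h|))); first by rewrite ler_wpM2l// lerDr.
rewrite -ltr_pdivlMr//; near: z; apply: cvgr_dist_lt; [exact: cvg_id|exact: divr_gt0].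
Unshelve. all: by end_near. Qed.

(** Expanding the square of the norm leaves |u|^2 and the inner products of u with the h_i,
    real-valued continuous functions of u; measurability is thus only asked of real functions. *)
Lemma measurable_combination n (hs : 'I_n -> H) (b : 'I_n -> T -> R) u :
  (forall i, measurable_fun setT (b i)) -> borel_measurable u ->
  measurable_fun setT (fun w => `|\sum_i b i w *: hs i - u w|).
Proof.
move=> mb bu.
have E w : `|\sum_i b i w *: hs i - u w| = Num.sqrt
    (\sum_i \sum_j (b i w * b j w) * ip (hs i) (hs j) - 2 * (\sum_i b i w * ip (u w) (hs i)) + `|u w| ^+ 2).
  rewrite -[LHS]ger0_norm// -sqrtr_sqr; congr Num.sqrt.
  pose x : H := \sum_i b i w *: hs i.
  transitivity (ip (x - u w) (x - u w)); first exact: (ip_norm hip (x - u w)).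
  have xx : ip x x = \sum_i \sum_j (b i w * b j w) * ip (hs i) (hs j).
    rewrite /x (ip_suml hip); apply: eq_bigr => i _; rewrite (ip_sumr hip); apply: eq_bigr => j _.
    by rewrite (ipZl hip) (ipZr hip) mulrA.
  have ux : ip (u w) x = \sum_i b i w * ip (u w) (hs i).
    by rewrite /x (ip_sumr hip); apply: eq_bigr => i _; rewrite (ipZr hip).
  have uu : ip (u w) (u w) = `|u w| ^+ 2 := esym (ip_norm hip (u w)).
  by rewrite (ipBl hip) !(ipBr hip) (ipC hip x (u w)) xx ux uu; ring.
under eq_fun do rewrite E.
have ms : measurable_fun setT (@Num.sqrt R) by apply: continuous_measurable_fun; exact: sqrt_continuous.
apply: (measurableT_comp ms); apply: measurable_funD; last first.
  by apply: measurable_funX; apply: (measurable_borel_comp bu); exact: norm_continuous.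
apply: measurable_funB.
  apply: measurable_sum => i; apply: measurable_sum => j; apply: measurable_funM => //.
  exact: measurable_funM.
apply: measurable_funM => //; apply: measurable_sum => i; apply: measurable_funM => //.
exact: (measurable_borel_comp bu (@continuous_ip (hs i))).
Qed.

Lemma smooth_L2 (Fn : T -> R) un : smooth_derivative W Fn un -> L2 P (fun w => `|un w|).
Proof.
move=> /smooth_decomp[_ [n [hs [b [Db [cb ->]]]]]].
have mb i : all_moments P (b i) by have [] := cyl_moments iW (cb i).
apply: moments_L2; apply: (moments_le _ _ (g := fun w => \sum_i `|b i w| * `|hs i|)).
- have -> : (fun w => `|\sum_i b i w *: hs i|) = (fun w => `|\sum_i b i w *: hs i - (0 : H)|).
    by apply/funext => w; congr `|_|; exact/esym/subr0.
  apply: (@measurable_combination _ hs b (fun=> 0) (fun i => proj1 (mb i))) => U oU.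
  by rewrite preimage_cst; case: ifP.
- move=> w; rewrite normr_id (le_trans (ler_norm_sum _ _ _))// [leRHS]ger0_norm ?sumr_ge0//.
  by apply: ler_sum => i _; rewrite normrZ.
- apply: moments_sum => i; apply: momentsM; [exact: moments_norm|exact: moments_cst].
Qed.

Definition malliavin_approx F u (Fn : nat -> T -> R) (un : nat -> T -> H) : Prop :=
  [/\ forall k, smooth_derivative W (Fn k) (un k), cvgL2 P Fn F,
    forall k, L2 P (fun w => `|un k w - u w|)
    & cvgL2 P (fun k w => `|un k w - u w|) (fun=> 0)].

Lemma malliavin_L2 (F : {RV P >-> R}) u : is_malliavin_derivative W F u ->
  [/\ borel_measurable u, L2 P F, L2 P (fun w => `|u w|) &
    exists Fn un, malliavin_approx F u Fn un].
Proof.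
move=> [bu [Fn [un [sm cF cu]]]].
have iFn k : L2 P (Fn k).
  have [c _] := smooth_decomp (sm k).
  by apply: moments_L2; have [] := cyl_moments iW c.
have [iF cF'] := cvg_L2_real iFn (measurable_funPT F) cF.
have iun k := smooth_L2 (sm k).
have mdiff k : measurable_fun setT (fun w => `|un k w - u w|).
  have [_ [n [hs [b [Db [cb ->]]]]]] := smooth_decomp (sm k).
  apply: measurable_combination => // i.
  by have [[]] := cyl_moments iW (cb i).
have mu : measurable_fun setT (fun w => `|u w|).
  by apply: (measurable_borel_comp bu); exact: norm_continuous.
have [|||N iN cN] := @integrable_cvg0 _ _ _ P (fun n w => `|un n w - u w| ^+ 2).
- by move=> n w; exact: sqr_ge0.
- by move=> n; exact: measurable_funX.
- exact: cu.
have iu : L2 P (fun w => `|u w|).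
  have i1 : L2 P (fun w => `|un N w - u w|) by split; [exact: mdiff|exact: iN].
  apply: (L2_le mu _ (L2D (iun N) i1)) => w; rewrite normr_id [leRHS]ger0_norm ?addr_ge0//.
  by rewrite -[in leLHS](subrK (un N w) (u w)) addrC -(distrC (u w)) ler_normD.
split=> //; exists Fn, un; split=> //.
- move=> k; apply: (L2_le (mdiff k) _ (L2D (iun k) iu)) => w.
  by rewrite normr_id [leRHS]ger0_norm ?addr_ge0// ler_normB.
- by rewrite /cvgL2; under eq_fun do under eq_fun do rewrite subr0.
Qed.

Lemma malliavin_approx_ip F u Fn un h : malliavin_approx F u Fn un -> borel_measurable u ->
  L2 P (fun w => `|u w|) ->
  [/\ forall k, L2 P (fun w => ip (un k w) h), L2 P (fun w => ip (u w) h) &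
  cvgL2 P (fun k w => ip (un k w) h) (fun w => ip (u w) h)].
Proof.
move=> [sm _ i c] bu iu.
have i1 k : L2 P (fun w => ip (un k w) h).
  have [c1 _] := smooth_decomp (sm k); apply: moments_L2.
  by have [_] := cyl_moments iW c1; apply.
have i2 : L2 P (fun w => ip (u w) h).
  apply: (L2_le _ _ (L2Z `|h| iu)).
    exact: (measurable_borel_comp bu (@continuous_ip h)).
  by move=> w; rewrite [leRHS]ger0_norm ?mulr_ge0// mulrC ip_le_norm.
split=> //; apply: (@cvgL2_le _ _ _ _ `|h| _ _ _ _ i1 i2 _ _ c).
  by move=> k; under eq_fun do rewrite subr0; have [] := i k.
by move=> k w; rewrite subr0 normr_id -(ipBl hip) mulrC ip_le_norm.
Qed.

Section C2Test.
Variables (phi phi' phi'' : R -> R) (M : R).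
Hypothesis dphi : forall x : R, is_derive x (1 : R) phi (phi' x).
Hypothesis dphi' : forall x : R, is_derive x (1 : R) phi' (phi'' x).
Hypothesis cphi'' : continuous phi''.
Hypothesis bphi : forall x, `|phi x| <= M.
Hypothesis bphi' : forall x, `|phi' x| <= M.
Hypothesis bphi'' : forall x, `|phi'' x| <= M.

Let cphi' : continuous phi'.
Proof. by move=> x; apply/differentiable_continuous/derivable1_diffP; exact: ex_derive. Qed.

Let cphi : continuous phi.
Proof. by move=> x; apply/differentiable_continuous/derivable1_diffP; exact: ex_derive. Qed.

(** Only the argument of phi is smooth here, F being reached through V. The field D phi(F_n) has
    coefficients phi'(F_n) b_i, and a bounded continuous phi'' makes them cylindrical. The
    right-hand side is the limit along smooth approximations of V. *)
Lemma malliavin_ibp_smooth (F V : {RV P >-> R}) v (Fn : T -> R) un :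
  is_Linv ip W F V -> is_malliavin_derivative W V v -> Ex P F = 0 ->
  smooth_derivative W Fn un ->
  Ex P (fun w => F w * phi (Fn w)) = - Ex P (fun w => phi' (Fn w) * ip (un w) (v w)).
Proof.
move=> LV dV F0 sF; have [bv iV iv [Vk [vk ap]]] := malliavin_L2 dV.
have [cF [n [hs [b [Db [cb unE]]]]]] := smooth_decomp sF.
have cZ := cyl_comp dphi cphi' bphi bphi' cF.
pose B i w := phi' (Fn w) * b i w.
have cB i := cylM (cyl_comp dphi' cphi'' bphi' bphi'' cF) (cb i).
set DB := fun i => (fun h w => phi' (Fn w) * Db i h w + b i w * (phi'' (Fn w) * ip (un w) h)).
have DZE h w : phi' (Fn w) * ip (un w) h = \sum_i (phi' (Fn w) * b i w) * ip (hs i) h.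
  rewrite unE (ip_suml hip) mulr_sumr; apply: eq_bigr => i _.
  by rewrite (ipZl hip) mulrA.
have := @Linv_divergence _ hs _ DB _ _ _ _ cB cZ DZE LV F0.
move=> /eqP; rewrite -eqr_oppLR => /eqP <-; congr (- _).
have [sV cV _ _] := ap.
have apip h := @malliavin_approx_ip _ _ _ _ h ap bv iv.
have iB i : L2 P (fun w => phi' (Fn w) * b i w).
  by apply: moments_L2; have [] := cyl_moments iW (cB i).
have iVk k : L2 P (Vk k).
  by have [c _] := smooth_decomp (sV k); apply: moments_L2; have [] := cyl_moments iW c.
have c1 := cvgL2_Ex iVk iV (moments_L2 (moments_divergence hs cB)) cV.
have c2 i : Ex P (fun w => ip (vk k w) (hs i) * (phi' (Fn w) * b i w)) @[k --> \oo] -->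
    Ex P (fun w => ip (v w) (hs i) * (phi' (Fn w) * b i w)).
  by have [j1 j2 j3] := apip (hs i); exact: cvgL2_Ex.
transitivity (\sum_i Ex P (fun w => ip (v w) (hs i) * (phi' (Fn w) * b i w))); last first.
  rewrite -Ex_sum => [|i]; last by have [_ j2 _] := apip (hs i); exact: L2M.
  apply: eq_Ex => w; rewrite unE (ip_suml hip) mulr_sumr; apply: eq_bigr => i _.
  by rewrite (ipZl hip) (ipC hip (v w)); ring.
have c3 : \sum_i Ex P (fun w => ip (vk k w) (hs i) * (phi' (Fn w) * b i w)) @[k --> \oo] -->
    \sum_i Ex P (fun w => ip (v w) (hs i) * (phi' (Fn w) * b i w)).
  by apply: cvg_big => [|i _]; [exact: add_continuous|exact: c2].
apply: (cvg_to_unique _ c1 c3) => k.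
rewrite (cyl_divergence hs cB (smooth_decomp (sV k)).1); apply: eq_bigr => i _.
by apply: eq_Ex => w; rewrite mulrC.
Qed.

(** The difficulty in letting F_n tend to F is that G is merely integrable while F_n converges in
    L^2. Truncating G at level K makes the Lipschitz bound on phi' usable; k tends to infinity
    first, then K. *)
Lemma malliavin_ibp_C2 (F G V : {RV P >-> R}) u v :
  is_Linv ip W F V -> is_malliavin_derivative W F u -> is_malliavin_derivative W V v ->
  {ae P, forall w, G w = ip (u w) (- v w)} -> Ex P F = 0 ->
  L1 P G /\ Ex P (fun w => F w * phi (F w)) = Ex P (fun w => G w * phi' (F w)).
Proof.
move=> LV dF dV GE F0.
have [bv iV iv _] := malliavin_L2 dV.
have [bu iF iu [Fn [un ap]]] := malliavin_L2 dF; have [sF cF iD cD] := ap.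
have iG : L1 P G.
  apply: (@L1_ae _ _ _ _ (fun w => `|u w| * `|v w|)); first exact: measurable_funPT.
    by apply: filterS GE => w ->; rewrite (le_trans (ip_le_norm hip _ _))// normrN.
  exact: L2M.
split=> //.
have iFn k : L2 P (Fn k).
  by have [c _] := smooth_decomp (sF k); apply: moments_L2; have [] := cyl_moments iW c.
have mF : measurable_fun setT F by case: iF.
have mFn k : measurable_fun setT (Fn k) by case: (iFn k).
have iun k := smooth_L2 (sF k).
have mc (f : R -> R) (X : T -> R) : continuous f -> measurable_fun setT X -> measurable_fun setT (fun w => f (X w)).
  by move=> cf mX; exact: (measurableT_comp (continuous_measurable_fun cf) mX).
have lip := @derive_bound_lipschitz R.
have i1 k : L2 P (fun w => phi (Fn k w)).
  by apply: (@L2_bounded _ _ _ _ _ M) => //; exact: mc.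
have i2 : L2 P (fun w => phi (F w)).
  by apply: (@L2_bounded _ _ _ _ _ M) => //; exact: mc.
have c1 : cvgL2 P (fun k w => phi (Fn k w)) (fun w => phi (F w)).
  apply: (@cvgL2_le _ _ _ _ M _ _ _ _ i1 i2 _ _ cF).
    by move=> k; have [] := L2B (iFn k) iF.
  by move=> k w; exact: lip.
have c2 := cvgL2_Ex i1 i2 iF c1.
have E1 k : Ex P (fun w => phi (Fn k w) * F w) = - Ex P (fun w => phi' (Fn k w) * ip (un k w) (v w)).
  rewrite -(malliavin_ibp_smooth LV dV F0 (sF k)).
  by apply: eq_Ex => w; rewrite mulrC.
have ipun k : measurable_fun setT (fun w => ip (un k w) (v w)) /\
    L1 P (fun w => phi' (Fn k w) * ip (un k w) (v w)).
  have mm : measurable_fun setT (fun w => ip (un k w) (v w)).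
    have [_ [n [hs [b [Db [cb unE]]]]]] := smooth_decomp (sF k).
    under eq_fun do rewrite unE (ip_suml hip).
    apply: measurable_sum => i; under eq_fun do rewrite (ipZl hip) (ipC hip (hs i)).
    apply: measurable_funM; first by have [[]] := cyl_moments iW (cb i).
    exact: (measurable_borel_comp bv (@continuous_ip (hs i))).
  split=> //; apply: (L1_le _ _ (L1Z M (L2M (iun k) iv))).
    by apply: measurable_funM => //; exact: mc.
  by move=> w; rewrite normrM ler_pM// (ip_le_norm hip).
have iGphi : L1 P (fun w => G w * phi' (F w)).
  apply: (L1_le _ _ (L1Z M (L1_norm iG))).
    by apply: measurable_funM; [exact: measurable_funPT|exact: mc].
  by move=> w; rewrite normrM mulrC ler_wpM2r.
(* The three errors: replacing un by u, replacing F_n by F against the truncated G, and truncating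
   G. *)
pose A k := Ex P (fun w => `|un k w - u w| * `|v w|).
pose B k := Ex P (fun w => `|Fn k w - F w| * 1).
pose C K := Ex P (fun w => `|G w - clamp K (G w)|).
have iC K : L1 P (fun w => `|G w - clamp K (G w)|).
  apply: L1_norm; apply: (L1B iG); apply: (L1_le _ _ (L1_norm iG)); last by move=> w; exact: clamp_norm2.
  by apply: mc; [exact: continuous_clamp|exact: measurable_funPT].
have iB k : L2 P (fun w => `|Fn k w - F w|) by apply/L2_norm/L2B.
have A0 : A k @[k --> \oo] --> (0 : R).
  have := cvgL2_Ex iD (L2_cst P 0) iv cD.
  by rewrite [X in _ --> X](eq_Ex _ (g := fun=> 0)) ?Ex_cst// => w; rewrite mul0r.
have B0 : B k @[k --> \oo] --> (0 : R).
  have h : cvgL2 P (fun k w => `|Fn k w - F w|) (fun=> 0).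
    apply: (@cvgL2_le _ _ _ _ 1 _ _ _ _ iB (L2_cst P 0) _ _ cF).
      by move=> k; have [] := L2B (iFn k) iF.
    by move=> k w; rewrite subr0 normr_id mul1r.
  have := cvgL2_Ex iB (L2_cst P 0) (L2_cst P 1) h.
  by rewrite [X in _ --> X](eq_Ex _ (g := fun=> 0)) ?Ex_cst// => w; rewrite mul0r.
have C0 : C K @[K --> \oo] --> (0 : R).
  have [||||_] := @dominated_Ex _ _ _ P (fun K w => `|G w - clamp K (G w)|) (fun=> 0) (fun w => 2 * `|G w|).
  - by move=> K; exact: L1_meas (iC K).
  - move=> w; rewrite -(@normr0 _ R) -(subrr (G w)); apply: cvg_norm.
    by apply: cvgB; [exact: cvg_cst|exact: cvg_clamp].
  - move=> K w; rewrite normr_id (le_trans (ler_normB _ _))// mulrDl mul1r lerD2l.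
    exact: clamp_norm2.
  - exact/L1Z/L1_norm.
  - by rewrite Ex_cst.
have M0 : 0 <= M := le_trans (normr_ge0 _) (bphi 0).
have bound k K : `|Ex P (fun w => phi (Fn k w) * F w) - Ex P (fun w => G w * phi' (F w))|
    <= M * A k + (M * K%:R) * B k + (2 * M) * C K.
  have [m1 j1] := ipun k.
  have j2 : L1 P (fun w => `|un k w - u w| * `|v w|) by exact: L2M.
  have j3 : L1 P (fun w => `|Fn k w - F w| * 1) by apply: L2M => //; exact: L2_cst.
  rewrite E1 -opprD normrN -ExD//; apply: (le_trans (Ex_norm (L1D j1 iGphi))).
  have e1 := L1Z M j2; have e2 := L1Z (M * K%:R) j3; have e3 := L1Z (2 * M) (iC K).
  rewrite /A /B /C -(ExZ M j2) -(ExZ _ j3) -(ExZ _ (iC K)) -(ExD e1 e2) -(ExD (L1D e1 e2) e3).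
  apply: (Ex_ae_le (L1_norm (L1D j1 iGphi)) (L1D (L1D e1 e2) e3)).
  apply: filterS GE => w Gw.
  have -> : phi' (Fn k w) * ip (un k w) (v w) + G w * phi' (F w) =
    phi' (Fn k w) * ip (un k w - u w) (v w) + (phi' (F w) - phi' (Fn k w)) * clamp K (G w)
     + (phi' (F w) - phi' (Fn k w)) * (G w - clamp K (G w)).
    by rewrite (ipBl hip) Gw (ipNr hip); ring.
  rewrite (le_trans (ler_normD _ _))// lerD//; last first.
    rewrite normrM ler_wpM2r// (le_trans (ler_normB _ _))// mulrDl mul1r; exact: lerD.
  rewrite (le_trans (ler_normD _ _))// lerD//.
    by rewrite normrM ler_pM// (ip_le_norm hip).
  rewrite normrM mulr1 mulrAC ler_pM//; last exact: clamp_norm.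
  by rewrite (distrC (Fn k w)); exact: lip.
have r0 K : `|Ex P (fun w => phi (F w) * F w) - Ex P (fun w => G w * phi' (F w))| <= (2 * M) * C K.
  have l1 : `|Ex P (fun w => phi (Fn k w) * F w) - Ex P (fun w => G w * phi' (F w))| @[k --> \oo] -->
      `|Ex P (fun w => phi (F w) * F w) - Ex P (fun w => G w * phi' (F w))|.
    by apply: cvg_norm; apply: cvgB; [exact: c2|exact: cvg_cst].
  have l2 : M * A k + (M * K%:R) * B k + (2 * M) * C K @[k --> \oo] --> M * 0 + (M * K%:R) * 0 + (2 * M) * C K.
    apply: cvgD; last exact: cvg_cst.
    by apply: cvgD; apply: cvgM => //; exact: cvg_cst.
  rewrite !mulr0 !add0r in l2.
  by apply: (ler_cvg_to l1 l2); apply: nearW => k; exact: bound.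
have r1 : `|Ex P (fun w => phi (F w) * F w) - Ex P (fun w => G w * phi' (F w))| <= 0.
  have l2 : (2 * M) * C K @[K --> \oo] --> (2 * M) * 0 by apply: cvgM => //; exact: cvg_cst.
  rewrite mulr0 in l2.
  by apply: (ler_cvg_to (cvg_cst _) l2); apply: nearW => K; exact: r0.
apply/eqP; rewrite -subr_eq0 -normr_le0; move: r1.
by rewrite (@eq_Ex _ _ _ _ (fun w => phi (F w) * F w) (fun w => F w * phi (F w)))// => w; rewrite mulrC.
Qed.

End C2Test.
End MalliavinIBP.

(** * Lipschitz test functions *)

Lemma is_derive_derive1 (R : realType) (f : R -> R) (x l : R) :
  derivable f x 1 -> f^`()%classic x = l -> is_derive x (1 : R) f l.
Proof. by move=> df <-; apply: DeriveDef => //; rewrite derive1E. Qed.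

Section Antiderivative.
Context (R : realType) (f : R -> R).
Hypothesis cf : continuous f.
Notation mu := (@lebesgue_measure R).

Let int a b : mu.-integrable `[a, b] (EFin \o f).
Proof.
apply: continuous_compact_integrable; first exact: segment_compact.
by apply: continuous_subspaceT => x; exact: cf.
Qed.

Definition primitive_from (N : nat) (x : R) : R := \int[mu]_(t in `[- N%:R, x]) f t.

(** The lower bound of integration depends on x, so as to lie to the left of both x and 0;
    subtracting the value at 0 makes the result independent of that bound. *)
Definition primitive (x : R) : R :=
  primitive_from (Num.truncn `|x|).+1 x - primitive_from (Num.truncn `|x|).+1 0.

Lemma primitive_fromB N M x : (N <= M)%N -> - N%:R <= x ->
  primitive_from M x - primitive_from M 0 = primitive_from N x - primitive_from N 0.
Proof.
move=> NM Nx.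
have key y : - N%:R <= y -> primitive_from M y - primitive_from M (- N%:R) = primitive_from N y.
  move=> Ny; rewrite /primitive_from Rintegral_itvB//; last by rewrite bnd_simp lerN2 ler_nat.
  rewrite Rintegral_itv_obnd_cbnd//; apply: (integrableS _ _ _ (int (- N%:R) y)) => //.
  exact: subset_itv_oc_cc.
by rewrite -(key x Nx) -(key 0) ?oppr_le0//; ring.
Qed.

Lemma is_derive_primitive (x : R) : is_derive x (1 : R) primitive (f x).
Proof.
(* One more than in [primitive], so that the same N also serves every y with |y| < |x| + 1. *)
pose N := (Num.truncn `|x|).+2.
have xN : `|x| + 1 < N%:R by rewrite -natr1 ltrD2r truncnS_gt.
have x0 : - N%:R < x.
  have := ler_norm (- x); rewrite normrN ltrNl; lra.
apply: (@near_eq_is_derive _ _ _ (fun y => primitive_from N y - primitive_from N 0)).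
  near=> y; have yx : `|y| < `|x| + 1.
    have -> : y = x - (x - y) by ring.
    apply: (le_lt_trans (ler_normB _ _)); rewrite ltrD2l.
    by near: y; apply: cvgr_dist_lt; [exact: cvg_id|].
  have ty : `|y| < (Num.truncn `|y|).+1%:R by exact: truncnS_gt.
  apply: primitive_fromB.
    rewrite ltnS -ltnS -(ltr_nat R).
    by rewrite (le_lt_trans _ (lt_trans yx xN))// truncn_le.
  have := ler_norm (- y); rewrite normrN; lra.
have h : is_derive x (1 : R) (primitive_from N) (f x).
  have [d1 d2] := @continuous_FTC1 R f (BLeft (- N%:R)) x (x + 1) (ltr_pwDr ltr01 (lexx x))
    (int (- N%:R) (x + 1)) x0 (cf (x := x)).
  exact: is_derive_derive1 d1 d2.
rewrite -[f x]subr0; exact: (is_deriveB h (is_derive_cst _ _ _)).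
Unshelve. all: by end_near. Qed.

Lemma ex_primitive : exists A : R -> R, forall x : R, is_derive x (1 : R) A (f x).
Proof. by exists primitive => x; exact: is_derive_primitive. Qed.

End Antiderivative.

Section Averaging.
Context (R : realType).
Implicit Types (f : R -> R).

(** Backward difference quotient; applied to a primitive of f, it is the mean of f over the interval
    of length 1 / (n + 1) ending at x. *)
Definition dquot (n : nat) f (x : R) : R := n.+1%:R * (f x - f (x - n.+1%:R^-1)).

Lemma is_derive_dquot n f f' (x : R) : (forall x : R, is_derive x (1 : R) f (f' x)) ->
  is_derive x (1 : R) (dquot n f) (dquot n f' x).
Proof.
move=> df.
have h : is_derive x (1 : R) (fun x => f (x - n.+1%:R^-1)) (f' (x - n.+1%:R^-1)).
  have h0 : is_derive x (1 : R) (fun x : R => x - n.+1%:R^-1) 1.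
    rewrite -[X in is_derive _ _ _ X]subr0.
    exact: (is_deriveB (is_derive_id _ _) (is_derive_cst _ _ _)).
  by have := @is_derive1_comp R f (fun x => x - n.+1%:R^-1) x _ _ (df _) h0; rewrite mulr1.
exact: (is_deriveZ n.+1%:R (is_deriveB (df x) h)).
Qed.

Lemma cvg_dquot f (l x : R) : is_derive x (1 : R) f l -> dquot n f x @[n --> \oo] --> l.
Proof.
move=> [dv dE].
have c : (fun h : R => h^-1 *: (f (h *: (1 : R) + x) - f x)) y @[y --> 0^'] --> l.
  by rewrite -dE; exact: dv.
have := (cvgr_dnbhsP _ _ _).1 c (fun n => - n.+1%:R^-1) _.
have h : (forall n : nat, (- n.+1%:R^-1 : R) != 0) /\ (- n.+1%:R^-1 : R) @[n --> \oo] --> (0 : R).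
  split=> [n|]; first by rewrite oppr_eq0 invr_eq0 pnatr_eq0.
  by rewrite -oppr0; apply: cvgN; exact: cvg_harmonic.
move=> /(_ h); apply: cvg_trans; apply: near_eq_cvg; apply: nearW => n.
by rewrite /dquot invrN invrK /GRing.scale/= mulr1 mulNr -mulrN opprB (addrC _ x).
Qed.

Lemma dquot_bound n f M : (forall x y, `|f x - f y| <= M * `|x - y|) ->
  forall x, `|dquot n f x| <= M.
Proof.
move=> lf x; rewrite normrM ger0_norm// -ler_pdivlMl//.
rewrite (le_trans (lf _ _))// opprB addrCA subrr addr0 ger0_norm ?invr_ge0// mulrC//.
Qed.

End Averaging.

(* Averaging over intervals of length 1/n to the left of x regularizes by one
   derivative and converges to the left derivative at a kink. *)
Section TestFunctionExtension.
Context (R : realType) (d : measure_display) (T : measurableType d) (P : probability T R).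
Variables (F G : T -> R).
Hypotheses (iF : L1 P F) (iG : L1 P G).
Hypothesis C2 : forall (phi phi' phi'' : R -> R) (M : R),
  (forall x : R, is_derive x (1 : R) phi (phi' x)) ->
  (forall x : R, is_derive x (1 : R) phi' (phi'' x)) -> continuous phi'' ->
  (forall x, `|phi x| <= M) -> (forall x, `|phi' x| <= M) -> (forall x, `|phi'' x| <= M) ->
  Ex P (fun w => F w * phi (F w)) = Ex P (fun w => G w * phi' (F w)).

Lemma continuous_is_derive (f f' : R -> R) :
  (forall x : R, is_derive x (1 : R) f (f' x)) -> continuous f.
Proof. by move=> df x; apply/differentiable_continuous/derivable1_diffP; exact: ex_derive. Qed.

Let mc (f : R -> R) : continuous f -> measurable_fun setT (fun w => f (F w)).
Proof. by move=> cf; exact: (measurableT_comp (continuous_measurable_fun cf) (L1_meas iF)). Qed.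

Lemma ibp_limit (fn fn' : nat -> R -> R) (phi psi : R -> R) M :
  (forall n, continuous (fn n)) -> (forall n, continuous (fn' n)) ->
  (forall n x, `|fn n x| <= M) -> (forall n x, `|fn' n x| <= M) ->
  (forall x, fn n x @[n --> \oo] --> phi x) -> (forall x, fn' n x @[n --> \oo] --> psi x) ->
  (forall n, Ex P (fun w => F w * fn n (F w)) = Ex P (fun w => G w * fn' n (F w))) ->
  [/\ L1 P (fun w => F w * phi (F w)), L1 P (fun w => G w * psi (F w)) &
  Ex P (fun w => F w * phi (F w)) = Ex P (fun w => G w * psi (F w))].
Proof.
move=> c1 c2 b1 b2 l1 l2 E.
have lim (D : T -> R) (gn : nat -> R -> R) (g : R -> R) : L1 P D -> (forall n, continuous (gn n)) ->
    (forall n x, `|gn n x| <= M) -> (forall x, gn n x @[n --> \oo] --> g x) ->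
    L1 P (fun w => D w * g (F w)) /\
    Ex P (fun w => D w * gn n (F w)) @[n --> \oo] --> Ex P (fun w => D w * g (F w)).
  move=> iD cg bg lg; apply: (@dominated_Ex _ _ _ P (fun n w => D w * gn n (F w)) _ (fun w => M * `|D w|)).
  - by move=> n; apply: measurable_funM; [exact: L1_meas iD|exact: mc].
  - by move=> w; apply: cvgM; [exact: cvg_cst|exact: lg].
  - by move=> n w; rewrite normrM mulrC ler_wpM2r.
  - exact/L1Z/L1_norm.
have [i1 k1] := lim F _ _ iF c1 b1 l1; have [i2 k2] := lim G _ _ iG c2 b2 l2.
by split=> //; exact: (cvg_to_unique E k1 k2).
Qed.

Lemma continuous_dquot n (f : R -> R) : continuous f -> continuous (dquot n f).
Proof.
move=> cf x; rewrite /continuous_at /dquot.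
apply: cvgM; first exact: cvg_cst.
apply: cvgB; first exact: cf.
have cs : (y - n.+1%:R^-1) @[y --> (x : R)] --> ((x : R) - n.+1%:R^-1 : R).
  by apply: cvgB; [exact: cvg_id|exact: cvg_cst].
exact: (cvg_comp _ f cs (cf _)).
Qed.

Lemma ibp_C1 (phi phi' : R -> R) (M : R) :
  (forall x : R, is_derive x (1 : R) phi (phi' x)) -> continuous phi' ->
  (forall x, `|phi x| <= M) -> (forall x, `|phi' x| <= M) ->
  Ex P (fun w => F w * phi (F w)) = Ex P (fun w => G w * phi' (F w)).
Proof.
move=> dphi cphi' bphi bphi'; have cphi := continuous_is_derive dphi.
have [A dA] := ex_primitive cphi; have cA := continuous_is_derive dA.
have lA := derive_bound_lipschitz dA bphi.
have lphi := derive_bound_lipschitz dphi bphi'.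
have M0 : 0 <= M := le_trans (normr_ge0 _) (bphi 0).
have [] // := @ibp_limit (fun n => dquot n A) (fun n => dquot n phi) phi phi' M.
- by move=> n; exact: continuous_dquot.
- by move=> n; exact: continuous_dquot.
- by move=> n x; exact: dquot_bound.
- by move=> n x; exact: dquot_bound.
- by move=> x; exact: cvg_dquot.
- by move=> x; exact: cvg_dquot.
(* The bound on the second derivative grows with n, which is harmless: it only licenses the use of
   [C2], while the passage to the limit uses M. *)
move=> n; apply: (@C2 (dquot n A) (dquot n phi) (dquot n phi') (n.+1%:R * (M + M))).
- by move=> x; exact: is_derive_dquot.
- by move=> x; exact: is_derive_dquot.
- exact: continuous_dquot.
- move=> x; rewrite (le_trans (dquot_bound n lA x))//.
  rewrite (le_trans (_ : M <= 1 * (M + M)))//; first by rewrite mul1r lerDl.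
  by rewrite ler_wpM2r ?addr_ge0// ler1n.
- move=> x; rewrite (le_trans (dquot_bound n lphi x))//.
  rewrite (le_trans (_ : M <= 1 * (M + M)))//; first by rewrite mul1r lerDl.
  by rewrite ler_wpM2r ?addr_ge0// ler1n.
- move=> x; rewrite normrM ger0_norm// ler_wpM2l//.
  by rewrite (le_trans (ler_normB _ _))// lerD.
Qed.

(** [psi] is a limit at every point, so dominated convergence applies even if the law of F charges a
    kink of [phi]. *)
Lemma ibp_lipschitz (phi psi : R -> R) (M : R) :
  (forall x, `|phi x| <= M) -> (forall x y, `|phi x - phi y| <= M * `|x - y|) ->
  (forall x, dquot n phi x @[n --> \oo] --> psi x) ->
  [/\ L1 P (fun w => F w * phi (F w)), L1 P (fun w => G w * psi (F w)) &
  Ex P (fun w => F w * phi (F w)) = Ex P (fun w => G w * psi (F w))].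
Proof.
move=> bphi lphi lpsi.
have M0 : 0 <= M := le_trans (normr_ge0 _) (bphi 0).
have cphi : continuous phi.
  move=> x; apply/cvgrPdist_lt => e e0; near=> y.
  rewrite (le_lt_trans (lphi _ _))// (@le_lt_trans _ _ ((1 + M) * `|x - y|))//.
    by rewrite ler_wpM2r// lerDr.
  rewrite mulrC -ltr_pdivlMr ?ltr_pwDl//; near: y.
  by apply: cvgr_dist_lt; [exact: cvg_id|rewrite divr_gt0// ltr_pwDl].
have [A dA] := ex_primitive cphi; have cA := continuous_is_derive dA.
have lA := derive_bound_lipschitz dA bphi.
apply: (@ibp_limit (fun n => dquot n A) (fun n => dquot n phi) phi psi M) => //.
- by move=> n; exact: continuous_dquot.
- by move=> n; exact: continuous_dquot.
- by move=> n x; exact: dquot_bound.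
- by move=> n x; exact: dquot_bound.
- by move=> x; exact: cvg_dquot.
move=> n; apply: (@ibp_C1 (dquot n A) (dquot n phi) M).
- by move=> x; exact: is_derive_dquot.
- exact: continuous_dquot.
- by move=> x; exact: dquot_bound.
- by move=> x; exact: dquot_bound.
Unshelve. all: by end_near. Qed.

End TestFunctionExtension.

(** * The Stein equation of the Gamma law *)

Section GammaSeries.
Context (R : realType).
Implicit Types (b x y : R).

(* [gser b y] is the integral of s^(b - 1) e^(y s) over [0, 1]. *)
Definition gser_coeff b (k : nat) : R := (k`!%:R * (b + k%:R))^-1.

Definition gser b y : R := limn (pseries (gser_coeff b) y).

Lemma gser_coeff_ge0 b k : 0 < b -> 0 <= gser_coeff b k.
Proof. by move=> b0; rewrite invr_ge0 mulr_ge0// addr_ge0// ltW. Qed.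

Lemma is_cvg_gser b y : 0 < b -> cvgn (pseries (gser_coeff b) y).
Proof.
move=> b0; apply: normed_cvg.
apply: (@series_le_cvg R _ (fun k => b^-1 * exp_coeff `|y| k)).
- by move=> k; exact: normr_ge0.
- by move=> k; apply: mulr_ge0; [rewrite invr_ge0 ltW|exact: exp_coeff_ge0].
- move=> k; rewrite /= normrM normrX ger0_norm ?gser_coeff_ge0// /exp_coeff mulrCA [leRHS]mulrC.
  apply: ler_wpM2r; first exact: exprn_ge0.
  rewrite /gser_coeff invfM [leLHS]mulrC ler_wpM2r ?invr_ge0//.
  by rewrite lef_pV2 ?posrE// ?lerDl// ltr_wpDr.
- by apply: is_cvg_seriesZ; exact: is_cvg_series_exp_coeff.
Qed.

Lemma gser_coeff_diffs b : pseries_diffs (gser_coeff b) = gser_coeff (b + 1).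
Proof.
apply/funext => k; rewrite /pseries_diffs /gser_coeff factS natrM -mulrA invfM mulVKf ?pnatr_eq0//.
by rewrite -addrA [1 + _]addrC natr1.
Qed.

Lemma is_derive_gser b y : 0 < b -> is_derive y (1 : R) (gser b) (gser (b + 1) y).
Proof.
move=> b0; rewrite /gser -gser_coeff_diffs; apply: (@pseries_snd_diffs R _ (`|y| + 1)).
- exact: is_cvg_gser.
- by rewrite gser_coeff_diffs; apply: is_cvg_gser; rewrite addr_gt0.
- by rewrite !gser_coeff_diffs; apply: is_cvg_gser; rewrite !addr_gt0.
- by rewrite [ltRHS]ger0_norm ?addr_ge0// ltrDl.
Qed.

(** Integration by parts on [0, 1]: both sides are the integral of the derivative of s^b e^(y s).
    The proof compares coefficients. *)
Lemma gser_rec b y : 0 < b -> y * gser (b + 1) y + b * gser b y = expR y.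
Proof.
move=> b0; have b1 : 0 < b + 1 by rewrite addr_gt0.
(* The factor y raises degrees by one, hence partial sums of length n on one side and n + 1 on the
   other. *)
have c1 : y * pseries (gser_coeff (b + 1)) y n + b * pseries (gser_coeff b) y n.+1 @[n --> \oo] -->
   y * gser (b + 1) y + b * gser b y.
  apply: cvgD; apply: cvgM; [exact: cvg_cst|exact: is_cvg_gser|exact: cvg_cst|].
  by rewrite (cvg_shiftS (pseries (gser_coeff b) y)); exact: is_cvg_gser.
have c2 : series (exp_coeff y) n.+1 @[n --> \oo] --> expR y.
  by rewrite (cvg_shiftS (series (exp_coeff y))); exact: is_cvg_series_exp_coeff.
apply: (cvg_to_unique _ c1 c2) => n; rewrite /pseries /series/=.
elim: n => [|n IH].
  rewrite big_geq// mulr0 add0r !big_nat1 /gser_coeff /exp_coeff/= fact0 addr0 !expr0; field.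
  by rewrite gt_eqF.
rewrite (big_nat_recr n)//= (big_nat_recr n.+1)//= [RHS](big_nat_recr n.+1)//= -IH !mulrDr.
suff : y * (gser_coeff (b + 1) n * y ^+ n) + b * (gser_coeff b n.+1 * y ^+ n.+1) = exp_coeff y n.+1 by lra.
have bn : b + n.+1%:R != 0 by rewrite gt_eqF// addr_gt0.
have fn : (n`!%:R : R) != 0 by rewrite pnatr_eq0 -lt0n fact_gt0.
have n1 : (n.+1%:R : R) != 0 by rewrite pnatr_eq0.
rewrite /gser_coeff /exp_coeff /= factS natrM -addrA [1 + _]addrC natr1 exprS.
move: bn n1; move: (n.+1%:R : R) => t bn n1.
by field; rewrite bn fn n1.
Qed.

Lemma continuous_gser b : 0 < b -> continuous (gser b).
Proof. by move=> b0; apply: continuous_is_derive => y; exact: is_derive_gser. Qed.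

Lemma gser_ge0_pos b y : 0 < b -> 0 <= y -> 0 <= gser b y.
Proof.
move=> b0 y0; apply: limr_ge; first exact: is_cvg_gser.
by apply: nearW => n; apply: sumr_ge0 => k _; rewrite mulr_ge0 ?exprn_ge0 ?gser_coeff_ge0.
Qed.

(* The lower incomplete gamma function, written so that no integral is needed. *)
Definition igamma a x : R := x `^ a * gser a (- x).

Lemma is_derive_igamma a x : 0 < a -> 0 < x ->
  is_derive x (1 : R) (igamma a) (x `^ (a - 1) * expR (- x)).
Proof.
move=> a0 x0; have d1 := is_derive1_powR a x0.
have d2 : is_derive x (1 : R) (fun x : R => gser a (- x)) (- gser (a + 1) (- x)).
  have := is_derive1_comp (is_derive_gser (- x) a0) (is_deriveNid x (1 : R)).
  by rewrite mulrN1.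
apply: (is_derive_eq (is_deriveM d1 d2)).
rewrite /GRing.scale/= -(gser_rec (- x) a0).
have -> : x `^ a = x * x `^ (a - 1) by rewrite mulr_powRB1// ltW.
ring.
Qed.

Lemma segment_MVT (f f' : R -> R) x y : x < y ->
  (forall t, x <= t <= y -> is_derive t (1 : R) f (f' t)) ->
  exists2 c, x < c < y & f y - f x = f' c * (y - x).
Proof.
move=> xy df; have [||c cxy E] := @MVT R f f' x y xy.
- by move=> t; rewrite in_itv/= => /andP[h1 h2]; apply: df; rewrite !ltW.
- apply: derivable_within_continuous => t; rewrite in_itv/= => h.
  exact: (@ex_derive _ _ _ _ _ _ _ (df t h)).
by exists c => //; move: cxy; rewrite in_itv.
Qed.

Lemma derive_ge0_le (f f' : R -> R) x y : x <= y ->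
  (forall t, x <= t <= y -> is_derive t (1 : R) f (f' t)) ->
  (forall t, x <= t <= y -> 0 <= f' t) -> f x <= f y.
Proof.
rewrite le_eqVlt => /orP[/eqP -> //|xy] df f0; have [c /andP[xc cy] E] := segment_MVT xy df.
by rewrite -subr_ge0 E mulr_ge0 ?f0 ?ltW// subr_gt0.
Qed.

Section Shape.
Variable a : R.
Hypothesis a0 : 0 < a.

Lemma igamma_le x y : 0 < x -> x <= y -> igamma a x <= igamma a y.
Proof.
move=> x0 xy; apply: (derive_ge0_le xy) => t /andP[xt _].
  by apply: is_derive_igamma => //; exact: lt_le_trans xt.
by rewrite mulr_ge0 ?powR_ge0// expR_ge0.
Qed.

Lemma igamma_cvg0 : igamma a x @[x --> 0^'+] --> (0 : R).
Proof.
rewrite -[X in _ --> X](mul0r (gser a (- 0))); apply: cvgM; first exact: powR_cvg0.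
apply: (cvg_comp _ (gser a) (G := nbhs (- 0 : R))); last exact: continuous_gser.
by apply: cvgN; exact: cvg_within.
Qed.

Lemma igamma_ge0 x : 0 < x -> 0 <= igamma a x.
Proof.
move=> x0; apply: (ler_cvg_to igamma_cvg0 (cvg_cst (igamma a x))).
near=> e; apply: igamma_le; near: e; [exact: nbhs_right_gt|exact: nbhs_right_le].
Unshelve. all: by end_near. Qed.

(** For y < 0 the terms alternate in sign; positivity is inherited from [igamma], which increases
    from its limit 0 at the origin. *)
Lemma gser_ge0 y : 0 <= gser a y.
Proof.
have [y0|y0] := leP 0 y; first exact: gser_ge0_pos.
have := @igamma_ge0 (- y); rewrite oppr_gt0 => /(_ y0).
by rewrite /igamma opprK pmulr_rge0// powR_gt0// ltrNr oppr0.
Qed.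

Lemma gser0 : gser a 0 = a^-1.
Proof.
have := gser_rec 0 a0; rewrite mul0r add0r expR0 => E.
by apply: (mulfI (lt0r_neq0 a0)); rewrite E mulfV// gt_eqF.
Qed.

(** The derivative of igamma(t) + 2 t^(a-1) e^(-t) is - (t - 2 (a - 1)) t^(a-2) e^(-t), so this sum
    decreases for t >= 2 a + 2. *)
Lemma igamma_tail x y : 2 * a + 2 <= x -> x <= y ->
  igamma a y <= igamma a x + 2 * (x `^ (a - 1) * expR (- x)).
Proof.
move=> ax xy.
pose B t := - (igamma a t + 2 * (t `^ (a - 1) * expR (- t))).
suff : B x <= B y.
  rewrite lerN2 => h; apply: le_trans h; rewrite lerDl mulr_ge0// mulr_ge0 ?powR_ge0// expR_ge0.
pose B' t := t `^ (a - 1) * expR (- t) - 2 * ((a - 1) * t `^ (a - 1 - 1) * expR (- t)).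
apply: (@derive_ge0_le B B' _ _ xy) => t /andP[xt _].
  have t0 : 0 < t by move: a0; lra.
  have d1 := is_derive1_powR (a - 1) t0.
  have d2 := is_derive1_comp (is_derive_expR (- t)) (is_deriveNid t (1 : R)).
  have d3 := is_deriveM d1 d2.
  have d4 := is_deriveN (is_deriveD (is_derive_igamma a0 t0) (is_deriveZ 2 d3)).
  apply: (is_derive_eq d4).
  by rewrite /GRing.scale/= /B'; ring.
have t0 : 0 < t by move: a0; lra.
rewrite /B'; have -> : t `^ (a - 1) = t * t `^ (a - 1 - 1).
  transitivity (t `^ (1 + (a - 1 - 1))); first by congr powR; ring.
  by rewrite [LHS]powRD ?(gt_eqF t0) ?implybT// powRr1// ltW.
have -> : t * t `^ (a - 1 - 1) * expR (- t) - 2 * ((a - 1) * t `^ (a - 1 - 1) * expR (- t)) =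
  (t - 2 * (a - 1)) * (t `^ (a - 1 - 1) * expR (- t)) by ring.
rewrite mulr_ge0 ?mulr_ge0 ?powR_ge0 ?expR_ge0//; lra.
Qed.

(** The value Gamma(a), as the supremum of a bounded increasing function; [gamma_total_fun]
    identifies it with the integral [gamma_fun a]. *)
Definition gamma_total : R := sup [set igamma a x | x in [set x | 0 < x]].

Lemma has_sup_igamma : has_sup [set igamma a x | x in [set x | 0 < x]].
Proof.
split; first by exists (igamma a 1), 1 => //=.
have K0 : 0 < 2 * a + 2 by move: a0; lra.
exists (igamma a (2 * a + 2) + 2 * ((2 * a + 2) `^ (a - 1) * expR (- (2 * a + 2)))) => _ [x /= x0 <-].
have [xK|/ltW Kx] := leP x (2 * a + 2); last exact: igamma_tail.
by rewrite (le_trans (igamma_le x0 xK))// lerDl mulr_ge0// mulr_ge0 ?powR_ge0// expR_ge0.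
Qed.

Lemma igamma_le_total x : 0 < x -> igamma a x <= gamma_total.
Proof. by move=> x0; apply: (sup_upper_bound has_sup_igamma); exists x. Qed.

Lemma total_le_tail x : 2 * a + 2 <= x ->
  gamma_total <= igamma a x + 2 * (x `^ (a - 1) * expR (- x)).
Proof.
move=> Kx; have x0 : 0 < x by move: a0; lra.
apply: ge_sup; first by case: has_sup_igamma.
move=> _ [y /= y0 <-]; have [xy|/ltW yx] := leP x y; first exact: igamma_tail.
by rewrite (le_trans (igamma_le y0 yx))// lerDl mulr_ge0// mulr_ge0 ?powR_ge0// expR_ge0.
Qed.

Lemma cvg_igamma_total : igamma a x @[x --> +oo] --> gamma_total.
Proof.
apply/cvgrPdist_le => e e0.
have [_ [y /= y0 <-] hy] := sup_adherent e0 has_sup_igamma.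
near=> x; have yx : y <= x by near: x; apply: nbhs_pinfty_ge; exact: num_real.
have x0 : 0 < x by exact: lt_le_trans yx.
rewrite ger0_norm ?subr_ge0 ?igamma_le_total//.
have := igamma_le y0 yx; move: hy; rewrite -/gamma_total; lra.
Unshelve. all: by end_near. Qed.
End Shape.

Lemma gser_homo b x y : 0 < b -> x <= y -> gser b x <= gser b y.
Proof.
move=> b0 xy; apply: (derive_ge0_le xy) => t _; first exact: is_derive_gser.
by apply: gser_ge0; rewrite addr_gt0.
Qed.

Lemma igamma_small a x : 0 < a -> 0 < x -> igamma a x <= x `^ a / a.
Proof.
move=> a0 x0; rewrite /igamma ler_wpM2l ?powR_ge0// -(gser0 a0) gser_homo// oppr_le0 ltW//.
Qed.

(* [b * kum b x] is the Kummer function 1F1(1; b + 1; x). *)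
Definition kum b x : R := expR x * gser b (- x).

Lemma is_derive_kum b x : 0 < b -> is_derive x (1 : R) (kum b) (kum b x - kum (b + 1) x).
Proof.
move=> b0; have d1 := is_derive_expR x.
have d2 : is_derive x (1 : R) (fun x : R => gser b (- x)) (- gser (b + 1) (- x)).
  have := is_derive1_comp (is_derive_gser (- x) b0) (is_deriveNid x (1 : R)).
  by rewrite mulrN1.
by apply: (is_derive_eq (is_deriveM d1 d2)); rewrite /GRing.scale/= /kum; ring.
Qed.

Lemma kum_ge0 b x : 0 < b -> 0 <= kum b x.
Proof. by move=> b0; rewrite mulr_ge0 ?expR_ge0 ?gser_ge0. Qed.

Lemma kum_rec b x : 0 < b -> b * kum b x = 1 + x * kum (b + 1) x.
Proof.
move=> b0; have := gser_rec (- x) b0 => E.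
transitivity (expR x * expR (- x) + x * kum (b + 1) x); first by rewrite -E /kum; ring.
by rewrite -expRD subrr expR0.
Qed.

(** The bound covers all negative x. For x <= 0 the recurrence gives b kum(b, x) <= 1; for x >= 0,
    e^x <= e^K and gser b (- x) <= gser b 0 = 1 / b. *)
Lemma kum_bound b x K : 0 < b -> 0 <= K -> x <= K -> kum b x <= expR K / b.
Proof.
move=> b0 K0 xK; rewrite ler_pdivlMr// mulrC.
have [x0|/ltW x0] := leP 0 x.
  rewrite /kum mulrCA -[leRHS]mulr1 ler_pM ?expR_ge0 ?mulr_ge0 ?gser_ge0 ?(ltW b0)// ?ler_expR//.
  by rewrite -(mulfV (lt0r_neq0 b0)) ler_wpM2l ?(ltW b0)// -(gser0 b0) gser_homo// oppr_le0.
rewrite kum_rec// (le_trans (_ : _ <= 1))//.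
  by rewrite -[leRHS]addr0 lerD2l mulr_le0_ge0// kum_ge0// addr_gt0.
by rewrite -[leLHS](expR0 R) ler_expR.
Qed.

Lemma kum_derive_bound b x K : 0 < b -> 0 <= K -> x <= K ->
  `|kum b x - kum (b + 1) x| <= expR K / b.
Proof.
move=> b0 K0 xK; have b1 : 0 < b + 1 by rewrite addr_gt0.
have h1 := kum_ge0 x b0; have h2 := kum_ge0 x b1.
have h3 := kum_bound b0 K0 xK; have h4 := kum_bound b1 K0 xK.
have h5 : expR K / (b + 1) <= expR K / b.
  by rewrite ler_wpM2l ?expR_ge0// lef_pV2 ?posrE// lerDl.
by rewrite ler_norml; apply/andP; split; lra.
Qed.

Lemma kum_ode b x : 0 < b -> x * (kum b x - kum (b + 1) x) = 1 + (x - b) * kum b x.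
Proof. by move=> b0; rewrite mulrBr mulrBl kum_rec//; ring. Qed.

Section Tail.
Variable a : R.
Hypothesis a0 : 0 < a.
(** The threshold of [igamma_tail]: up to K the solution is controlled by [kum], with bound E, and
    beyond K by the Gamma tail. *)
Let K := 2 * a + 2.
Let E := expR K / a.

(** The reciprocal of x^a e^(-x), the positive solution of the homogeneous equation x g' = (x - a)
    g. *)
Definition gamma_weight x : R := expR x * x `^ (- a).

(** The solution of x g' - (x - a) g = -1 on ]0, +oo[ that stays bounded at infinity. *)
Definition tail_ratio x : R := (gamma_total a - igamma a x) * gamma_weight x.

Lemma gamma_weight_ge0 x : 0 <= gamma_weight x.
Proof. by rewrite mulr_ge0 ?expR_ge0 ?powR_ge0. Qed.

Lemma gamma_weightM x : 0 < x -> x `^ (a - 1) * expR (- x) * gamma_weight x = x^-1.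
Proof.
move=> x0; rewrite /gamma_weight -[RHS]powR_inv1 ?(ltW x0)//.
transitivity ((x `^ (a - 1) * x `^ (- a)) * (expR (- x) * expR x)); first by ring.
rewrite -expRD addNr expR0 mulr1 -powRD ?(gt_eqF x0) ?implybT//.
by congr powR; ring.
Qed.

Lemma igamma_weight x : 0 < x -> igamma a x * gamma_weight x = kum a x.
Proof.
move=> x0; rewrite /igamma /gamma_weight /kum.
transitivity ((x `^ a * x `^ (- a)) * (expR x * gser a (- x))); first by ring.
by rewrite -powRD ?(gt_eqF x0) ?implybT// subrr powRr0 mul1r.
Qed.

Lemma is_derive_tail_ratio x : 0 < x ->
  is_derive x (1 : R) tail_ratio (tail_ratio x * (1 - a / x) - x^-1).
Proof.
move=> x0.
have d1 := is_deriveB (is_derive_cst (gamma_total a) x (1 : R)) (is_derive_igamma a0 x0).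
have d2 := is_deriveM (is_derive_expR x) (is_derive1_powR (- a) x0).
apply: (is_derive_eq (is_deriveM d1 d2)); rewrite /GRing.scale/= sub0r.
have -> : x `^ (- a - 1) = x `^ (- a) / x.
  by rewrite powRD ?(gt_eqF x0) ?implybT// powR_inv1// ltW.
rewrite -(gamma_weightM x0) /tail_ratio /gamma_weight.
rewrite [(cst _ - _) x](_ : _ = gamma_total a - igamma a x)// [(expR * _) x](_ : _ = expR x * x `^ (- a))//.
ring.
Qed.

Lemma tail_ratio_ge0 x : 0 < x -> 0 <= tail_ratio x.
Proof. by move=> x0; rewrite mulr_ge0 ?gamma_weight_ge0// subr_ge0 igamma_le_total. Qed.

Lemma tail_ratio_le x : K <= x -> tail_ratio x <= 2 / x.
Proof.
move=> Kx; have x0 : 0 < x by move: a0 Kx; rewrite /K; lra.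
rewrite -(gamma_weightM x0) mulrA ler_wpM2r ?gamma_weight_ge0//.
by have := total_le_tail a0 Kx; lra.
Qed.

Lemma tail_ratio_ode x : 0 < x ->
  x * (tail_ratio x * (1 - a / x) - x^-1) = (x - a) * tail_ratio x - 1.
Proof. by move=> x0; field; rewrite gt_eqF. Qed.

(* The bounded solution of [x g' - (x - a) g = (x <= z) - m], where [m] is the
   mass of ]0, z] under the Gamma(a) law, and its left derivative. *)
Variables (z : R).
Hypotheses (z0 : 0 < z) (tot0 : 0 < gamma_total a).
Let m := igamma a z / gamma_total a.

Definition stein x : R := if x <= z then (1 - m) * kum a x else m * tail_ratio x.

Definition stein' x : R :=
  if x <= z then (1 - m) * (kum a x - kum (a + 1) x)
  else m * (tail_ratio x * (1 - a / x) - x^-1).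

Let m01 : 0 <= m <= 1.
Proof. by rewrite divr_ge0 ?igamma_ge0 ?(ltW tot0)//= ler_pdivrMr// mul1r igamma_le_total. Qed.

Lemma stein_ode x : x * stein' x - (x - a) * stein x = (x <= z)%R%:R - m.
Proof.
rewrite /stein /stein'; case: (leP x z) => zx /=.
  by rewrite mulrCA kum_ode//; ring.
by rewrite mulrCA tail_ratio_ode ?(lt_trans z0)//; ring.
Qed.

(** The value of m is the one for which the two pieces of [stein] meet at z. *)
Lemma stein_cont : m * tail_ratio z = (1 - m) * kum a z.
Proof. by rewrite -igamma_weight// /tail_ratio /m; field; rewrite gt_eqF. Qed.

Lemma stein_ge0 x : 0 <= stein x.
Proof.
have /andP[m0 m1] := m01; rewrite /stein; case: (leP x z) => zx.
  by rewrite mulr_ge0 ?subr_ge0 ?kum_ge0.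
by rewrite mulr_ge0 ?tail_ratio_ge0// (lt_trans z0).
Qed.

(** The formula valid on one side of z dominates the solution on the other: left of z, (1 - m)
    igamma(x) <= gamma_total - igamma(x), because igamma(x) <= igamma(z). *)
Lemma stein_le_tail x : K <= x -> stein x <= 2 / x.
Proof.
move=> Kx; have x0 : 0 < x by move: a0 Kx; rewrite /K; lra.
have /andP[m0 m1] := m01; apply: le_trans (tail_ratio_le Kx).
rewrite /stein; case: (leP x z) => xz; last by rewrite ler_piMl ?tail_ratio_ge0.
rewrite -igamma_weight// mulrA ler_wpM2r ?gamma_weight_ge0//.
have l1 := igamma_le a0 x0 xz; have l2 := igamma_le_total a0 x0; have l3 := igamma_ge0 a0 x0.
have -> : 1 - m = (gamma_total a - igamma a z) / gamma_total a by rewrite /m; field; rewrite gt_eqF.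
rewrite mulrAC ler_pdivrMr//.
by apply: ler_pM => //; [rewrite subr_ge0 igamma_le_total|lra].
Qed.

(** The mirror argument: right of z, m (gamma_total - igamma(x)) <= igamma(x), because igamma(z) <=
    igamma(x). *)
Lemma stein_le_kum x : x <= K -> stein x <= E.
Proof.
have K0 : 0 <= K by move: a0; rewrite /K; lra.
move=> xK; have /andP[m0 m1] := m01; apply: le_trans (kum_bound a0 K0 xK).
have k0 := kum_ge0 x a0.
rewrite /stein; case: (leP x z) => xz; first by rewrite ler_piMl// lerBlDr lerDl.
have x0 : 0 < x := lt_trans z0 xz.
rewrite -igamma_weight// /tail_ratio mulrA ler_wpM2r ?gamma_weight_ge0//.
have l1 := igamma_le a0 z0 (ltW xz); have l2 := igamma_le_total a0 x0; have l3 := igamma_ge0 a0 z0.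
rewrite /m mulrAC ler_pdivrMr// ler_pM// ?subr_ge0//; first by lra.
Qed.

Variable al : R.
Hypotheses (al0 : 0 < al) (al1 : al <= 1) (alz : al <= z).
(** Chosen above the bounds 4, E and K E + 1 that occur in the different regions. *)
Definition stein_cst : R := 4 + (K + 1) * E.

Let E0 : 0 < E. Proof. by rewrite divr_gt0 ?expR_gt0. Qed.
Let K1 : 2 <= K. Proof. by move: a0; rewrite /K; lra. Qed.

Let C4 : 4 <= stein_cst.
Proof. rewrite /stein_cst; move: E0 K1; move: E K => E' K'; nra. Qed.

Let CE : E <= stein_cst.
Proof. rewrite /stein_cst; move: E0 K1; move: E K => E' K'; nra. Qed.

Let CKE : K * E + 1 <= stein_cst.
Proof. rewrite /stein_cst; move: E0 K1; move: E K => E' K'; nra. Qed.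

Let cst_le : stein_cst <= stein_cst / al.
Proof. by rewrite ler_peMr ?invf_ge1//; move: C4; lra. Qed.

Lemma stein_bound x : `|stein x| <= stein_cst / al.
Proof.
apply: le_trans cst_le; rewrite ger0_norm ?stein_ge0//.
have [xK|/ltW Kx] := leP x K; first exact: le_trans (stein_le_kum xK) CE.
apply: (le_trans (stein_le_tail Kx)); have x2 : 2 <= x by exact: le_trans K1 Kx.
by rewrite ler_pdivrMr; [move: C4 x2; move: stein_cst => c; nra|lra].
Qed.

(** Left of z and up to K, [kum_derive_bound] applies. Between z and K the derivative is solved from
    the equation, and the division by x >= z >= al costs the factor 1 / al. Beyond K the decay 2 / x
    of the solution compensates the coefficient x - a. *)
Lemma stein'_bound x : `|stein' x| <= stein_cst / al.
Proof.
have /andP[m0 m1] := m01; have [xK|/ltW Kx] := leP x K.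
  have [xz|zx] := leP x z.
    apply: le_trans cst_le; rewrite /stein' xz normrM ger0_norm ?subr_ge0//.
    have K0 : 0 <= K by move: K1; lra.
    apply: le_trans CE; apply: le_trans (kum_derive_bound a0 K0 xK).
    by rewrite ler_piMl// lerBlDr lerDl.
  have x0 : 0 < x := lt_trans z0 zx.
  have xal : al <= x := le_trans alz (ltW zx).
  have -> : stein' x = ((x - a) * stein x - m) / x.
    have := stein_ode x; rewrite leNgt zx/= => /eqP; rewrite subr_eq => /eqP h.
    apply: (mulfI (lt0r_neq0 x0)); rewrite h; field; by rewrite gt_eqF.
  rewrite normrM normfV [`|x|]gtr0_norm// ler_pM ?invr_ge0 ?(ltW x0)//; last first.
    by rewrite lef_pV2.
  have s0 := stein_ge0 x; have s1 := stein_le_kum xK.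
  rewrite (le_trans (ler_normB _ _))// normrM (ger0_norm s0) (ger0_norm m0).
  have xa : `|x - a| <= K by rewrite ler_norml; apply/andP; split; move: a0 x0 xK; rewrite /K; lra.
  apply: le_trans CKE; apply: lerD => //; exact: ler_pM.
apply: le_trans cst_le.
have x0 : 0 < x by move: K1 Kx; lra.
have s0 := stein_ge0 x; have s1 := stein_le_tail Kx.
have E' : x * stein' x = (x - a) * stein x + ((x <= z)%R%:R - m).
  by rewrite -(stein_ode x); ring.
have h : `|(x <= z)%R%:R - m| <= 1.
  by rewrite ler_norml; case: (leP x z) => _ /=; apply/andP; split; lra.
have xs : x * stein x <= 2 by rewrite mulrC -ler_pdivlMr.
(* Here |x - a| <= x, so the first term of the equation is at most 2 and the right-hand side at most
   1. *)
have : x * `|stein' x| <= 3.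
  rewrite -[X in X * _](gtr0_norm x0) -normrM E' (le_trans (ler_normD _ _))//.
  have : `|(x - a) * stein x| <= 2.
    rewrite normrM (ger0_norm s0) (le_trans _ xs)// ler_wpM2r//.
    by rewrite ler_norml; apply/andP; split; move: a0 Kx; rewrite /K; lra.
  lra.
have := C4; have x2 : 2 <= x by exact: le_trans K1 Kx.
move: (`|_|) (normr_ge0 (stein' x)) x2; move: stein_cst => c t; nra.
Qed.

(** The difference quotients in [dquot] look only to the left, so agreement with a differentiable
    function there suffices; at z this function is the left piece. *)
Lemma stein_left_germ x : exists f : R -> R, is_derive x (1 : R) f (stein' x) /\
  exists2 e, 0 < e & forall y, x - e < y <= x -> stein y = f y.
Proof.
have [xz|zx] := leP x z.
  exists (fun y => (1 - m) * kum a y); split.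
    by rewrite /stein' xz; exact: (is_deriveZ (1 - m) (is_derive_kum x a0)).
  by exists 1 => // y /andP[_ yx]; rewrite /stein (le_trans yx xz).
have x0 : 0 < x := lt_trans z0 zx.
exists (fun y => m * tail_ratio y); split.
  by rewrite /stein' leNgt zx/=; exact: (is_deriveZ m (is_derive_tail_ratio x0)).
exists (x - z); first by rewrite subr_gt0.
by move=> y /andP[h _]; rewrite /stein leNgt (_ : z < y)//; move: h; lra.
Qed.

Lemma stein_lipschitz x y : `|stein x - stein y| <= stein_cst / al * `|x - y|.
Proof.
wlog xy : x y / x <= y.
  by move=> wl; have [|/ltW] := leP x y => [/wl//|/wl]; rewrite distrC (distrC y).
have left u v : u <= v -> v <= z -> `|stein u - stein v| <= stein_cst / al * (v - u).
  rewrite le_eqVlt => /orP[/eqP ->|uv vz]; first by rewrite !subrr normr0 mulr0.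
  have [c /andP[uc cv] E'] := segment_MVT uv
    (fun t _ => is_deriveZ (1 - m) (is_derive_kum t a0)).
  rewrite /stein (le_trans (ltW uv) vz) vz distrC [X in `|X|]E' normrM [`|v - u|]gtr0_norm ?subr_gt0//.
  rewrite ler_wpM2r ?subr_ge0 ?(ltW uv)//.
  by have := stein'_bound c; rewrite /stein' (le_trans (ltW cv) vz).
have right u v : z <= u -> u <= v -> `|stein u - stein v| <= stein_cst / al * (v - u).
  move=> zu; rewrite le_eqVlt => /orP[/eqP ->|uv]; first by rewrite !subrr normr0 mulr0.
  (* By continuity the right-hand formula also holds at z, so the mean value theorem applies up to
     the kink. *)
  have sE t : z <= t -> stein t = m * tail_ratio t.
    rewrite le_eqVlt => /orP[/eqP <-|zt]; first by rewrite /stein lexx stein_cont.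
    by rewrite /stein leNgt zt.
  have dt t : u <= t <= v -> is_derive t (1 : R) (fun t => m * tail_ratio t)
     (m * (tail_ratio t * (1 - a / t) - t^-1)).
    move=> /andP[ut _]; apply: (is_deriveZ m (is_derive_tail_ratio _)).
    exact: lt_le_trans (le_trans zu ut).
  have [c /andP[uc cv] E'] := segment_MVT uv dt.
  rewrite (sE u)// (sE v) ?(le_trans zu (ltW uv))// distrC E' normrM [`|v - u|]gtr0_norm ?subr_gt0//.
  rewrite ler_wpM2r ?subr_ge0 ?(ltW uv)//.
  have zc : z < c := le_lt_trans zu uc.
  by have := stein'_bound c; rewrite /stein' (leNgt c z) zc.
rewrite (distrC x) [`|y - x|]ger0_norm ?subr_ge0//.
have [yz|/ltW zy] := leP y z; first exact: left.
have [zx|/ltW xz] := leP z x; first exact: right.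
have -> : stein x - stein y = (stein x - stein z) + (stein z - stein y) by ring.
rewrite (le_trans (ler_normD _ _))//.
have := left x z xz (lexx z); have := right z y (lexx z) zy; lra.
Qed.

End Tail.
End GammaSeries.

(** * From the Stein equation to the Kolmogorov distance *)

Lemma measurable_le_event (R : realType) d (T : measurableType d) (f : T -> R) c :
  measurable_fun setT f -> measurable [set w | f w <= c].
Proof.
move=> mf; have -> : [set w | f w <= c] = f @^-1` `]-oo, c].
  by apply/seteqP; split=> w /=; rewrite in_itv.
by rewrite -[X in measurable X]setTI; exact: mf.
Qed.

(** * The distribution function of the centered Gamma law *)

Section GammaLaw.
Context (R : realType).
Notation mu := (@lebesgue_measure R).

Lemma gamma_law_le0 (a t : R) : t <= 0 -> gamma_law a `]-oo, t] = 0%E.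
Proof.
move=> t0; apply: integral0_eq => x; rewrite /= in_itv/= => xt.
by rewrite /gamma_pdf ltNge (le_trans xt t0).
Qed.

(** Upper tails keep away from 0, where the density is unbounded for a < 1. If [gamma_fun a] were 0,
    both sides would be 0 by the convention on division. *)
Lemma gamma_law_tail (a t : R) : 0 < a -> 0 < t ->
  gamma_law a `]t, +oo[ = ((gamma_total a - igamma a t) / gamma_fun a)%:E.
Proof.
move=> a0 t0.
have g0 : 0 <= gamma_fun a.
  by apply: Rintegral_ge0 => x _; rewrite mulr_ge0 ?powR_ge0 ?expR_ge0.
pose f x := x `^ (a - 1) * expR (- x) / gamma_fun a.
pose F x := igamma a x / gamma_fun a.
have dF (x : R) : 0 < x -> is_derive x (1 : R) F (f x).
  move=> x0; have := is_deriveZ (gamma_fun a)^-1 (is_derive_igamma a0 x0).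
  have -> : (gamma_fun a)^-1 \*: igamma a = F by apply/funext => y; rewrite /F /GRing.scale/= mulrC.
  by rewrite /GRing.scale/= mulrC.
have cf (x : R) : 0 < x -> {for x, continuous f}.
  move=> x0; apply: cvgM; last exact: cvg_cst.
  apply: cvgM.
    have := is_derive1_powR (a - 1) x0 => dp.
    exact: (differentiable_continuous ((derivable1_diffP _ _).1 (@ex_derive _ _ _ _ _ _ _ dp))).
  by apply: (cvg_comp -%R expR); [apply: cvgN; exact: cvg_id|exact: continuous_expR].
have mf : measurable_fun `[t, +oo[ (EFin \o f).
  apply/measurable_EFinP; apply: subspace_continuous_measurable_fun => //.
  apply: continuous_in_subspaceT => x; rewrite inE/= in_itv/= andbT => tx.
  by apply: cf; exact: lt_le_trans tx.
transitivity (\int[mu]_(x in `]t, +oo[) (f x)%:E)%E.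
  apply: eq_integral => x; rewrite inE/= in_itv/= andbT => tx.
  by rewrite /gamma_pdf (lt_trans t0 tx).
rewrite integral_itv_obnd_cbnd; last by apply: measurable_funS mf => //; move=> x /=; rewrite !in_itv/= !andbT; exact: ltW.
rewrite (@ge0_continuous_FTC2y _ f F t (gamma_total a / gamma_fun a)).
- by rewrite -EFinB /F mulrBl.
- by move=> x _; rewrite !mulr_ge0 ?powR_ge0 ?expR_ge0 ?invr_ge0.
- apply: continuous_in_subspaceT => x; rewrite inE/= in_itv/= andbT => tx.
  by apply: cf; exact: lt_le_trans tx.
- by apply: cvgM; [exact: cvg_igamma_total|exact: cvg_cst].
- by move=> x tx; exact: (@ex_derive _ _ _ _ _ _ _ (dF x (lt_trans t0 tx))).
- apply: cvg_at_right_filter; apply: differentiable_continuous; apply/derivable1_diffP.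
  exact: (@ex_derive _ _ _ _ _ _ _ (dF t t0)).
- move=> x; rewrite in_itv/= andbT => tx; rewrite derive1E.
  exact: (@derive_val _ _ _ _ _ _ _ (dF x (lt_trans t0 tx))).
Qed.

Definition gamma_cdf (a z : R) : R := if 0 < z then igamma a z / gamma_total a else 0.

Context (d : measure_display) (T : measurableType d) (Q : probability T R).
Variables (nu : R) (G : {RV Q >-> R}).
Hypothesis nu0 : 0 < nu.
Hypothesis lawG : has_law Q G (centered_gamma_law nu).
Let a := nu / 2.
Let a0 : 0 < a. Proof. by rewrite divr_gt0. Qed.

Let le_event (t : R) : Q [set w | G w <= 2 * t - nu] = gamma_law a `]-oo, t].
Proof.
have -> : [set w | G w <= 2 * t - nu] = G @^-1` `]-oo, 2 * t - nu].
  by apply/seteqP; split=> w /=; rewrite in_itv.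
rewrite lawG// /centered_gamma_law; congr gamma_law.
by apply/seteqP; split=> x /=; rewrite !in_itv/= lerD2r ler_pM2l.
Qed.

Let gt_event (t : R) : Q [set w | 2 * t - nu < G w] = gamma_law a `]t, +oo[.
Proof.
have -> : [set w | 2 * t - nu < G w] = G @^-1` `]2 * t - nu, +oo[.
  by apply/seteqP; split=> w /=; rewrite in_itv/= andbT.
rewrite lawG// /centered_gamma_law; congr gamma_law.
by apply/seteqP; split=> x /=; rewrite !in_itv/= !andbT ltrD2r ltr_pM2l.
Qed.

Let mle c : measurable [set w | G w <= c].
Proof. exact/measurable_le_event/measurable_funPT. Qed.

Let compl (t : R) : Q [set w | 2 * t - nu < G w] = (1 - Q [set w | (G w <= 2 * t - nu)%R])%E.
Proof.
rewrite -probability_setC//; congr (Q _).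
by apply/seteqP; split=> w /=; rewrite ltNge => /negP.
Qed.

(** [gamma_fun a] would be 0 by default if its integral diverged. The existence of G decides: its
    law gives mass 1 to the upper half-line, and exhausting this by the tails beyond 1 / (n + 1)
    yields 1 = gamma_total / gamma_fun. *)
Lemma gamma_total_fun : 0 < gamma_total a /\ gamma_fun a = gamma_total a.
Proof.
have h0 : Q [set w | 2 * 0 - nu < G w] = 1%E.
  by rewrite compl le_event gamma_law_le0// sube0.
pose D n := [set w | 2 * n.+1%:R^-1 - nu < G w].
have mD n : measurable (D n).
  rewrite (_ : D n = ~` [set w | G w <= 2 * n.+1%:R^-1 - nu]); first exact: measurableC.
  by apply/seteqP; split=> w /=; rewrite /D/= ltNge => /negP.
have UD : \bigcup_n D n = [set w | 2 * 0 - nu < G w].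
  apply/seteqP; split=> w /=.
    by move=> [n _]; apply: lt_trans; rewrite ltrD2r ltr_pM2l// invr_gt0.
  rewrite mulr0 sub0r => h; pose e := (G w + nu) / 2.
  have e0 : 0 < e by rewrite divr_gt0//; lra.
  have [n /= _ hn] := near_infty_natSinv_lt (PosNum e0).
  exists n => //; rewrite /D/=; have : n.+1%:R^-1 < e by exact: hn n (leqnn n).
  by rewrite /e; move: h; move: (n.+1%:R^-1) (G w : R) => p q; lra.
have c1 : (fun n => (Q \o D) n) @ \oo --> 1%E.
  rewrite -h0 -UD; apply: nondecreasing_cvg_mu => //; first exact: bigcup_measurable.
  move=> n m nm; apply/subsetPset => w; rewrite /D/=; apply: le_lt_trans.
  by rewrite lerD2r ler_pM2l// lef_pV2 ?posrE// ler_nat.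
have c2 : (gamma_total a - igamma a n.+1%:R^-1) / gamma_fun a @[n --> \oo] --> (gamma_total a - 0) / gamma_fun a.
  apply: cvgM; last exact: cvg_cst.
  apply: cvgB; first exact: cvg_cst.
  apply: ((cvg_at_rightP _ _ _).1 (igamma_cvg0 a0) (fun n => n.+1%:R^-1)).
  by split=> [n|]; [rewrite invr_gt0|exact: cvg_harmonic].
have E : 1 = gamma_total a / gamma_fun a.
  rewrite subr0 in c2.
  have c3 : fine (Q (D n)) @[n --> \oo] --> (1 : R) by apply: fine_cvg.
  apply: (cvg_to_unique _ c3 c2) => n.
  by rewrite /D gt_event gamma_law_tail// invr_gt0.
(* Division by 0 returns 0, so [E] rules out a vanishing normalization. *)
have g0 : gamma_fun a != 0.
  by apply/eqP => h; move: E; rewrite h invr0 mulr0 => /eqP; rewrite oner_eq0.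
have e : gamma_fun a = gamma_total a.
  by apply: (mulIf (invr_neq0 g0)); rewrite divff.
split=> //; rewrite -e lt_neqAle eq_sym g0/=.
by apply: Rintegral_ge0 => x _; rewrite mulr_ge0 ?powR_ge0 ?expR_ge0.
Qed.

Lemma centered_gamma_cdf x : Q [set w | G w <= x] = (gamma_cdf a ((x + nu) / 2))%:E.
Proof.
have xE : x = 2 * ((x + nu) / 2) - nu by field.
rewrite /gamma_cdf; case: ltP => z0; last by rewrite [in LHS]xE le_event gamma_law_le0.
have [tot0 totE] := gamma_total_fun.
have := compl ((x + nu) / 2); rewrite gt_event gamma_law_tail// -xE totE.
have : Q [set w | G w <= x] \is a fin_num by exact: fin_num_measure.
case: (Q _) => // q _ /eqP; rewrite -EFinB eqe => /eqP E; congr EFin.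
have -> : q = 1 - (1 - q) by ring.
by rewrite -E; field; rewrite gt_eqF.
Qed.

End GammaLaw.

Section SinScale.
Context (R : realType).

Lemma is_derive_sin_scale (k : nat) (x : R) :
  is_derive x (1 : R) (fun x => k.+1%:R * sin (x / k.+1%:R)) (cos (x / k.+1%:R)).
Proof.
have k0 : (k.+1%:R : R) != 0 by rewrite pnatr_eq0.
have d1 : is_derive x (1 : R) (fun x : R => x / k.+1%:R) k.+1%:R^-1.
  have := is_deriveZ (k.+1%:R^-1 : R) (is_derive_id x (1 : R)).
  rewrite [_ *: 1]mulr1; congr is_derive.
  by apply/funext => y; rewrite /GRing.scale/= mulrC.
have d2 := @is_derive1_comp R sin (fun x => x / k.+1%:R) x _ _ (is_derive_sin (x / k.+1%:R)) d1.
have := is_deriveZ (k.+1%:R : R) d2.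
by rewrite /GRing.scale/= mulrCA mulfV// mulr1.
Qed.

Lemma sin_le_norm (x : R) : `|sin x| <= `|x|.
Proof.
have := derive_bound_lipschitz (@is_derive_sin R) (@cos_max R) x 0.
by rewrite sin0 !subr0 mul1r.
Qed.

Lemma cvg_sin_scale (x : R) : k.+1%:R * sin (x / k.+1%:R) @[k --> \oo] --> x.
Proof.
have d1 : is_derive (0 : R) (1 : R) (fun t : R => x * t) x.
  have := is_deriveZ x (is_derive_id (0 : R) (1 : R)).
  by rewrite [_ *: 1]mulr1.
have d2 : is_derive (0 : R) (1 : R) (fun t : R => sin (x * t)) x.
  have := @is_derive1_comp R sin (fun t => x * t) 0 _ _ (is_derive_sin (x * 0)) d1.
  by rewrite mulr0 cos0 mul1r.
have := cvg_dquot d2; apply: cvg_trans; apply: near_eq_cvg; apply: nearW => k.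
by rewrite /dquot mulr0 sin0 !sub0r (mulrN x) sinN opprK.
Qed.

End SinScale.

(** * Bound on the distance of distribution functions at one point *)

Section SteinBound.
Context (R : realType) (d : measure_display) (T : measurableType d) (P : probability T R).
Variables (F G : T -> R).
Hypotheses (iF : L1 P F) (iG : L1 P G).
Hypothesis C2 : forall (phi phi' phi'' : R -> R) (M : R),
  (forall x : R, is_derive x (1 : R) phi (phi' x)) ->
  (forall x : R, is_derive x (1 : R) phi' (phi'' x)) -> continuous phi'' ->
  (forall x, `|phi x| <= M) -> (forall x, `|phi' x| <= M) -> (forall x, `|phi'' x| <= M) ->
  Ex P (fun w => F w * phi (F w)) = Ex P (fun w => G w * phi' (F w)).
Hypothesis i2F : L2 P F.

(** The test function x is unbounded; it is replaced by (k + 1) sin(x / (k + 1)), which is dominated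
    by |x|, tends to x, and has a derivative bounded by 1 that tends to 1. *)
Lemma Ex_gamma1 : Ex P G = Ex P (fun w => F w ^+ 2).
Proof.
pose s (k : nat) (x : R) := k.+1%:R * sin (x / k.+1%:R).
have E k : Ex P (fun w => F w * s k (F w)) = Ex P (fun w => G w * cos (F w / k.+1%:R)).
  apply: (@ibp_C1 _ _ _ _ _ _ iF iG C2 (s k) (fun x => cos (x / k.+1%:R)) k.+1%:R).
  - by move=> x; exact: is_derive_sin_scale.
  - move=> x; apply: (cvg_comp (fun x : R => x / k.+1%:R) cos); last exact: continuous_cos.
    by apply: cvgM; [exact: cvg_id|exact: cvg_cst].
  - by move=> x; rewrite /s normrM ger0_norm// ler_piMr// sin_max.
  - by move=> x; rewrite (le_trans (cos_max _))// ler1n.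
have mF : measurable_fun setT F by exact: L1_meas iF.
have mG : measurable_fun setT G by exact: L1_meas iG.
have mdiv k : measurable_fun setT (fun w => F w / k.+1%:R) by exact: measurable_funM.
have c0 (x : R) : x / k.+1%:R @[k --> \oo] --> (0 : R).
  by rewrite -[X in _ --> X](mulr0 x); apply: cvgM; [exact: cvg_cst|exact: cvg_harmonic].
have [||||_ l1] := @dominated_Ex _ _ _ P (fun k w => F w * s k (F w)) (fun w => F w ^+ 2) (fun w => F w ^+ 2).
- move=> k; apply: measurable_funM => //; apply: measurable_funM => //.
  exact: (measurableT_comp (continuous_measurable_fun (@continuous_sin R)) (mdiv k)).
- by move=> w; rewrite expr2; apply: cvgM; [exact: cvg_cst|exact: cvg_sin_scale].
- move=> k w; rewrite normrM -[leRHS]real_normK ?num_real// expr2 ler_wpM2l// /s normrM.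
  rewrite ger0_norm// -ler_pdivlMl// (le_trans (sin_le_norm _))// normrM mulrC.
  by rewrite [X in X * _]ger0_norm ?invr_ge0.
- by case: i2F.
have [||||_ l2] := @dominated_Ex _ _ _ P (fun k w => G w * cos (F w / k.+1%:R)) G (fun w => `|G w|).
- move=> k; apply: measurable_funM => //.
  exact: (measurableT_comp (continuous_measurable_fun (@continuous_cos R)) (mdiv k)).
- move=> w; rewrite -[X in _ --> X]mulr1; apply: cvgM; first exact: cvg_cst.
  have := cvg_comp _ cos (c0 (F w)) (continuous_cos (x := 0)).
  by rewrite cos0.
- by move=> k w; rewrite normrM ler_piMr// cos_max.
- exact: L1_norm.
exact: (cvg_to_unique (fun k => esym (E k)) l2 l1).
Qed.

Variable nu : R.
Hypothesis nu0 : 0 < nu.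
Let a := nu / 2.
Let a0 : 0 < a. Proof. by rewrite divr_gt0. Qed.
Hypothesis tot0 : 0 < gamma_total a.
Hypothesis iD : L2 P (fun w => G w - 2 * F w - 2 * nu).

Let le_indic c : (fun w => (F w <= c)%R%:R) = \1_[set w | F w <= c] :> (T -> R).
Proof.
apply/funext => w; rewrite indicE; congr (nat_of_bool _)%:R.
by apply/idP/idP => [h|]; [apply/mem_set|move/set_mem].
Qed.

Let mevent c : measurable [set w | F w <= c].
Proof. exact/measurable_le_event/(L1_meas iF). Qed.

Lemma L1_le_event c : L1 P (fun w => (F w <= c)%R%:R).
Proof.
apply: (@L1_bounded _ _ _ _ _ 1) => [|w]; last by case: (F w <= c); rewrite ?normr1 ?normr0.
by rewrite le_indic; exact: measurable_indic.
Qed.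

Lemma Ex_le_event c : Ex P (fun w => (F w <= c)%R%:R) = fine (P [set w | F w <= c]).
Proof. by rewrite le_indic /Ex /Rintegral integral_indic// setIT. Qed.

Lemma stein_discrepancy z al : 0 < al -> al <= 1 -> al <= z ->
  `|fine (P [set w | F w <= 2 * z - nu]) - igamma a z / gamma_total a| <=
  stein_cst a / al * Num.sqrt (Ex P (fun w => (G w - 2 * F w - 2 * nu) ^+ 2)).
Proof.
move=> al0 al1 alz; have z0 : 0 < z := lt_le_trans al0 alz.
set m := igamma a z / gamma_total a; set C := stein_cst a / al.
pose Y y := (y + nu) / 2.
pose phi y := stein a z (Y y); pose psi y := stein' a z (Y y) / 2.
have C0 : 0 <= C := le_trans (normr_ge0 _) (stein_bound a0 z0 tot0 al0 al1 0).
have lphi x y : `|phi x - phi y| <= C * `|x - y|.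
  rewrite (le_trans (stein_lipschitz a0 z0 tot0 al0 al1 alz _ _))// ler_wpM2l//.
  have -> : Y x - Y y = (x - y) / 2 by rewrite /Y; field.
  by rewrite normrM [`|2^-1|]ger0_norm// ler_piMr//; lra.
have lpsi y : dquot n phi y @[n --> \oo] --> psi y.
  have [f [df [e e0 fe]]] := stein_left_germ a0 z0 (Y y).
  have d1 : is_derive y (1 : R) Y 2^-1.
    have := is_deriveZ (2^-1 : R) (is_deriveD (is_derive_id y (1 : R)) (is_derive_cst nu y (1 : R))).
    rewrite addr0 [_ *: 1]mulr1; congr is_derive.
    by apply/funext => t; exact: mulrC.
  have d2 := @is_derive1_comp R f Y y _ _ df d1.
  (* For n large, the backward step stays in the interval where [stein] agrees with [f]. *)
  have := cvg_dquot d2; apply: cvg_trans; apply: near_eq_cvg.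
  have [N _ hN] := near_infty_natSinv_lt (PosNum e0).
  exists N => // n Nn /=; rewrite /dquot /phi /=.
  have hn : n.+1%:R^-1 < e by exact: hN n Nn.
  have q0 : 0 < n.+1%:R^-1 :> R by rewrite invr_gt0.
  have f1 : stein a z (Y y) = f (Y y).
    by apply: fe; rewrite lexx andbT ltrBlDr ltrDl.
  have f2 : stein a z (Y (y - n.+1%:R^-1)) = f (Y (y - n.+1%:R^-1)).
    apply: fe; move: q0 hn; rewrite /Y; move: (n.+1%:R^-1) => q q0 hn.
    by apply/andP; split; lra.
  by rewrite f1 f2.
have bphi y : `|phi y| <= C by exact: stein_bound.
have [i1 i2 E] := ibp_lipschitz iF iG C2 bphi lphi lpsi.
pose D w := (G w - 2 * F w - 2 * nu) * stein' a z (Y (F w)).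
(* Four times the Stein equation at Y, where Y - a = F / 2 and stein' = 2 psi. The last term has
   expectation 0 by integration by parts. *)
have key w : D w = 4 * (m - (F w <= 2 * z - nu)%R%:R) + 2 * (G w * psi (F w) - F w * phi (F w)).
  have := stein_ode a0 z0 (Y (F w)); rewrite -/m.
  have -> : (Y (F w) <= z) = (F w <= 2 * z - nu) by apply/idP/idP; rewrite /Y; lra.
  rewrite /D /psi /phi; set s' := stein' _ _ _; set s := stein _ _ _; set b := (_ <= _)%R%:R => h.
  have -> : b = m + (Y (F w) * s' - (Y (F w) - a) * s) by rewrite h; ring.
  by rewrite /Y /a; field.
have i3 := L1_le_event (2 * z - nu).
have i4 : L1 P (fun w => 4 * (m - (F w <= 2 * z - nu)%R%:R)) by apply/L1Z/L1B => //; exact: L1_cst.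
have i5 : L1 P (fun w => 2 * (G w * psi (F w) - F w * phi (F w))) by exact/L1Z/L1B.
have iDw : L1 P D by rewrite (funext key); exact: L1D i4 i5.
have ED : Ex P D = 4 * (m - fine (P [set w | F w <= 2 * z - nu])).
  rewrite (eq_Ex _ key) ExD// !ExZ ?ExB//; [|exact: L1_cst|exact: L1B|apply: L1B => //; exact: L1_cst].
  by rewrite Ex_cst Ex_le_event E subrr mulr0 addr0.
have : `|Ex P D| <= C * Num.sqrt (Ex P (fun w => (G w - 2 * F w - 2 * nu) ^+ 2)).
  rewrite (le_trans (Ex_norm iDw))//.
  have h1 : Ex P (fun w => `|D w|) <= Ex P (fun w => C * `|(G w - 2 * F w - 2 * nu) * 1|).
    apply: Ex_le; [exact: L1_norm|by apply/L1Z/L1_norm/(L2M iD)/L2_cst|move=> w].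
    by rewrite mulr1 normrM mulrC ler_wpM2r// stein'_bound.
  rewrite (le_trans h1)// ExZ; last by apply/L1_norm/(L2M iD)/L2_cst.
  rewrite ler_wpM2l// (le_trans (Ex_cauchy_schwarz iD (L2_cst P 1)))//.
  by rewrite [X in _ * X](_ : _ = 1) ?mulr1// expr1n Ex_cst sqrtr1.
rewrite ED normrM [`|4|]ger0_norm// -[`|m - _|]distrC.
have := normr_ge0 (fine (P [set w | F w <= 2 * z - nu]) - m).
move: (`|_ - m|) => q q0; lra.
Qed.

Let S := Num.sqrt (Ex P (fun w => (G w - 2 * F w - 2 * nu) ^+ 2)).
Let p (x : R) := fine (P [set w | F w <= x]).

Let gap x := `|p x - gamma_cdf a ((x + nu) / 2)|.

Let p_homo x y : x <= y -> p x <= p y.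
Proof.
move=> xy; rewrite /p -!Ex_le_event; apply: Ex_le => [||w]; [exact: L1_le_event..|].
by rewrite ler_nat; case: (leP (F w) x) => // Fx; rewrite (le_trans Fx xy).
Qed.

Let p_ge0 x : 0 <= p x. Proof. by rewrite /p -Ex_le_event; apply: Ex_ge0. Qed.

Let p_le1 x : p x <= 1.
Proof.
rewrite /p -Ex_le_event -[leRHS](Ex_cst P 1).
by apply: Ex_le => [||w]; [exact: L1_le_event|exact: L1_cst|case: (F w <= x)].
Qed.

Let cdf01 z : 0 <= gamma_cdf a z <= 1.
Proof.
rewrite /gamma_cdf; case: ltP => z0; last by rewrite lexx ler01.
by rewrite divr_ge0 ?igamma_ge0 ?(ltW tot0)//= ler_pdivrMr// mul1r igamma_le_total.
Qed.

Lemma kolmogorov_gap_le1 x : gap x <= 1.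
Proof.
have := p_ge0 x; have := p_le1 x; have /andP[] := cdf01 ((x + nu) / 2).
by rewrite /gap => *; rewrite ler_norml; apply/andP; split; lra.
Qed.

Lemma kolmogorov_gap_split x al : 0 < al -> al <= 1 ->
  gap x <= al `^ a / (a * gamma_total a) + stein_cst a / al * S.
Proof.
move=> al0 al1; pose z := (x + nu) / 2.
have xE : x = 2 * z - nu by rewrite /z; field.
have m_le : igamma a al / gamma_total a <= al `^ a / (a * gamma_total a).
  by rewrite invfM mulrA ler_wpM2r ?invr_ge0 ?(ltW tot0)// igamma_small.
have [alz|zal] := leP al z.
  have z0 := lt_le_trans al0 alz.
  rewrite /gap /gamma_cdf -/z z0 [X in p X]xE.
  apply: (le_trans (stein_discrepancy al0 al1 alz)).
  by rewrite lerDr divr_ge0 ?powR_ge0// mulr_ge0 ?ltW.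
have h1 := stein_discrepancy al0 al1 (lexx al); rewrite -/S in h1.
have h2 : p x <= p (2 * al - nu) by apply: p_homo; rewrite xE; lra.
have h3 : gamma_cdf a z <= igamma a al / gamma_total a.
  rewrite /gamma_cdf; case: ltP => z0; last by rewrite divr_ge0 ?igamma_ge0 ?ltW.
  by rewrite ler_wpM2r ?invr_ge0 ?(ltW tot0)// igamma_le// ltW.
(* Both distribution functions lie between 0 and their values at [al], and [h1] bounds the value for
   F by that for the Gamma law plus the error. *)
have /andP[h4 _] := cdf01 z; have h5 := p_ge0 x.
have h6 : 0 <= stein_cst a / al * S := le_trans (normr_ge0 _) h1.
move: h1; rewrite -/(p _) ler_norml => /andP[_ h1].
rewrite /gap -/z; move: (stein_cst a / al * S) (igamma a al / gamma_total a) (al `^ a / _)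
  h1 h2 h3 h4 h5 h6 m_le => A B D *.
by rewrite ler_norml; apply/andP; split; lra.
Qed.

Lemma kolmogorov_gap x : S <= 1 ->
  gap x <= ((a * gamma_total a)^-1 + stein_cst a) * S `^ (nu / (nu + 2)).
Proof.
move=> S1; have S0 : 0 <= S by exact: sqrtr_ge0.
have n2 : 0 < nu + 2 by move: nu0; lra.
(* For S = 0 the balanced choice would be al = 0, which is excluded; instead al tends to 0. *)
have [s0|s0] := eqVneq S 0.
  rewrite s0 powR0 ?mulr0; last by rewrite gt_eqF// divr_gt0.
  have l : al `^ a / (a * gamma_total a) @[al --> 0^'+] --> 0 / (a * gamma_total a).
    by apply: cvgM; [exact: powR_cvg0|exact: cvg_cst].
  rewrite mul0r in l; apply: (ler_cvg_to (cvg_cst (gap x)) l); near=> al.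
  have := @kolmogorov_gap_split x al; rewrite s0 mulr0 addr0; apply.
    by near: al; exact: nbhs_right_gt.
  by near: al; apply: nbhs_right_le; exact: ltr01.
have Sp : 0 < S by rewrite lt_def s0.
pose al := S `^ (2 / (nu + 2)).
have al0 : 0 < al by exact: powR_gt0.
have al1 : al <= 1.
  by rewrite -[leRHS](powRr0 S) ger_powR ?Sp// divr_ge0 ?(ltW n2).
apply: (le_trans (kolmogorov_gap_split x al0 al1)).
have e1 : al `^ a = S `^ (nu / (nu + 2)).
  by rewrite /al -powRrM; congr powR; rewrite /a; field; rewrite gt_eqF.
have e2 : S / al = S `^ (nu / (nu + 2)).
  rewrite /al -powRN -[X in X * _](powRr1 S0) -powRD ?s0 ?implybT//; congr powR.
  by field; rewrite gt_eqF.
have -> : stein_cst a / al * S = stein_cst a * (S / al) by rewrite mulrAC mulrA.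
rewrite e1 e2 le_eqVlt; apply/orP; left; apply/eqP.
by move: (_ `^ _) (a * _)^-1 => t i; ring.
Unshelve. all: by end_near. Qed.

End SteinBound.

Section Variance.
Context (R : realType) (d : measure_display) (T : measurableType d) (P : probability T R).

(** Integration by parts provides integrability only; square integrability is drawn from the
    finiteness of the variance. *)
Lemma variance_lty (X : T -> R) : L1 P X -> ('V_P[X] < +oo)%E ->
  L2 P (fun w => X w - Ex P X) /\ 'V_P[X] = (Ex P (fun w => (X w - Ex P X) ^+ 2))%:E.
Proof.
move=> iX; have mX := L1_meas iX.
have E : 'V_P[X] = (\int[P]_w ((X w - Ex P X) ^+ 2)%:E)%E.
  rewrite /variance unlock [in LHS]unlock; apply: eq_integral => w _.
  by rewrite expr2.
move=> Vfin; have mD : measurable_fun setT (fun w => X w - Ex P X) by exact: measurable_funB.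
have i2 : L2 P (fun w => X w - Ex P X).
  split=> //; apply/integrableP; split; first by apply/measurable_EFinP; exact: measurable_funX.
  rewrite E in Vfin; apply: le_lt_trans Vfin; rewrite le_eqVlt; apply/orP; left; apply/eqP.
  by apply: eq_integral => w _; rewrite /= ger0_norm ?sqr_ge0.
by split=> //; rewrite E EFin_Ex//; case: i2.
Qed.

End Variance.

Theorem theorem6p8 (R : realType) (nu : R) (hnu : 0 < nu) :
  exists2 C : R, 0 < C &
    forall (H : completeNormedModType R) (ip : H -> H -> R)
           (d : measure_display) (T : measurableType d) (P : probability T R)
           (W : H -> {RV P >-> R})
           (d' : measure_display) (T' : measurableType d')
           (Q : probability T' R) (G : {RV Q >-> R})
           (F Gamma1F : {RV P >-> R}),
      hilbert_product ip -> separable H -> isonormal ip W ->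
      has_law Q G (centered_gamma_law nu) ->
      finite_chaos ip W F ->
      ('E_P[F] = 0)%E ->
      ('E_P[fun w => (F w ^+ 2)%R] = (2 * nu)%:E)%E ->
      is_Gamma1 ip W F Gamma1F ->
      (kolmogorov_distance P Q F G <=
        C%:E * 'V_P[fun w => (Gamma1F w - 2 * F w)%R]
                 `^ (if 2 <= nu then 4^-1 else nu / (2 * (nu + 2)))%R)%E.
Proof.
pose a := nu / 2.
(* The constant precedes G, whose law is what yields gamma_total a > 0; the absolute value gives a
   nonnegative constant in advance. *)
pose K := `|(a * gamma_total a)^-1 + stein_cst a|.
have K0 : 0 <= K by exact: normr_ge0.
(* The summand 1 serves variances above 1, where the distance is at most 1. *)
exists (1 + K); first by rewrite ltr_pwDl.
move=> H ip d T P W d' T' Q G F X hip _ iW lawG _ EF EF2 [V [u [v [LV dF dV XE]]]].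
set r := (if _ then _ else _).
have n2 : 0 < nu + 2 by rewrite addr_gt0.
have r0 : 0 < r by rewrite /r; case: ifP => _; rewrite ?invr_gt0// divr_gt0// mulr_gt0.
have [_ iF2 _ _] := malliavin_L2 hip iW dF.
have iF := L2_L1 iF2.
have F0 : Ex P F = 0 by move: EF; rewrite unlock EFin_Ex// => -[].
have F2 : Ex P (fun w => F w ^+ 2) = 2 * nu.
  by move: EF2; rewrite unlock EFin_Ex; [move=> []|case: iF2].
have C2 : forall (phi phi' phi'' : R -> R) (M : R),
    (forall x : R, is_derive x (1 : R) phi (phi' x)) ->
    (forall x : R, is_derive x (1 : R) phi' (phi'' x)) -> continuous phi'' ->
    (forall x, `|phi x| <= M) -> (forall x, `|phi' x| <= M) -> (forall x, `|phi'' x| <= M) ->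
    Ex P (fun w => F w * phi (F w)) = Ex P (fun w => X w * phi' (F w)).
  move=> phi phi' phi'' M h1 h2 h3 h4 h5 h6.
  by have [_] := malliavin_ibp_C2 hip iW h1 h2 h3 h4 h5 h6 LV dF dV XE F0.
have iX : L1 P X.
  (* Integrability of X does not depend on the test function, so the zero function is used. *)
  have z (x : R) : is_derive x (1 : R) (fun=> 0 : R) 0 by exact: is_derive_cst.
  have b (x : R) : `|0 : R| <= 0 by rewrite normr0.
  have c : continuous (fun _ : R => 0 : R) by move=> x; exact: cst_continuous.
  by have [] := malliavin_ibp_C2 hip iW z z c b b b LV dF dV XE F0.
(* This is what turns the mean square of X - 2 F - 2 nu into the variance of X - 2 F. *)
have X0 : Ex P X = 2 * nu by rewrite -F2; exact: (Ex_gamma1 iF iX C2 iF2).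
have iD : L1 P (fun w => X w - 2 * F w) by apply/L1B => //; exact: L1Z.
have ED : Ex P (fun w => X w - 2 * F w) = 2 * nu.
  by rewrite ExB// ?ExZ ?F0 ?X0 ?mulr0 ?subr0//; exact: L1Z.
have [tot0 _] := gamma_total_fun hnu lawG; rewrite -/a in tot0.
apply: ge_ereal_sup => _ [x _ <-].
rewrite (centered_gamma_cdf hnu lawG).
(* An infinite variance makes the right-hand side infinite, as r > 0 and the constant is
   positive. *)
have [Voo|] := boolP ('V_P[fun w => (X w - 2 * F w)%R] == +oo)%E.
  by rewrite (eqP Voo) poweRyr ?gt_eqF// gt0_muley ?leey// lte_fin ltr_pwDl.
rewrite -ltey => /(variance_lty iD)[]; rewrite ED => iD2 ->.
set v2 := Ex P _; rewrite poweR_EFin -EFinM.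
have -> : P [set w | F w <= x] = (fine (P [set w | F w <= x]))%:E.
  by rewrite fineK// fin_num_measure//; exact/measurable_le_event/(L1_meas iF).
rewrite lee_fin -/a.
have := kolmogorov_gap_le1 iF hnu tot0 x.
have v0 : 0 <= v2 by apply: Ex_ge0 => w; exact: sqr_ge0.
have [v1|/ltW v1] := leP v2 1; last first.
  move=> h; apply: (le_trans h); rewrite (le_trans (_ : 1 <= 1 * v2 `^ r))//.
    by rewrite mul1r -[leLHS](powRr0 v2) ler_powR// ltW.
  by rewrite ler_wpM2r ?powR_ge0// lerDl.
move=> _; have := @kolmogorov_gap _ _ _ _ F X iF iX C2 nu hnu tot0 iD2 x.
rewrite -/v2 => /(_ _)/le_trans; apply.
  by rewrite -sqrtr1 ler_sqrt.
rewrite -powR12_sqrt// -powRrM; set q := 2^-1 * _.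
(* On ]0, 1] a smaller exponent gives a larger power, and r <= q in both cases; base 0 is handled
   apart, both powers being 0. *)
have qr : v2 `^ q <= v2 `^ r.
  have [v20|v20] := eqVneq v2 0.
    by rewrite v20 !powR0 ?gt_eqF// mulr_gt0// divr_gt0.
  apply: ger_powR; first by rewrite lt_def v20 v0.
  have qE : q = nu / (2 * (nu + 2)) by rewrite /q; field; rewrite gt_eqF.
  rewrite /r qE; case: ifP => // nu2.
  by rewrite ler_pdivlMr ?mulr_gt0//; lra.
rewrite (le_trans (_ : _ <= K * v2 `^ q))//; first by rewrite ler_wpM2r ?powR_ge0// ler_norm.
by rewrite ler_pM ?powR_ge0// lerDr.
Qed.
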